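(* Let $f\not\equiv 0$ be a weakly holomorphic modular function for $\mathrm{SL}(2,\mathbb{Z})$ such that $f(e^{it})$ is real and non-negative for all $t\in[\pi/3,2\pi/3]$, and let $\phi=\frac{1+\sqrt5}{2}$. For every $x\in\mathbb{P}^1(\mathbb{R})$ we have $0\le\Lambda_f(x)\le\Lambda_f(\phi)$. Moreover every value in $[0,\Lambda_f(\phi)]$ is attained by $\Lambda_f$, i.e. $\Lambda_f(\mathbb{P}^1(\mathbb{R}))=[0,\Lambda_f(\phi)]$.
   Context: Let $T=\begin{pmatrix}1&1\\0&1\end{pmatrix}$, $V=\begin{pmatrix}1&0\\1&1\end{pmatrix}$, acting by Möbius transformations. For hyperbolic $A\in\mathrm{SL}(2,\mathbb{Z})$ with repelling/attracting fixed points $w,\tilde w$, let $Q(x,y)=ax^2+bxy+cy^2$ be the primitive integral form vanishing at $(w,1),(\tilde w,1)$ with $\mathrm{sgn}(a)=\mathrm{sgn}(w-\tilde w)$, $D=b^2-4ac$, and $I_f(A)=\int_{\tau_0}^{A\tau_0}\frac{f(\tau)\sqrt D}{Q(\tau,1)}d\tau$ ($\tau_0\in\mathbb{H}$ arbitrary); $I_f(A)=0$ if $A$ is not hyperbolic. For $x\in(0,\infty)$ let $(A_n)_{n\ge0}$ be the unique sequence in $\mathrm{SL}(2,\mathbb{Z}_{\ge0})$ with $A_0=I$, $A_n^{-1}A_{n+1}\in\{T,V\}$, $A_n(1)\to x$, whose letters contain infinitely many $T$'s and $V$'s if $x$ is irrational and are eventually all $V$ if $x$ is rational (the Farey path of $x$;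 for $x=[a_1;a_2,\dots]$ irrational, $A_n$ is the prefix of length $n$ of the infinite word $T^{a_1}V^{a_2}T^{a_3}V^{a_4}\cdots$). Define $\Lambda_f(x)=\limsup_{n}\mathrm{Re}(I_f(A_n))/n$ for $x\in(0,\infty)$, and extend to $\mathbb{P}^1(\mathbb{R})$ by $\Lambda_f(x)=\Lambda_f(-x)$ for $x<0$ and $\Lambda_f(0)=\Lambda_f(\infty)=0$ (this is the $\mathrm{GL}(2,\mathbb{Z})$-invariant extension). *)

(* Defs.v *)
From Stdlib Require Import Reals ZArith Qreals ClassicalEpsilon.
From Coquelicot Require Import Coquelicot.
Open Scope R_scope.

Record mat2 : Set := Mat2 { ma : Z; mb : Z; mc : Z; md : Z }.

Definition mdet (A : mat2) : Z := (ma A * md A - mb A * mc A)%Z.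
Definition mtrace (A : mat2) : Z := (ma A + md A)%Z.
Definition mone : mat2 := Mat2 1 0 0 1.
Definition mmul (A B : mat2) : mat2 :=
  Mat2 (ma A * ma B + mb A * mc B) (ma A * mb B + mb A * md B)
       (mc A * ma B + md A * mc B) (mc A * mb B + md A * md B).

(* The adjugate, which is the inverse on SL(2,Z). *)
Definition minv (A : mat2) : mat2 := Mat2 (md A) (- mb A) (- mc A) (ma A).

Definition SL2Z (A : mat2) : Prop := mdet A = 1%Z.
Definition SL2Z_nonneg (A : mat2) : Prop :=
  SL2Z A /\ (0 <= ma A)%Z /\ (0 <= mb A)%Z /\ (0 <= mc A)%Z /\ (0 <= md A)%Z.

Definition matT : mat2 := Mat2 1 1 0 1.
Definition matV : mat2 := Mat2 1 0 1 1.

Definition mobR (A : mat2) (x : R) : R :=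
  (IZR (ma A) * x + IZR (mb A)) / (IZR (mc A) * x + IZR (md A)).
Definition mobC (A : mat2) (z : C) : C :=
  ((RtoC (IZR (ma A)) * z + RtoC (IZR (mb A)))
   / (RtoC (IZR (mc A)) * z + RtoC (IZR (md A))))%C.

Definition upper_half (tau : C) : Prop := 0 < Im tau.

Definition Cexp (z : C) : C := (exp (Re z) * cos (Im z), exp (Re z) * sin (Im z)).

Definition nome (tau : C) : C := Cexp (RtoC 2 * RtoC PI * Ci * tau)%C.

(* The last clause is the q-expansion f = q^(-N) * sum_(n >= 0) a_n q^n, i.e.
   f has at most a pole at the cusp. *)
Definition weakly_holomorphic_modular_function (f : C -> C) : Prop :=
  (forall tau, upper_half tau ->
     ex_derive (K := C_AbsRing) (V := C_NormedModule) f tau) /\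
  (forall A tau, SL2Z A -> upper_half tau -> f (mobC A tau) = f tau) /\
  (exists (N : nat) (a : nat -> C), forall tau, upper_half tau ->
     is_pseries (K := C_AbsRing) (V := C_NormedModule) a (nome tau)
       (nome tau ^ N * f tau)%C).

Definition hyperbolic (A : mat2) : Prop := (2 < Z.abs (mtrace A))%Z.

(* The first clause says that w is not mapped to infinity.  The fixed points of
   a hyperbolic element of SL(2,Z) are irrational, hence finite. *)
Definition fixed_point (A : mat2) (w : R) : Prop :=
  IZR (mc A) * w + IZR (md A) <> 0 /\ mobR A w = w.
Definition repelling (A : mat2) (w : R) : Prop :=
  fixed_point A w /\ 1 < Rabs (Derive (mobR A) w).
Definition attracting (A : mat2) (w : R) : Prop :=
  fixed_point A w /\ Rabs (Derive (mobR A) w) < 1.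

(* The form a x^2 + b x y + c y^2. *)
Record qform : Set := QForm { qa : Z; qb : Z; qc : Z }.

Definition qprimitive (Q : qform) : Prop :=
  Z.gcd (qa Q) (Z.gcd (qb Q) (qc Q)) = 1%Z.
Definition qdisc (Q : qform) : Z := (qb Q * qb Q - 4 * qa Q * qc Q)%Z.
Definition qeval (Q : qform) (x y : C) : C :=
  (RtoC (IZR (qa Q)) * x * x + RtoC (IZR (qb Q)) * x * y
   + RtoC (IZR (qc Q)) * y * y)%C.

Definition is_form_of (A : mat2) (Q : qform) : Prop :=
  qprimitive Q /\
  exists w wt : R,
    repelling A w /\ attracting A wt /\
    qeval Q (RtoC w) (RtoC 1) = RtoC 0 /\ qeval Q (RtoC wt) (RtoC 1) = RtoC 0 /\
    sign (IZR (qa Q)) = sign (w - wt).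

(* A hyperbolic A in SL(2,Z) has exactly one such form, so that epsilon merely
   names it. *)
Definition form_of (A : mat2) : qform :=
  epsilon (inhabits (QForm 0 0 0)) (is_form_of A).

Definition segment_integral (g : C -> C) (z0 z1 : C) : C :=
  RInt (V := C_R_CompleteNormedModule)
    (fun s : R => g (z0 + RtoC s * (z1 - z0))%C * (z1 - z0))%C 0 1.

(* The integrand is holomorphic on the upper half-plane (the roots of Q are
   real), so the choice of the straight path is immaterial. *)
Definition I_f (f : C -> C) (tau0 : C) (A : mat2) : C :=
  if excluded_middle_informative (hyperbolic A) then
    let Q := form_of A in
    segment_integral
      (fun tau => f tau * RtoC (sqrt (IZR (qdisc Q))) / qeval Q tau (RtoC 1))%C
      tau0 (mobC A tau0)
  else RtoC 0.

Definition rational (x : R) : Prop := exists r : Q, x = Q2R r.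

Definition letter (A : nat -> mat2) (n : nat) : mat2 := mmul (minv (A n)) (A (S n)).

Definition is_farey_path (x : R) (A : nat -> mat2) : Prop :=
  (forall n, SL2Z_nonneg (A n)) /\
  A 0%nat = mone /\
  (forall n, letter A n = matT \/ letter A n = matV) /\
  is_lim_seq (fun n => mobR (A n) 1) x /\
  (~ rational x ->
     (forall N, exists n, (N <= n)%nat /\ letter A n = matT) /\
     (forall N, exists n, (N <= n)%nat /\ letter A n = matV)) /\
  (rational x -> exists N, forall n, (N <= n)%nat -> letter A n = matV).

(* For x > 0 there is exactly one such sequence. *)
Definition farey_path (x : R) : nat -> mat2 :=
  epsilon (inhabits (fun _ => mone)) (is_farey_path x).

Definition Lambda_pos (f : C -> C) (tau0 : C) (x : R) : Rbar :=
  LimSup_seq (fun n => Re (I_f f tau0 (farey_path x n)) / INR n).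

Inductive P1R : Set := P1_fin (x : R) | P1_inf.

Definition Lambda (f : C -> C) (tau0 : C) (x : P1R) : Rbar :=
  match x with
  | P1_fin x =>
      if Rlt_dec 0 x then Lambda_pos f tau0 x
      else if Rlt_dec x 0 then Lambda_pos f tau0 (- x)
      else Finite 0
  | P1_inf => Finite 0
  end.

Definition phi : R := (1 + sqrt 5) / 2.

(* Main.v *)
(* The fixed point rho = e^(2 pi i/3) satisfies T rho = V rho = e^(i pi/3), so for a word
   A = L_1 ... L_n in T and V the path from rho to A rho breaks into translates of the unit arc
   from 2 pi/3 to pi/3. With w = -u < 0 < v the fixed points of A, the differential is
   f (1/(tau + u) - 1/(tau - v)) dtau, and pulling back along prefixes gives
   Re I_f(A) = sum_k (G(v_k) + G(u_k)), where v_k and u_k run over the fixed points of the cyclic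
   rotations of A and of the reversed word, and G is the integral over the arc of f against a
   positive kernel depending on v + 1/v only. Hence Re I_f(A) >= 0.

   For the upper bound, G(L v) <= G(phi) - kappa (psi(L v) - psi(v)) for each letter L, with
   psi(v) = |v - 1/v|; around a cycle the coboundary cancels, so Re I_f(A) <= 2 n G(phi), with
   equality for (TV)^k, the path of phi.

   A word of length r contracts (0, oo) so strongly that G varies by at most C/r on its image.
   Replacing the periodic tails by cut-off ones therefore costs O(sqrt n), and the sum becomes
   quasi-additive under concatenation. Blocks TV raise the average towards 2 G(phi), runs of V
   lower it towards 0, and choosing greedily between them realises any upper limit in between. *)

(* A pointwise bound of the kernel by its value at [phi] fails: the kernel decreases in [v + / v],
   so it is largest at [v = 1], and the points [v_k] can come arbitrarily close to 1. The coboundary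
   pays for this excess: T brings a point near 1 only from near 0, where [skew] is large, so [skew]
   drops there (mirrored for V). At the orbit [phi], [/ phi] the function [skew] equals 1 and both
   sides of the letter inequality agree; kappa is then forced by equality of the derivatives. The
   inequality holds at every point of the arc separately, so integration against the non-negative
   weight preserves it. The symmetry in [v] and [/ v] comes from f(-1/tau) = f(tau), which reflects
   the arc.

   Runs of a single letter are parabolic, so no contraction better than 1/r is available. The errors
   C/r add up to a logarithm; the cruder square root is enough because averages divide by n.

   [Re I_f] is 0 on non-hyperbolic words and its fixed points depend on the whole word, so the
   greedy choice watches the cut-off sums, which are almost additive. *)
Require Import Defs.
From Stdlib Require Import Reals ZArith Qreals Lra Lia Psatz List ClassicalEpsilon.
From Coquelicot Require Import Coquelicot.
Import ListNotations.
Open Scope R_scope.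

(** * Complex and mixed derivatives *)

(** [f] is differentiated over [C_AbsRing], while paths and integrals treat [C] as a real normed
    module. Plain epsilon-delta statements mediate between the two structures. *)
Definition is_cderiv (g : C -> C) (z l : C) : Prop :=
  forall eps, 0 < eps -> exists d, 0 < d /\
    forall y, Cmod (y - z)%C < d ->
      Cmod (g y - g z - (y - z) * l)%C <= eps * Cmod (y - z)%C.

Definition is_ccont (g : C -> C) (z : C) : Prop :=
  forall eps, 0 < eps -> exists d, 0 < d /\
    forall y, Cmod (y - z)%C < d -> Cmod (g y - g z)%C < eps.

Definition is_rderiv (h : R -> C) (s : R) (l : C) : Prop :=
  forall eps, 0 < eps -> exists d, 0 < d /\
    forall y, Rabs (y - s) < d ->
      Cmod (h y - h s - RtoC (y - s) * l)%C <= eps * Rabs (y - s).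

Lemma is_derive_is_cderiv (g : C -> C) (z l : C) :
  is_derive (K := C_AbsRing) (V := C_NormedModule) g z l -> is_cderiv g z l.
Proof.
  intros [_ H] eps Heps.
  destruct (H z (fun P HP => HP) (mkposreal eps Heps)) as [d Hd].
  exists d; split; [apply cond_pos|].
  intros y Hy. exact (Hd y Hy).
Qed.

Lemma norm_C_R (z : C) : norm (V := C_R_NormedModule) z = Cmod z.
Proof.
  unfold Cmod, norm; simpl. unfold prod_norm, norm; simpl. unfold abs; simpl.
  f_equal. rewrite !Rmult_1_r.
  rewrite <- !Rabs_mult, !Rabs_pos_eq by nra. reflexivity.
Qed.

Lemma is_rderiv_is_derive (h : R -> C) (s : R) (l : C) :
  is_rderiv h s l -> is_derive (V := C_R_NormedModule) h s l.
Proof.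
  intros H. split; [apply (is_linear_scal_l (V := C_R_NormedModule))|].
  intros x Hx eps.
  rewrite <- (is_filter_lim_locally_unique _ _ Hx).
  destruct (H eps (cond_pos eps)) as [d [Hd Hy]].
  exists (mkposreal d Hd). intros y Hb.
  specialize (Hy y Hb).
  rewrite norm_C_R.
  replace (Cmod _) with (Cmod (h y - h s - RtoC (y - s) * l)%C); [exact Hy|].
  f_equal. apply injective_projections; simpl; unfold scal, mult, minus, plus, opp; simpl; unfold mult; simpl; ring.
Qed.

Lemma is_rderiv_Re (h : R -> C) (s : R) (l : C) :
  is_rderiv h s l -> is_derive (fun t => Re (h t)) s (Re l).
Proof.
  intros H. split; [apply (is_linear_scal_l (V := R_NormedModule))|].
  intros x Hx eps.
  rewrite <- (is_filter_lim_locally_unique _ _ Hx).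
  destruct (H eps (cond_pos eps)) as [d [Hd Hy]].
  exists (mkposreal d Hd). intros y Hb.
  specialize (Hy y Hb).
  eapply Rle_trans; [|exact Hy].
  eapply Rle_trans; [|apply Rmax_Cmod].
  eapply Rle_trans; [|apply Rmax_l].
  right. unfold norm; simpl. unfold abs; simpl. f_equal.
  unfold scal, mult, minus, plus, opp; simpl; unfold mult; simpl. unfold Re. ring.
Qed.

Lemma is_derive_components_rderiv (h : R -> C) (s : R) (l : C) :
  is_derive (fun t => Re (h t)) s (Re l) ->
  is_derive (fun t => Im (h t)) s (Im l) -> is_rderiv h s l.
Proof.
  intros [_ H1] [_ H2] eps Heps.
  assert (He : 0 < eps / 2) by lra.
  destruct (H1 s (fun P HP => HP) (mkposreal _ He)) as [d1 Hd1].
  destruct (H2 s (fun P HP => HP) (mkposreal _ He)) as [d2 Hd2].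
  exists (Rmin d1 d2). split; [apply Rmin_pos; apply cond_pos|].
  intros y Hy.
  assert (K1 := Hd1 y (Rlt_le_trans _ _ _ Hy (Rmin_l _ _))).
  assert (K2 := Hd2 y (Rlt_le_trans _ _ _ Hy (Rmin_r _ _))).
  unfold norm in K1, K2; simpl in K1, K2. unfold abs in K1, K2; simpl in K1, K2.
  unfold scal, mult, minus, plus, opp in K1, K2; simpl in K1, K2. unfold mult in K1, K2; simpl in K1, K2.
  set (D := (h y - h s - RtoC (y - s) * l)%C).
  assert (E : D = (RtoC (Re D) + Ci * RtoC (Im D))%C).
  { apply injective_projections; simpl; unfold Re, Im; ring. }
  rewrite E.
  eapply Rle_trans; [apply Cmod_triangle|].
  rewrite Cmod_mult, !Cmod_R.
  replace (Cmod Ci) with 1.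
  2:{ unfold Cmod; simpl. rewrite <- sqrt_1 at 1. f_equal; ring. }
  replace (Re D) with (Re (h y) + - Re (h s) + - ((y + - s) * Re l)) by (unfold D, Re; simpl; ring).
  replace (Im D) with (Im (h y) + - Im (h s) + - ((y + - s) * Im l)) by (unfold D, Im; simpl; ring).
  unfold Rminus in *. lra.
Qed.

Lemma is_rderiv_comp (g : C -> C) (h : R -> C) (s : R) (l l' : C) :
  is_cderiv g (h s) l -> is_rderiv h s l' -> is_rderiv (fun t => g (h t)) s (l * l')%C.
Proof.
  intros Hg Hh eps Heps.
  assert (P1 := Cmod_ge_0 l). assert (P2 := Cmod_ge_0 l').
  set (e1 := eps / (2 * (Cmod l' + 1))).
  set (e2 := eps / (2 * (Cmod l + 1))).
  assert (E1 : 0 < e1) by (apply Rdiv_lt_0_compat; lra).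
  assert (E2 : 0 < e2) by (apply Rdiv_lt_0_compat; lra).
  destruct (Hg e1 E1) as [d1 [Hd1 G]].
  (* The bound 1 makes [h] Lipschitz at [s] with constant [Cmod l' + 1]; the bound [e2] controls the
     error that gets multiplied by [l]. *)
  destruct (Hh (Rmin 1 e2)) as [d2 [Hd2 K]]; [apply Rmin_pos; lra|].
  exists (Rmin d2 (d1 / (Cmod l' + 1))). split.
  { apply Rmin_pos; [lra|]. apply Rdiv_lt_0_compat; lra. }
  intros y Hy.
  assert (Hy1 : Rabs (y - s) < d2) by (eapply Rlt_le_trans; [exact Hy|apply Rmin_l]).
  assert (Hy2 : Rabs (y - s) < d1 / (Cmod l' + 1)) by (eapply Rlt_le_trans; [exact Hy|apply Rmin_r]).
  specialize (K y Hy1).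
  assert (Ha := Rabs_pos (y - s)).
  assert (Hm : Cmod (h y - h s) <= (Cmod l' + 1) * Rabs (y - s)).
  { replace (h y - h s)%C with ((h y - h s - RtoC (y - s) * l') + RtoC (y - s) * l')%C by ring.
    eapply Rle_trans; [apply Cmod_triangle|]. rewrite Cmod_mult, Cmod_R.
    assert (Rmin 1 e2 * Rabs (y - s) <= 1 * Rabs (y - s)) by (apply Rmult_le_compat_r; [lra|apply Rmin_l]).
    lra. }
  assert (Hm1 : Cmod (h y - h s) < d1).
  { eapply Rle_lt_trans; [exact Hm|]. apply Rmult_lt_reg_r with (/ (Cmod l' + 1)).
    - apply Rinv_0_lt_compat; lra.
    - unfold Rdiv in Hy2. rewrite (Rmult_comm _ (Rabs _)), Rmult_assoc, Rinv_r by lra. lra. }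
  specialize (G _ Hm1).
  replace (g (h y) - g (h s) - RtoC (y - s) * (l * l'))%C with
    ((g (h y) - g (h s) - (h y - h s) * l) + (h y - h s - RtoC (y - s) * l') * l)%C by ring.
  eapply Rle_trans; [apply Cmod_triangle|]. rewrite Cmod_mult.
  assert (Q1 : e1 * Cmod (h y - h s) <= eps / 2 * Rabs (y - s)).
  { replace (eps / 2 * Rabs (y - s)) with (e1 * ((Cmod l' + 1) * Rabs (y - s))) by (unfold e1; field; lra).
    apply Rmult_le_compat_l; lra. }
  assert (Q2 : Cmod (h y - h s - RtoC (y - s) * l') * Cmod l <= eps / 2 * Rabs (y - s)).
  { apply Rle_trans with (e2 * Rabs (y - s) * (Cmod l + 1)).
    - apply Rmult_le_compat; try apply Cmod_ge_0; try lra.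
      eapply Rle_trans; [exact K|]. apply Rmult_le_compat_r; [lra|apply Rmin_r].
    - right. unfold e2; field; lra. }
  lra.
Qed.

Lemma is_cderiv_ext_loc (g k : C -> C) (z l : C) (r : R) :
  0 < r -> (forall y, Cmod (y - z)%C < r -> g y = k y) ->
  is_cderiv g z l -> is_cderiv k z l.
Proof.
  intros Hr E H eps He. destruct (H eps He) as [d [Hd K]].
  exists (Rmin d r). split; [apply Rmin_pos; lra|].
  intros y Hy.
  rewrite <- (E y), <- (E z).
  - apply K. eapply Rlt_le_trans; [exact Hy|apply Rmin_l].
  - replace (z - z)%C with (RtoC 0) by ring. rewrite Cmod_0. exact Hr.
  - eapply Rlt_le_trans; [exact Hy|apply Rmin_r].
Qed.

Lemma is_cderiv_cont (g : C -> C) (z l : C) :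
  is_cderiv g z l -> is_ccont g z.
Proof.
  intros H eps He.
  destruct (H 1 Rlt_0_1) as [d [Hd K]].
  assert (P := Cmod_ge_0 l).
  exists (Rmin d (eps / (Cmod l + 2))). split.
  { apply Rmin_pos; [lra|]. apply Rdiv_lt_0_compat; lra. }
  intros y Hy.
  assert (H1 : Cmod (y - z) < d) by (eapply Rlt_le_trans; [exact Hy|apply Rmin_l]).
  assert (H2 : Cmod (y - z) < eps / (Cmod l + 2)) by (eapply Rlt_le_trans; [exact Hy|apply Rmin_r]).
  specialize (K y H1).
  assert (P' := Cmod_ge_0 (y - z)).
  replace (g y - g z)%C with ((g y - g z - (y - z) * l) + (y - z) * l)%C by ring.
  eapply Rle_lt_trans; [apply Cmod_triangle|]. rewrite Cmod_mult.
  apply Rle_lt_trans with (Cmod (y - z) * (Cmod l + 1)); [lra|].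
  apply Rle_lt_trans with (Cmod (y - z) * (Cmod l + 2)); [nra|].
  apply Rmult_lt_reg_r with (/ (Cmod l + 2)); [apply Rinv_0_lt_compat; lra|].
  rewrite Rmult_assoc, Rinv_r by lra. unfold Rdiv in H2. lra.
Qed.

Lemma is_cderiv_mult (g k : C -> C) (z l m : C) :
  is_cderiv g z l -> is_cderiv k z m ->
  is_cderiv (fun y => g y * k y)%C z (l * k z + g z * m)%C.
Proof.
  intros Hg Hk eps He.
  assert (P1 := Cmod_ge_0 (k z)). assert (P2 := Cmod_ge_0 (g z)). assert (P3 := Cmod_ge_0 l).
  set (M := Cmod (k z) + 1 + Cmod (g z) + Cmod l).
  assert (E1 : 0 < eps / (3 * M)) by (apply Rdiv_lt_0_compat; unfold M; lra).
  destruct (Hg _ E1) as [d1 [Hd1 K1]].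
  destruct (Hk _ E1) as [d2 [Hd2 K2]].
  destruct (is_cderiv_cont k z m Hk (Rmin 1 (eps / (3 * M)))) as [d3 [Hd3 K3]].
  { apply Rmin_pos; lra. }
  exists (Rmin d1 (Rmin d2 d3)). split; [repeat apply Rmin_pos; lra|].
  intros y Hy.
  assert (H1 : Cmod (y - z) < d1) by (eapply Rlt_le_trans; [exact Hy|apply Rmin_l]).
  assert (H23 : Cmod (y - z) < Rmin d2 d3) by (eapply Rlt_le_trans; [exact Hy|apply Rmin_r]).
  assert (H2 : Cmod (y - z) < d2) by (eapply Rlt_le_trans; [exact H23|apply Rmin_l]).
  assert (H3 : Cmod (y - z) < d3) by (eapply Rlt_le_trans; [exact H23|apply Rmin_r]).
  specialize (K1 y H1). specialize (K2 y H2). specialize (K3 y H3).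
  assert (K3a : Cmod (k y - k z) < 1) by (eapply Rlt_le_trans; [exact K3|apply Rmin_l]).
  assert (K3b : Cmod (k y - k z) < eps / (3 * M)) by (eapply Rlt_le_trans; [exact K3|apply Rmin_r]).
  assert (Ky : Cmod (k y) <= Cmod (k z) + 1).
  { replace (k y) with ((k y - k z) + k z)%C by ring. eapply Rle_trans; [apply Cmod_triangle|]. lra. }
  replace (g y * k y - g z * k z - (y - z) * (l * k z + g z * m))%C with
    ((g y - g z - (y - z) * l) * k y + g z * (k y - k z - (y - z) * m) + (y - z) * (l * (k y - k z)))%C by ring.
  eapply Rle_trans; [apply Cmod_triangle|].
  eapply Rle_trans; [apply Rplus_le_compat_r, Cmod_triangle|].
  rewrite !Cmod_mult.
  assert (P := Cmod_ge_0 (y - z)).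
  set (t := Cmod (y - z)) in *. set (e := eps / (3 * M)) in *.
  assert (HM : eps * t = e * t * M + e * t * M + e * t * M) by (unfold e; field; unfold M; lra).
  rewrite HM.
  assert (0 <= e * t) by (apply Rmult_le_pos; lra).
  apply Rplus_le_compat; [apply Rplus_le_compat|].
  - apply Rmult_le_compat; try apply Cmod_ge_0; try lra. unfold M; lra.
  - rewrite Rmult_comm. apply Rmult_le_compat; try apply Cmod_ge_0; try lra. unfold M; lra.
  - replace (e * t * M) with (t * (M * e)) by ring.
    apply Rmult_le_compat_l; [lra|]. apply Rmult_le_compat; try apply Cmod_ge_0; try lra. unfold M; lra.
Qed.

Lemma is_cderiv_comp (g k : C -> C) (z l m : C) :
  is_cderiv g (k z) l -> is_cderiv k z m ->
  is_cderiv (fun y => g (k y)) z (l * m)%C.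
Proof.
  intros Hg Hh eps Heps.
  assert (P1 := Cmod_ge_0 l). assert (P2 := Cmod_ge_0 m).
  set (e1 := eps / (2 * (Cmod m + 1))).
  set (e2 := eps / (2 * (Cmod l + 1))).
  assert (E1 : 0 < e1) by (apply Rdiv_lt_0_compat; lra).
  assert (E2 : 0 < e2) by (apply Rdiv_lt_0_compat; lra).
  destruct (Hg e1 E1) as [d1 [Hd1 G]].
  destruct (Hh (Rmin 1 e2)) as [d2 [Hd2 K]]; [apply Rmin_pos; lra|].
  exists (Rmin d2 (d1 / (Cmod m + 1))). split.
  { apply Rmin_pos; [lra|]. apply Rdiv_lt_0_compat; lra. }
  intros y Hy.
  assert (Hy1 : Cmod (y - z) < d2) by (eapply Rlt_le_trans; [exact Hy|apply Rmin_l]).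
  assert (Hy2 : Cmod (y - z) < d1 / (Cmod m + 1)) by (eapply Rlt_le_trans; [exact Hy|apply Rmin_r]).
  specialize (K y Hy1).
  assert (Ha := Cmod_ge_0 (y - z)).
  assert (Hm : Cmod (k y - k z) <= (Cmod m + 1) * Cmod (y - z)).
  { replace (k y - k z)%C with ((k y - k z - (y - z) * m) + (y - z) * m)%C by ring.
    eapply Rle_trans; [apply Cmod_triangle|]. rewrite Cmod_mult.
    assert (Rmin 1 e2 * Cmod (y - z) <= 1 * Cmod (y - z)) by (apply Rmult_le_compat_r; [lra|apply Rmin_l]).
    lra. }
  assert (Hm1 : Cmod (k y - k z) < d1).
  { eapply Rle_lt_trans; [exact Hm|]. apply Rmult_lt_reg_r with (/ (Cmod m + 1)).
    - apply Rinv_0_lt_compat; lra.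
    - unfold Rdiv in Hy2. rewrite (Rmult_comm _ (Cmod (y - z))), Rmult_assoc, Rinv_r by lra. lra. }
  specialize (G _ Hm1).
  replace (g (k y) - g (k z) - (y - z) * (l * m))%C with
    ((g (k y) - g (k z) - (k y - k z) * l) + (k y - k z - (y - z) * m) * l)%C by ring.
  eapply Rle_trans; [apply Cmod_triangle|]. rewrite Cmod_mult.
  assert (Q1 : e1 * Cmod (k y - k z) <= eps / 2 * Cmod (y - z)).
  { replace (eps / 2 * Cmod (y - z)) with (e1 * ((Cmod m + 1) * Cmod (y - z))) by (unfold e1; field; lra).
    apply Rmult_le_compat_l; lra. }
  assert (Q2 : Cmod (k y - k z - (y - z) * m) * Cmod l <= eps / 2 * Cmod (y - z)).
  { apply Rle_trans with (e2 * Cmod (y - z) * (Cmod l + 1)).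
    - apply Rmult_le_compat; try apply Cmod_ge_0; try lra.
      eapply Rle_trans; [exact K|]. apply Rmult_le_compat_r; [lra|apply Rmin_r].
    - right. unfold e2; field; lra. }
  lra.
Qed.

Lemma is_cderiv_const (c z : C) : is_cderiv (fun _ => c) z 0%C.
Proof.
  intros eps He. exists 1. split; [lra|]. intros y _.
  replace (c - c - (y - z) * 0)%C with (RtoC 0) by ring. rewrite Cmod_0.
  apply Rmult_le_pos; [lra|apply Cmod_ge_0].
Qed.

Lemma is_cderiv_shift (c z : C) : is_cderiv (fun y => y + c)%C z 1%C.
Proof.
  intros eps He. exists 1. split; [lra|]. intros y _.
  replace (y + c - (z + c) - (y - z) * 1)%C with (RtoC 0) by ring. rewrite Cmod_0.
  apply Rmult_le_pos; [lra|apply Cmod_ge_0].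
Qed.

Lemma is_cderiv_minus (g k : C -> C) (z l m : C) :
  is_cderiv g z l -> is_cderiv k z m ->
  is_cderiv (fun y => g y - k y)%C z (l - m)%C.
Proof.
  intros Hg Hk eps He.
  destruct (Hg (eps / 2)) as [d1 [Hd1 K1]]; [lra|].
  destruct (Hk (eps / 2)) as [d2 [Hd2 K2]]; [lra|].
  exists (Rmin d1 d2). split; [apply Rmin_pos; lra|].
  intros y Hy.
  assert (H1 : Cmod (y - z) < d1) by (eapply Rlt_le_trans; [exact Hy|apply Rmin_l]).
  assert (H2 : Cmod (y - z) < d2) by (eapply Rlt_le_trans; [exact Hy|apply Rmin_r]).
  specialize (K1 y H1). specialize (K2 y H2).
  replace (g y - k y - (g z - k z) - (y - z) * (l - m))%C with
   ((g y - g z - (y - z) * l) + - (k y - k z - (y - z) * m))%C by ring.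
  eapply Rle_trans; [apply Cmod_triangle|]. rewrite Cmod_opp. lra.
Qed.

Lemma is_cderiv_inv (z : C) : z <> 0%C -> is_cderiv Cinv z (- / (z * z))%C.
Proof.
  intros Hz eps He.
  assert (P : 0 < Cmod z) by (apply Cmod_gt_0; exact Hz).
  set (m := Cmod z) in *.
  exists (Rmin (m / 2) (eps * (m * m * m) / 2)). split.
  { apply Rmin_pos; [lra|]. assert (0 < m * m * m) by (repeat apply Rmult_lt_0_compat; lra). nra. }
  intros y Hy.
  assert (H1 : Cmod (y - z) < m / 2) by (eapply Rlt_le_trans; [exact Hy|apply Rmin_l]).
  assert (H2 : Cmod (y - z) < eps * (m * m * m) / 2) by (eapply Rlt_le_trans; [exact Hy|apply Rmin_r]).
  assert (Py : m / 2 <= Cmod y).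
  { assert (T := Cmod_triangle y (- (y - z))%C). rewrite Cmod_opp in T.
    replace (y + - (y - z))%C with z in T by ring. unfold m in *. lra. }
  assert (Hy0 : y <> 0%C) by (apply Cmod_gt_0; lra).
  replace (/ y - / z - (y - z) * - / (z * z))%C with ((y - z) * ((y - z) * / (y * (z * z))))%C by (field; auto).
  rewrite !Cmod_mult, Cmod_inv, !Cmod_mult by (repeat apply Cmult_neq_0; auto).
  fold m. assert (P' := Cmod_ge_0 (y - z)). rewrite (Rmult_comm eps).
  apply Rmult_le_compat_l; [lra|].
  assert (0 < Cmod y * (m * m)) by (repeat apply Rmult_lt_0_compat; lra).
  apply Rmult_le_reg_r with (Cmod y * (m * m)); [lra|].
  rewrite Rmult_assoc, Rinv_l by lra.
  assert (m / 2 * (m * m) <= Cmod y * (m * m)) by (apply Rmult_le_compat_r; nra).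
  nra.
Qed.

(** * Integrals along segments and Goursat's theorem *)

Lemma continuous_C_R (h : R -> C) (s : R) :
  (forall eps, 0 < eps -> exists d, 0 < d /\
    forall y, Rabs (y - s) < d -> Cmod (h y - h s)%C < eps) ->
  continuous (U := C_R_NormedModule) h s.
Proof.
  intros H. apply (proj2 (filterlim_locally (U := C_R_NormedModule) h (h s))).
  intros eps. destruct (H eps (cond_pos eps)) as [d [Hd K]].
  exists (mkposreal d Hd). intros y Hy. specialize (K y Hy).
  assert (Q := Rmax_Cmod (h y - h s)%C).
  split.
  - eapply Rle_lt_trans; [|exact K]. eapply Rle_trans; [|exact Q]. apply Rmax_l.
  - eapply Rle_lt_trans; [|exact K]. eapply Rle_trans; [|exact Q]. apply Rmax_r.
Qed.

Lemma Cmod_seg (a b : C) (s s' : R) :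
  Cmod ((a + RtoC s' * (b - a)) - (a + RtoC s * (b - a)))%C = Rabs (s' - s) * Cmod (b - a)%C.
Proof.
  rewrite <- Cmod_R, <- Cmod_mult. f_equal. rewrite RtoC_minus. ring.
Qed.

Lemma continuous_seg (g : C -> C) (a b : C) (s : R) :
  is_ccont g (a + RtoC s * (b - a))%C ->
  continuous (U := C_R_NormedModule) (fun s => g (a + RtoC s * (b - a)) * (b - a))%C s.
Proof.
  intros H. apply continuous_C_R. intros eps He.
  assert (P := Cmod_ge_0 (b - a)%C).
  destruct (H (eps / (Cmod (b - a) + 1))) as [d [Hd K]].
  { apply Rdiv_lt_0_compat; lra. }
  exists (d / (Cmod (b - a) + 1)). split; [apply Rdiv_lt_0_compat; lra|].
  intros y Hy.
  assert (K' : Cmod (g (a + RtoC y * (b - a)) - g (a + RtoC s * (b - a)))%C < eps / (Cmod (b - a) + 1)).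
  { apply K. rewrite Cmod_seg. apply Rle_lt_trans with (Rabs (y - s) * (Cmod (b - a) + 1)).
    - apply Rmult_le_compat_l; [apply Rabs_pos|lra].
    - replace d with (d / (Cmod (b - a) + 1) * (Cmod (b - a) + 1)) by (field; lra).
      apply Rmult_lt_compat_r; lra. }
  replace (_ - _)%C with ((g (a + RtoC y * (b - a)) - g (a + RtoC s * (b - a))) * (b - a))%C by ring.
  rewrite Cmod_mult.
  apply Rle_lt_trans with (Cmod (g (a + RtoC y * (b - a)) - g (a + RtoC s * (b - a)))%C * (Cmod (b - a) + 1)).
  - apply Rmult_le_compat_l; [apply Cmod_ge_0|lra].
  - replace eps with (eps / (Cmod (b - a) + 1) * (Cmod (b - a) + 1)) by (field; lra).
    apply Rmult_lt_compat_r; lra.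
Qed.

Definition segment_ccont (g : C -> C) (a b : C) : Prop :=
  forall s, 0 <= s <= 1 -> is_ccont g (a + RtoC s * (b - a))%C.

Lemma ex_RInt_seg (g : C -> C) (a b : C) (u v : R) :
  segment_ccont g a b -> 0 <= u <= 1 -> 0 <= v <= 1 ->
  ex_RInt (V := C_R_NormedModule) (fun s => g (a + RtoC s * (b - a)) * (b - a))%C u v.
Proof.
  intros H Hu Hv. apply (ex_RInt_continuous (V := C_R_CompleteNormedModule)).
  intros s Hs. apply continuous_seg, H.
  split; [apply Rle_trans with (Rmin u v)|apply Rle_trans with (Rmax u v)]; try lra.
  - apply Rmin_glb; lra.
  - apply Rmax_lub; lra.
Qed.

Lemma segment_integral_correct (g : C -> C) (a b : C) :
  segment_ccont g a b ->
  is_RInt (V := C_R_NormedModule) (fun s => g (a + RtoC s * (b - a)) * (b - a))%C 0 1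
    (segment_integral g a b).
Proof.
  intros H. apply (RInt_correct (V := C_R_CompleteNormedModule)).
  apply ex_RInt_seg; [exact H|lra|lra].
Qed.

Lemma is_rderiv_seg (a b : C) (s : R) : is_rderiv (fun s => a + RtoC s * (b - a))%C s (b - a)%C.
Proof.
  intros eps He. exists 1. split; [lra|]. intros y _.
  rewrite RtoC_minus.
  replace (_ - _ - _)%C with (RtoC 0) by ring. rewrite Cmod_0.
  apply Rmult_le_pos; [lra|apply Rabs_pos].
Qed.

Lemma segment_integral_primitive (g F : C -> C) (a b : C) :
  segment_ccont g a b ->
  (forall s, 0 <= s <= 1 ->
     is_cderiv F (a + RtoC s * (b - a))%C (g (a + RtoC s * (b - a))%C)) ->
  segment_integral g a b = (F b - F a)%C.
Proof.
  intros Hc HF.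
  assert (K : is_RInt (V := C_R_NormedModule) (fun s => g (a + RtoC s * (b - a)) * (b - a))%C 0 1
     (minus (G := C_R_NormedModule) (F (a + RtoC 1 * (b - a))%C) (F (a + RtoC 0 * (b - a))%C))).
  { apply (is_RInt_derive (V := C_R_CompleteNormedModule) (fun s => F (a + RtoC s * (b - a))%C)).
    - intros s Hs. rewrite Rmin_left, Rmax_right in Hs by lra.
      apply is_rderiv_is_derive. apply (is_rderiv_comp F); [apply HF; lra|apply is_rderiv_seg].
    - intros s Hs. rewrite Rmin_left, Rmax_right in Hs by lra.
      apply continuous_seg, Hc; lra. }
  unfold segment_integral. rewrite (is_RInt_unique (V := C_R_CompleteNormedModule) _ _ _ _ K).
  replace (a + RtoC 1 * (b - a))%C with b by ring.
  replace (a + RtoC 0 * (b - a))%C with a by ring. reflexivity.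
Qed.

(** Maximum times length, for a difference of integrands: [k] will be the linearisation of [g] in
    Goursat's argument and a constant in the construction of a primitive. *)
Lemma segment_integral_near (g k : C -> C) (a b : C) (M : R) :
  segment_ccont g a b -> segment_ccont k a b ->
  (forall s, 0 <= s <= 1 ->
     Cmod (g (a + RtoC s * (b - a)) - k (a + RtoC s * (b - a)))%C <= M) ->
  Cmod (segment_integral g a b - segment_integral k a b)%C <= M * Cmod (b - a)%C.
Proof.
  intros Hg Hk HM.
  assert (K := is_RInt_minus (V := C_R_NormedModule) _ _ _ _ _ _
     (segment_integral_correct g a b Hg) (segment_integral_correct k a b Hk)).
  rewrite <- norm_C_R.
  replace (M * Cmod (b - a)%C) with (scal (V := R_NormedModule) (1 - 0) (M * Cmod (b - a)%C))
    by (unfold scal; simpl; unfold mult; simpl; ring).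
  refine (norm_RInt_le (V := C_R_NormedModule) _ (fun _ => M * Cmod (b - a)%C) 0 1 _ _ Rle_0_1 _ K
    (is_RInt_const (V := R_NormedModule) 0 1 _)).
  intros s Hs. rewrite norm_C_R.
  replace (minus _ _) with ((g (a + RtoC s * (b - a)) - k (a + RtoC s * (b - a))) * (b - a))%C.
  2:{ match goal with |- _ = ?r => change r with (g (a + RtoC s * (b - a)) * (b - a) - k (a + RtoC s * (b - a)) * (b - a))%C end. ring. }
  rewrite Cmod_mult. apply Rmult_le_compat_r; [apply Cmod_ge_0|]. apply HM; exact Hs.
Qed.

(** The explicit primitive makes affine functions integrate to 0 around a triangle, so only the
    remainder of a first-order expansion counts there. *)
Lemma segment_integral_affine (g : C -> C) (a b : C) (p q : C) :
  (forall z, g z = p + q * z)%C ->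
  segment_ccont g a b /\
  segment_integral g a b = ((p * b + q * b * b / 2) - (p * a + q * a * a / 2))%C.
Proof.
  intros Hg.
  assert (Hc : segment_ccont g a b).
  { intros s _. set (z := (a + RtoC s * (b - a))%C).
    apply is_cderiv_cont with q. intros eps He. exists 1. split; [lra|]. intros y _.
    rewrite !Hg. replace (_ - _ - _)%C with (RtoC 0) by ring. rewrite Cmod_0.
    apply Rmult_le_pos; [lra|apply Cmod_ge_0]. }
  split; [exact Hc|].
  apply (segment_integral_primitive g (fun z => p * z + q * z * z / 2)%C); [exact Hc|].
  intros s _. set (z := (a + RtoC s * (b - a))%C). rewrite Hg.
  intros eps He. exists (eps / (Cmod (q / 2) + 1)).
  assert (P := Cmod_ge_0 (q / 2)%C).
  split; [apply Rdiv_lt_0_compat; lra|]. intros y Hy.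
  replace (_ - _ - _)%C with (q / 2 * (y - z) * (y - z))%C.
  2:{ field. }
  rewrite !Cmod_mult. apply Rmult_le_compat_r; [apply Cmod_ge_0|].
  apply Rle_trans with ((Cmod (q / 2) + 1) * (eps / (Cmod (q / 2) + 1))).
  - apply Rmult_le_compat; try apply Cmod_ge_0; lra.
  - right; field; lra.
Qed.

Lemma scal_C_R (x : R) (z : C) : scal (V := C_R_NormedModule) x z = (RtoC x * z)%C.
Proof.
  apply injective_projections; simpl; unfold scal; simpl; unfold mult; simpl; ring.
Qed.

Lemma segment_integral_sub (g : C -> C) (a b : C) (u v : R) :
  segment_ccont g a b -> 0 <= u <= 1 -> 0 <= v <= 1 ->
  segment_integral g (a + RtoC u * (b - a))%C (a + RtoC v * (b - a))%C =
  RInt (V := C_R_CompleteNormedModule) (fun s => g (a + RtoC s * (b - a)) * (b - a))%C u v.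
Proof.
  intros H Hu Hv.
  assert (E : (v - u) * 0 + u = u) by ring.
  assert (E' : (v - u) * 1 + u = v) by ring.
  assert (K := RInt_comp_lin (V := C_R_CompleteNormedModule)
    (fun s => g (a + RtoC s * (b - a)) * (b - a))%C (v - u) u 0 1).
  rewrite E, E' in K. rewrite <- K by (apply ex_RInt_seg; auto). clear K.
  unfold segment_integral. apply (RInt_ext (V := C_R_CompleteNormedModule)). intros s _.
  etransitivity; [|symmetry; apply scal_C_R].
  rewrite RtoC_plus, RtoC_mult, RtoC_minus.
  replace (a + RtoC u * (b - a) + RtoC s * (a + RtoC v * (b - a) - (a + RtoC u * (b - a))))%C
    with (a + ((RtoC v - RtoC u) * RtoC s + RtoC u) * (b - a))%C by ring.
  match goal with |- @eq _ ?x ?y => change (@eq C x y) end. ring.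
Qed.

Lemma segment_integral_rev (g : C -> C) (a b : C) :
  segment_ccont g a b -> segment_integral g b a = (- segment_integral g a b)%C.
Proof.
  intros H.
  assert (K := segment_integral_sub g a b 1 0 H ltac:(lra) ltac:(lra)).
  replace (a + RtoC 1 * (b - a))%C with b in K by ring.
  replace (a + RtoC 0 * (b - a))%C with a in K by ring.
  rewrite K. rewrite <- (opp_RInt_swap (V := C_R_CompleteNormedModule)); [reflexivity|].
  apply ex_RInt_seg; auto; lra.
Qed.

Definition Cmid (a b : C) : C := ((a + b) / 2)%C.

Lemma Cmid_seg (a b : C) : Cmid a b = (a + RtoC (1 / 2) * (b - a))%C.
Proof. apply injective_projections; unfold Cmid; simpl; field. Qed.

Lemma segment_integral_mid (g : C -> C) (a b : C) :
  segment_ccont g a b ->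
  segment_integral g a b = (segment_integral g a (Cmid a b) + segment_integral g (Cmid a b) b)%C.
Proof.
  intros H.
  assert (K1 := segment_integral_sub g a b 0 (1/2) H ltac:(lra) ltac:(lra)).
  assert (K2 := segment_integral_sub g a b (1/2) 1 H ltac:(lra) ltac:(lra)).
  rewrite <- Cmid_seg in K1, K2.
  replace (a + RtoC 1 * (b - a))%C with b in K2 by ring.
  replace (a + RtoC 0 * (b - a))%C with a in K1 by ring.
  rewrite K1, K2. symmetry.
  apply (RInt_Chasles (V := C_R_CompleteNormedModule)); apply ex_RInt_seg; auto; lra.
Qed.

Lemma upper_half_seg (a b : C) (s : R) :
  upper_half a -> upper_half b -> 0 <= s <= 1 -> upper_half (a + RtoC s * (b - a))%C.
Proof.
  unfold upper_half, Im. intros Ha Hb Hs. simpl.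
  destruct (Req_dec s 0) as [->|]; [lra|]. nra.
Qed.

(** The intervals around [x n] of radius [2 * K / 2 ^ n] are nested, so their lower ends increase to
    a common point. *)
Lemma half_dist_cauchy (x : nat -> R) (K : R) :
  0 <= K -> (forall n, Rabs (x (S n) - x n) <= K / 2 ^ n) ->
  exists l, forall n, Rabs (x n - l) <= 2 * K / 2 ^ n.
Proof.
  intros HK H.
  assert (P : forall n, 0 < 2 ^ n) by (intros; apply pow_lt; lra).
  assert (D : forall n, 2 * K / 2 ^ S n = K / 2 ^ n) by (intros n; simpl; field; apply Rgt_not_eq, P).
  assert (D' : forall n, 2 * K / 2 ^ n = K / 2 ^ n + K / 2 ^ n) by (intros n; field; apply Rgt_not_eq, P).
  assert (D0 : forall n, 0 <= 2 * K / 2 ^ n) by (intros n; apply Rmult_le_pos; [lra|]; left; apply Rinv_0_lt_compat, P).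
  assert (Hinc : forall n, x n - 2 * K / 2 ^ n <= x (S n) - 2 * K / 2 ^ (S n)).
  { intros n. rewrite D, D'. specialize (H n). apply Rabs_le_between in H. lra. }
  assert (Hdec : forall n, x (S n) + 2 * K / 2 ^ (S n) <= x n + 2 * K / 2 ^ n).
  { intros n. rewrite D, D'. specialize (H n). apply Rabs_le_between in H. lra. }
  assert (Hm : forall n m, x n - 2 * K / 2 ^ n <= x (n + m)%nat - 2 * K / 2 ^ (n + m)).
  { intros n m. induction m; [rewrite Nat.add_0_r; lra|]. rewrite Nat.add_succ_r.
    eapply Rle_trans; [exact IHm|apply Hinc]. }
  assert (HM : forall n m, x (n + m)%nat + 2 * K / 2 ^ (n + m) <= x n + 2 * K / 2 ^ n).
  { intros n m. induction m; [rewrite Nat.add_0_r; lra|]. rewrite Nat.add_succ_r.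
    eapply Rle_trans; [apply Hdec|exact IHm]. }
  assert (Hb : forall n m, x m - 2 * K / 2 ^ m <= x n + 2 * K / 2 ^ n).
  { intros n m. specialize (Hm m n). specialize (HM n m). rewrite (Nat.add_comm m n) in Hm.
    specialize (D0 (n + m)%nat). lra. }
  destruct (ex_finite_lim_seq_incr (fun n => x n - 2 * K / 2 ^ n) (x 0%nat + 2 * K / 2 ^ 0) Hinc (Hb 0%nat)) as [l Hl].
  exists l. intros n. apply Rabs_le_between'. split.
  - assert (Q := is_lim_seq_le _ (fun _ => x n + 2 * K / 2 ^ n) _ _ (Hb n) Hl (is_lim_seq_const _)).
    simpl in Q. lra.
  - assert (Q := is_lim_seq_incr_compare _ _ Hl Hinc n). simpl in Q. lra.
Qed.

Section Goursat.
Variable g : C -> C.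
Hypothesis Hg : forall z, upper_half z -> exists l, is_cderiv g z l.

Lemma holo_segment_ccont (a b : C) : upper_half a -> upper_half b -> segment_ccont g a b.
Proof.
  intros Ha Hb s Hs. destruct (Hg _ (upper_half_seg a b s Ha Hb Hs)) as [l Hl].
  exact (is_cderiv_cont _ _ _ Hl).
Qed.

Definition tri_integral (t : C * C * C) : C :=
  let '(a, b, c) := t in
  (segment_integral g a b + segment_integral g b c + segment_integral g c a)%C.

Definition perimeter (t : C * C * C) : R :=
  let '(a, b, c) := t in Cmod (b - a)%C + Cmod (c - b)%C + Cmod (a - c)%C.

Definition tri_above (m : R) (t : C * C * C) : Prop :=
  let '(a, b, c) := t in m <= Im a /\ m <= Im b /\ m <= Im c.

(** Inner edges cancel, so the integral is the sum over the four half-size triangles and one of them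
    carries a quarter of it. The fixed height [m] survives by convexity and keeps the limit point of
    the iteration off the real axis. *)
Lemma quadrisect (m : R) (t : C * C * C) :
  0 < m -> tri_above m t ->
  exists t', tri_above m t' /\ perimeter t' = perimeter t / 2 /\
    Cmod (fst (fst t') - fst (fst t))%C <= perimeter t /\
    Cmod (tri_integral t) / 4 <= Cmod (tri_integral t').
Proof.
  destruct t as [[a b] c]. intros Hm (Ha & Hb & Hc).
  assert (Hmid : forall x y, m <= Im x -> m <= Im y -> m <= Im (Cmid x y)).
  { intros x y Hx Hy. replace (Im (Cmid x y)) with ((Im x + Im y) / 2); [lra|].
    unfold Cmid, Im; simpl; field. }
  assert (Hu : forall x, m <= Im x -> upper_half x) by (intros x Hx; unfold upper_half; lra).
  assert (Hs : forall x y, m <= Im x -> m <= Im y -> segment_ccont g x y)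
    by (intros x y Hx Hy; apply holo_segment_ccont; auto).
  set (m1 := Cmid a b). set (m2 := Cmid b c). set (m3 := Cmid c a).
  assert (H1 : m <= Im m1) by (apply Hmid; auto).
  assert (H2 : m <= Im m2) by (apply Hmid; auto).
  assert (H3 : m <= Im m3) by (apply Hmid; auto).
  assert (E : tri_integral (a, b, c) =
    (tri_integral (a, m1, m3) + tri_integral (m1, b, m2) + tri_integral (m3, m2, c) + tri_integral (m1, m2, m3))%C).
  { simpl.
    rewrite (segment_integral_mid g a b), (segment_integral_mid g b c), (segment_integral_mid g c a) by auto.
    fold m1 m2 m3.
    rewrite (segment_integral_rev g m1 m3), (segment_integral_rev g m1 m2), (segment_integral_rev g m2 m3) by auto.
    ring. }
  assert (Cm : forall x y, Cmod (x / 2 - y / 2)%C = Cmod (x - y)%C / 2).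
  { intros x y. replace (x / 2 - y / 2)%C with (RtoC (/ 2) * (x - y))%C.
    - rewrite Cmod_mult, Cmod_R, Rabs_pos_eq by lra. lra.
    - apply injective_projections; simpl; field. }
  assert (Ph : forall x y z w, (x - y = z / 2 - w / 2)%C -> Cmod (x - y) = Cmod (z - w) / 2)
    by (intros x y z w ->; apply Cm).
  assert (Pab := Cmod_ge_0 (b - a)). assert (Pbc := Cmod_ge_0 (c - b)). assert (Pca := Cmod_ge_0 (a - c)).
  assert (Sy : forall x y, Cmod (x - y) = Cmod (y - x)).
  { intros x y. rewrite <- Cmod_opp. f_equal. ring. }
  assert (Tr := Cmod_triangle (tri_integral (a, m1, m3) + tri_integral (m1, b, m2) + tri_integral (m3, m2, c)) (tri_integral (m1, m2, m3))).
  assert (Tr2 := Cmod_triangle (tri_integral (a, m1, m3) + tri_integral (m1, b, m2)) (tri_integral (m3, m2, c))).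
  assert (Tr3 := Cmod_triangle (tri_integral (a, m1, m3)) (tri_integral (m1, b, m2))).
  assert (P1 : perimeter (a, m1, m3) = perimeter (a, b, c) / 2).
  { simpl. rewrite (Ph m1 a b a), (Ph m3 m1 c b), (Ph a m3 a c); [lra|..];
      unfold m1, m2, m3, Cmid; apply injective_projections; simpl; field. }
  assert (P2 : perimeter (m1, b, m2) = perimeter (a, b, c) / 2).
  { simpl. rewrite (Ph b m1 b a), (Ph m2 b c b), (Ph m1 m2 a c); [lra|..];
      unfold m1, m2, m3, Cmid; apply injective_projections; simpl; field. }
  assert (P3 : perimeter (m3, m2, c) = perimeter (a, b, c) / 2).
  { simpl. rewrite (Ph m2 m3 b a), (Ph c m2 c b), (Ph m3 c a c); [lra|..];
      unfold m1, m2, m3, Cmid; apply injective_projections; simpl; field. }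
  assert (P4 : perimeter (m1, m2, m3) = perimeter (a, b, c) / 2).
  { simpl. rewrite (Ph m2 m1 c a), (Ph m3 m2 a b), (Ph m1 m3 b c);
      [rewrite (Sy c a), (Sy a b), (Sy b c); lra|..];
      unfold m1, m2, m3, Cmid; apply injective_projections; simpl; field. }
  assert (D1 : Cmod (m1 - a) <= perimeter (a, b, c)).
  { simpl. rewrite (Ph m1 a b a); [lra|]. unfold m1, Cmid; apply injective_projections; simpl; field. }
  assert (D3 : Cmod (m3 - a) <= perimeter (a, b, c)).
  { simpl. rewrite (Ph m3 a c a); [rewrite (Sy c a); lra|]. unfold m3, Cmid; apply injective_projections; simpl; field. }
  assert (D0 : Cmod (a - a) <= perimeter (a, b, c)).
  { replace (a - a)%C with (RtoC 0) by ring. rewrite Cmod_0. simpl; lra. }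
  rewrite <- E in Tr.
  destruct (Rle_dec (Cmod (tri_integral (a, b, c)) / 4) (Cmod (tri_integral (a, m1, m3)))) as [Q|Q];
    [exists (a, m1, m3); repeat split; auto|].
  destruct (Rle_dec (Cmod (tri_integral (a, b, c)) / 4) (Cmod (tri_integral (m1, b, m2)))) as [Q'|Q'];
    [exists (m1, b, m2); repeat split; auto|].
  destruct (Rle_dec (Cmod (tri_integral (a, b, c)) / 4) (Cmod (tri_integral (m3, m2, c)))) as [Q''|Q''];
    [exists (m3, m2, c); repeat split; auto|].
  exists (m1, m2, m3); repeat split; auto. lra.
Qed.

Lemma goursat_triangle (a b c : C) :
  upper_half a -> upper_half b -> upper_half c -> tri_integral (a, b, c) = 0%C.
Proof.
  intros Ha Hb Hc.
  set (m := Rmin (Im a) (Rmin (Im b) (Im c))).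
  assert (Hm : 0 < m) by (unfold m; repeat apply Rmin_pos; assumption).
  set (L := perimeter (a, b, c)). set (I := Cmod (tri_integral (a, b, c))).
  pose (P := fun t => tri_above m t).
  assert (H0 : P (a, b, c)).
  { split; [|split].
    - apply Rmin_l.
    - eapply Rle_trans; [apply Rmin_r|apply Rmin_l].
    - eapply Rle_trans; [apply Rmin_r|apply Rmin_r]. }
  (* Dependent choice: the iteration runs on triangles bundled with their height bound, which
     [quadrisect] requires again at each step. *)
  pose (next := fun t : {t | P t} =>
    let h := quadrisect m (proj1_sig t) Hm (proj2_sig t) in
    let u := ClassicalEpsilon.constructive_indefinite_description _ h in
    exist P (proj1_sig u) (proj1 (proj2_sig u))).
  pose (seqt := fun n => proj1_sig (Nat.iter n next (exist P (a, b, c) H0))).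
  assert (Hnext : forall n, P (seqt n) /\ perimeter (seqt (S n)) = perimeter (seqt n) / 2 /\
    Cmod (fst (fst (seqt (S n))) - fst (fst (seqt n)))%C <= perimeter (seqt n) /\
    Cmod (tri_integral (seqt n)) / 4 <= Cmod (tri_integral (seqt (S n)))).
  { intros n. unfold seqt. simpl. destruct (Nat.iter n next _) as [t Ht]. simpl.
    destruct (ClassicalEpsilon.constructive_indefinite_description _ _) as [u Hu]. simpl.
    split; [exact Ht|]. exact (proj2 Hu). }
  assert (P2 : forall n, 0 < 2 ^ n) by (intros; apply pow_lt; lra).
  assert (HL : forall n, perimeter (seqt n) = L / 2 ^ n).
  { intros n. induction n.
    - change (perimeter (seqt 0%nat)) with L. simpl. field.
    - destruct (Hnext n) as (_ & E & _). rewrite E, IHn. simpl. field. apply Rgt_not_eq, P2. }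
  assert (HI : forall n, I / 4 ^ n <= Cmod (tri_integral (seqt n))).
  { intros n. induction n.
    - unfold seqt; simpl. unfold I; simpl. lra.
    - destruct (Hnext n) as (_ & _ & _ & E). eapply Rle_trans; [|exact E].
      replace (I / 4 ^ S n) with (I / 4 ^ n / 4); [lra|]. simpl. field. apply pow_nonzero; lra. }
  set (x := fun n => fst (fst (seqt n))).
  assert (L0 : 0 <= L).
  { unfold L; simpl. assert (Pab := Cmod_ge_0 (b - a)). assert (Pbc := Cmod_ge_0 (c - b)). assert (Pca := Cmod_ge_0 (a - c)). lra. }
  assert (Hx : forall n, Cmod (x (S n) - x n)%C <= L / 2 ^ n).
  { intros n. rewrite <- HL. apply Hnext. }
  destruct (half_dist_cauchy (fun n => Re (x n)) L L0) as [p1 Hp1].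
  { intros n. eapply Rle_trans; [|apply Hx]. eapply Rle_trans; [|apply Rmax_Cmod]. apply Rmax_l. }
  destruct (half_dist_cauchy (fun n => Im (x n)) L L0) as [p2 Hp2].
  { intros n. eapply Rle_trans; [|apply Hx]. eapply Rle_trans; [|apply Rmax_Cmod]. apply Rmax_r. }
  set (p := (p1, p2) : C).
  assert (Hpn : forall n, Cmod (x n - p)%C <= 4 * (L / 2 ^ n)).
  { intros n. replace (x n - p)%C with (RtoC (Re (x n) - p1) + Ci * RtoC (Im (x n) - p2))%C.
    2:{ apply injective_projections; simpl; unfold Re, Im; ring. }
    eapply Rle_trans; [apply Cmod_triangle|]. rewrite Cmod_mult, !Cmod_R.
    replace (Cmod Ci) with 1.
    2:{ unfold Cmod; simpl. rewrite <- sqrt_1 at 1. f_equal; ring. }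
    specialize (Hp1 n). specialize (Hp2 n). unfold Rdiv in *. lra. }
  assert (Hsmall : forall e, 0 < e -> exists n, L / 2 ^ n < e).
  { intros e He. destruct (pow_lt_1_zero (/2)) with (y := e / (L + 1)) as [n Hn].
    - rewrite Rabs_pos_eq; lra.
    - apply Rdiv_lt_0_compat; lra.
    - exists n. specialize (Hn n (Nat.le_refl n)).
      rewrite Rabs_pos_eq in Hn by (apply pow_le; lra). rewrite pow_inv in Hn.
      apply Rle_lt_trans with ((L + 1) * / 2 ^ n).
      + unfold Rdiv. apply Rmult_le_compat_r; [left; apply Rinv_0_lt_compat, P2|lra].
      + replace e with ((L + 1) * (e / (L + 1))) by (field; lra). apply Rmult_lt_compat_l; lra. }
  assert (Hp : upper_half p).
  { unfold upper_half. apply Rlt_le_trans with m; [exact Hm|]. apply le_epsilon. intros e He.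
    destruct (Hsmall (e / 2)) as [n Hn]; [lra|].
    destruct (Hnext n) as (K & _). specialize (Hp2 n). apply Rabs_le_between in Hp2.
    unfold P, x in *. destruct (seqt n) as [[an bn] cn]. simpl in *. unfold Rdiv in *. lra. }
  destruct (Hg p Hp) as [l Hl].
  apply Cmod_eq_0. apply Rle_antisym; [|apply Cmod_ge_0]. fold I.
  apply le_epsilon. intros e He. rewrite Rplus_0_l.
  (* With [h] the perimeter of the small triangle, the edges contribute at most [e' * (6 * h) * h]
     together, and [h * h = L * L / 4 ^ n] cancels the factor [4 ^ n]. The summand 1 covers
     [L = 0]. *)
  assert (He' : 0 < e / (6 * L * L + 1)) by (apply Rdiv_lt_0_compat; nra).
  destruct (Hl _ He') as [d [Hd K]]. set (e' := e / (6 * L * L + 1)) in *.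
  (* Points on the edges lie within [6 * h] of [p]: [4 * h] for the first vertex, [h] to another
     vertex and [h] along an edge. *)
  destruct (Hsmall (d / 6)) as [n Hn]; [lra|].
  specialize (HI n). specialize (HL n). specialize (Hpn n). destruct (Hnext n) as (Pn & _).
  unfold x in Hpn. destruct (seqt n) as [[an bn] cn]. simpl in HL, Hpn. destruct Pn as (An & Bn & Cn).
  set (h := L / 2 ^ n) in *.
  assert (Pab := Cmod_ge_0 (bn - an)). assert (Pbc := Cmod_ge_0 (cn - bn)). assert (Pca := Cmod_ge_0 (an - cn)).
  assert (Hedge : forall u v, upper_half u -> upper_half v ->
    Cmod (u - p)%C <= 5 * h -> Cmod (v - u)%C <= h ->
    Cmod (segment_integral g u v -
      (((g p - l * p) * v + l * v * v / 2) - ((g p - l * p) * u + l * u * u / 2)))%C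
      <= e' * (6 * h) * Cmod (v - u)%C).
  { intros u v Hu Hv Hup Huv.
    destruct (segment_integral_affine (fun z => (g p - l * p) + l * z)%C u v (g p - l * p)%C l) as [Hc' <-];
      [reflexivity|].
    apply segment_integral_near; [apply holo_segment_ccont; auto|exact Hc'|].
    intros s Hs. set (z := (u + RtoC s * (v - u))%C).
    assert (Hz : Cmod (z - p) <= 6 * h).
    { replace (z - p)%C with ((u - p) + RtoC s * (v - u))%C by (unfold z; ring).
      eapply Rle_trans; [apply Cmod_triangle|]. rewrite Cmod_mult, Cmod_R, Rabs_pos_eq by lra.
      assert (V := Cmod_ge_0 (v - u)). nra. }
    replace (g z - _)%C with (g z - g p - (z - p) * l)%C by ring.
    eapply Rle_trans; [apply K; lra|]. apply Rmult_le_compat_l; lra. }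
  assert (Ub : Cmod (bn - p) <= 5 * h).
  { replace (bn - p)%C with ((bn - an) + (an - p))%C by ring. eapply Rle_trans; [apply Cmod_triangle|]. lra. }
  assert (Uc : Cmod (cn - p) <= 5 * h).
  { replace (cn - p)%C with (- (an - cn) + (an - p))%C by ring. eapply Rle_trans; [apply Cmod_triangle|].
    rewrite Cmod_opp. lra. }
  assert (Uan : upper_half an) by (unfold upper_half; lra).
  assert (Ubn : upper_half bn) by (unfold upper_half; lra).
  assert (Ucn : upper_half cn) by (unfold upper_half; lra).
  assert (E1 := Hedge an bn Uan Ubn ltac:(lra) ltac:(lra)).
  assert (E2 := Hedge bn cn Ubn Ucn ltac:(lra) ltac:(lra)).
  assert (E3 := Hedge cn an Ucn Uan ltac:(lra) ltac:(lra)).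
  match type of E1 with Cmod ?X <= _ => set (X1 := X) in * end.
  match type of E2 with Cmod ?X <= _ => set (X2 := X) in * end.
  match type of E3 with Cmod ?X <= _ => set (X3 := X) in * end.
  assert (ET : tri_integral (an, bn, cn) = (X1 + X2 + X3)%C).
  { unfold X1, X2, X3. simpl. ring. }
  rewrite ET in HI.
  assert (T1 := Cmod_triangle (X1 + X2) X3). assert (T2 := Cmod_triangle X1 X2).
  assert (F : I / 4 ^ n <= e' * 6 * (h * h)).
  { replace (e' * 6 * (h * h)) with (e' * (6 * h) * Cmod (bn - an) + e' * (6 * h) * Cmod (cn - bn) + e' * (6 * h) * Cmod (an - cn)).
    - lra.
    - rewrite <- HL. ring. }
  assert (P4 : 0 < 4 ^ n) by (apply pow_lt; lra).
  assert (hh : h * h = L * L / 4 ^ n).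
  { unfold h. replace 4 with (2 * 2) by ring. rewrite Rpow_mult_distr. field. apply Rgt_not_eq, P2. }
  rewrite hh in F.
  assert (F' : I <= e' * (6 * L * L)).
  { apply Rmult_le_reg_r with (/ 4 ^ n); [apply Rinv_0_lt_compat; lra|]. unfold Rdiv in F. lra. }
  apply Rle_trans with (e' * (6 * L * L + 1)); [nra|]. unfold e'. right. field. nra.
Qed.

(** Integrate from [Ci] along straight segments, which stay in the convex half-plane. By Goursat on
    the triangle [Ci], [z], [y], the increment is the integral from [z] to [y]. Path independence is
    used below only through such primitives. *)
Lemma holo_primitive : exists F : C -> C, forall z, upper_half z -> is_cderiv F z (g z).
Proof.
  assert (Hi : upper_half Ci) by (unfold upper_half; simpl; lra).
  exists (fun z => segment_integral g Ci z). intros z Hz eps He.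
  destruct (Hg z Hz) as [l Hl].
  destruct (is_cderiv_cont _ _ _ Hl eps He) as [d [Hd K]].
  unfold upper_half in Hz.
  exists (Rmin d (Im z)). split; [apply Rmin_pos; lra|].
  intros y Hy.
  assert (Hy1 : Cmod (y - z) < d) by (eapply Rlt_le_trans; [exact Hy|apply Rmin_l]).
  assert (Hy2 : Cmod (y - z) < Im z) by (eapply Rlt_le_trans; [exact Hy|apply Rmin_r]).
  assert (Uy : upper_half y).
  { unfold upper_half. assert (Q := Rle_trans _ _ _ (Rmax_r _ _) (Rmax_Cmod (y - z)%C)).
    assert (Q' := Rle_lt_trans _ _ _ Q Hy2). apply Rabs_lt_between in Q'.
    unfold Im in *. simpl in Q'. lra. }
  assert (T := goursat_triangle Ci z y Hi Hz Uy). simpl in T.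
  rewrite (segment_integral_rev g Ci y) in T by (apply holo_segment_ccont; auto).
  replace (segment_integral g Ci y - segment_integral g Ci z)%C with (segment_integral g z y).
  2:{ replace (segment_integral g z y) with (segment_integral g z y - 0)%C by ring. rewrite <- T. ring. }
  destruct (segment_integral_affine (fun _ => g z) z y (g z) 0%C) as [Hc Hv]; [intros; ring|].
  replace ((y - z) * g z)%C with (segment_integral (fun _ => g z) z y) by (rewrite Hv; field).
  apply segment_integral_near; [apply holo_segment_ccont; auto|exact Hc|].
  intros s Hs. left. apply K.
  replace (z + RtoC s * (y - z) - z)%C with (RtoC s * (y - z))%C by ring.
  rewrite Cmod_mult, Cmod_R, Rabs_pos_eq by lra. assert (Q := Cmod_ge_0 (y - z)). nra.
Qed.
End Goursat.

(** * Words in T and V *)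

(* In a word, [true] stands for T and [false] for V. *)
Definition lmat (b : bool) : mat2 := if b then matT else matV.
Definition wmat (l : list bool) : mat2 := fold_right (fun b M => mmul (lmat b) M) mone l.
Definition lact (b : bool) (z : R) : R := if b then z + 1 else z / (z + 1).
Definition act (l : list bool) (z : R) : R := fold_right lact z l.
Definition lactC (b : bool) (z : C) : C := if b then (z + 1)%C else (z / (z + 1))%C.
Definition actC (l : list bool) (z : C) : C := fold_right lactC z l.

Lemma mat2_eq (A B : mat2) : ma A = ma B -> mb A = mb B -> mc A = mc B -> md A = md B -> A = B.
Proof. destruct A, B; simpl; intros; subst; reflexivity. Qed.

Lemma mmul_assoc (A B D : mat2) : mmul (mmul A B) D = mmul A (mmul B D).
Proof. apply mat2_eq; simpl; ring. Qed.

Lemma mmul_one_l (A : mat2) : mmul mone A = A.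
Proof. apply mat2_eq; cbn [mmul mone ma mb mc md]; ring. Qed.

Lemma mmul_one_r (A : mat2) : mmul A mone = A.
Proof. apply mat2_eq; cbn [mmul mone ma mb mc md]; ring. Qed.

Lemma mdet_mmul (A B : mat2) : mdet (mmul A B) = (mdet A * mdet B)%Z.
Proof. unfold mdet; simpl; ring. Qed.

Lemma wmat_app (l m : list bool) : wmat (l ++ m) = mmul (wmat l) (wmat m).
Proof.
  induction l as [|b l IH]; [symmetry; apply mmul_one_l|].
  simpl. rewrite IH, mmul_assoc. reflexivity.
Qed.

Lemma wmat_nonneg (l : list bool) : SL2Z_nonneg (wmat l).
Proof.
  induction l as [|b l [H (H1 & H2 & H3 & H4)]]; [repeat split; simpl; lia|].
  change (wmat (b :: l)) with (mmul (lmat b) (wmat l)). set (A := wmat l) in *. split.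
  - unfold SL2Z in *. rewrite mdet_mmul, H. destruct b; reflexivity.
  - destruct b; cbn [lmat mmul matT matV ma mb mc md]; lia.
Qed.

Lemma wmat_diag_pos (l : list bool) : (1 <= ma (wmat l))%Z /\ (1 <= md (wmat l))%Z.
Proof. destruct (wmat_nonneg l) as [H (H1 & H2 & H3 & H4)]. unfold SL2Z, mdet in H. nia. Qed.

Lemma wmat_cons (b : bool) (l : list bool) : wmat (b :: l) = mmul (lmat b) (wmat l).
Proof. reflexivity. Qed.

Lemma lact_pos (b : bool) (z : R) : 0 < z -> 0 < lact b z.
Proof. intros H. destruct b; simpl; [lra|]. apply Rdiv_lt_0_compat; lra. Qed.

Lemma act_pos (l : list bool) (z : R) : 0 < z -> 0 < act l z.
Proof. intros H. induction l; simpl; [exact H|]. apply lact_pos, IHl. Qed.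

Lemma lact_nonneg (b : bool) (z : R) : 0 <= z -> 0 <= lact b z.
Proof. intros H. destruct b; simpl; [lra|]. apply Rmult_le_pos; [lra|]. left; apply Rinv_0_lt_compat; lra. Qed.

Lemma act_nonneg (l : list bool) (z : R) : 0 <= z -> 0 <= act l z.
Proof. intros H. induction l; simpl; [exact H|]. apply lact_nonneg, IHl. Qed.

Lemma act_app (l m : list bool) (z : R) : act (l ++ m) z = act l (act m z).
Proof. apply fold_right_app. Qed.

Lemma wmat_real (l : list bool) :
  let A := wmat l in
  0 <= IZR (mb A) /\ 0 <= IZR (mc A) /\ 1 <= IZR (ma A) /\ 1 <= IZR (md A) /\
  IZR (ma A) * IZR (md A) - IZR (mb A) * IZR (mc A) = 1.
Proof.
  destruct (wmat_nonneg l) as [H (H1 & H2 & H3 & H4)]. destruct (wmat_diag_pos l) as [H5 H6].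
  simpl. repeat split; try (apply IZR_le; assumption).
  rewrite <- !mult_IZR, <- minus_IZR. f_equal. exact H.
Qed.

Lemma mobR_wmat (l : list bool) (z : R) : 0 <= z -> mobR (wmat l) z = act l z.
Proof.
  intros Hz. induction l as [|b l IH].
  - unfold mobR; simpl. field.
  - change (act (b :: l) z) with (lact b (act l z)). rewrite <- IH, wmat_cons.
    destruct (wmat_real l) as (Hb & Hc & Ha & Hd & _).
    set (A := wmat l) in *. unfold mobR.
    assert (0 < IZR (mc A) * z + IZR (md A)) by nra.
    assert (0 < IZR (ma A) * z + IZR (mb A) + (IZR (mc A) * z + IZR (md A))) by nra.
    destruct b; cbn [lmat mmul matT matV ma mb mc md lact];
      rewrite !plus_IZR, !mult_IZR; field; lra.
Qed.

Lemma Clin_neq_0 (x y : R) (z : C) : upper_half z -> (x <> 0 \/ y <> 0) -> (RtoC x * z + RtoC y)%C <> 0%C.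
Proof.
  unfold upper_half, Im. intros Hz H E.
  assert (E1 := f_equal fst E). assert (E2 := f_equal snd E). simpl in E1, E2.
  assert (Hx : x = 0) by nra. subst x. destruct H as [H|H]; [lra|]. apply H. lra.
Qed.

Lemma upper_half_inv (z : C) : upper_half z -> upper_half (- / z)%C.
Proof.
  unfold upper_half, Im. intros H. simpl.
  replace (- (- snd z / (fst z * (fst z * 1) + snd z * (snd z * 1)))) with (snd z / (fst z * fst z + snd z * snd z)) by (field; nra).
  apply Rdiv_lt_0_compat; nra.
Qed.

Lemma upper_half_neq_0 (z : C) : upper_half z -> z <> 0%C.
Proof. unfold upper_half. intros H ->. simpl in H. lra. Qed.

Lemma upper_half_shift (z : C) (x : R) : upper_half z -> upper_half (z + RtoC x)%C.
Proof. unfold upper_half, Im. simpl. lra. Qed.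

Lemma upper_half_lactC (b : bool) (z : C) : upper_half z -> upper_half (lactC b z).
Proof.
  intros H. destruct b; simpl; [apply upper_half_shift, H|].
  assert (H1 := upper_half_shift z 1 H).
  replace (z / (z + 1))%C with (- / (z + 1) + RtoC 1)%C by (field; apply upper_half_neq_0, H1).
  apply upper_half_shift, upper_half_inv, H1.
Qed.

Lemma upper_half_actC (l : list bool) (z : C) : upper_half z -> upper_half (actC l z).
Proof. intros H. induction l; simpl; [exact H|]. apply upper_half_lactC, IHl. Qed.

Lemma mobC_wmat (l : list bool) (z : C) : upper_half z -> mobC (wmat l) z = actC l z.
Proof.
  intros Hz. induction l as [|b l IH].
  - unfold mobC; simpl. field.
  - change (actC (b :: l) z) with (lactC b (actC l z)). rewrite <- IH, wmat_cons.
    destruct (wmat_real l) as (Hb & Hc & Ha & Hd & _).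
    set (A := wmat l) in *. unfold mobC.
    assert (N1 : (RtoC (IZR (mc A)) * z + RtoC (IZR (md A)))%C <> 0%C) by (apply Clin_neq_0; [exact Hz|right; lra]).
    assert (N2 : (RtoC (IZR (ma A) + IZR (mc A)) * z + RtoC (IZR (mb A) + IZR (md A)))%C <> 0%C) by (apply Clin_neq_0; [exact Hz|right; lra]).
    rewrite !RtoC_plus in N2.
    destruct b; cbn [lmat mmul matT matV ma mb mc md lactC];
      rewrite !plus_IZR, !mult_IZR, !RtoC_plus, !RtoC_mult.
    + field. exact N1.
    + field. split; [exact N1|]. intros E; apply N2; rewrite <- E; ring.
Qed.

(** * The integral over the arc *)

Lemma RtoC_m1 : RtoC (-1) = (- (1))%C.
Proof. apply injective_projections; simpl; ring. Qed.

Lemma upper_half_sub_real (z : C) (x : R) : upper_half z -> (z - RtoC x)%C <> 0%C.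
Proof. intros H. apply upper_half_neq_0. unfold upper_half, Im in *. simpl. lra. Qed.

Lemma is_cderiv_inv_sub (x : R) (z : C) :
  upper_half z -> is_cderiv (fun t => / (t - RtoC x))%C z (- / ((z - RtoC x) * (z - RtoC x)))%C.
Proof.
  intros Hz.
  assert (K := is_cderiv_comp Cinv (fun t => t + - RtoC x)%C z _ _
     (is_cderiv_inv _ (upper_half_sub_real z x Hz)) (is_cderiv_shift (- RtoC x) z)).
  replace (- / ((z - RtoC x) * (z - RtoC x)))%C with (- / ((z - RtoC x) * (z - RtoC x)) * 1)%C by ring.
  exact K.
Qed.

Lemma is_cderiv_lactC (b : bool) (z : C) :
  upper_half z -> is_cderiv (lactC b) z (if b then 1 else / ((z + 1) * (z + 1)))%C.
Proof.
  intros Hz. destruct b; [apply is_cderiv_shift|].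
  assert (K := is_cderiv_minus _ _ z _ _ (is_cderiv_const 1 z) (is_cderiv_inv_sub (-1) z Hz)).
  replace (/ ((z + 1) * (z + 1)))%C with (0 - - / ((z - RtoC (-1)) * (z - RtoC (-1))))%C.
  2:{ rewrite RtoC_m1. replace (z - - (1))%C with (z + 1)%C by ring. ring. }
  (* The radius [Im z] keeps [y] in the upper half-plane, where [y / (y + 1)] may be written as
     [1 - / (y + 1)]. *)
  apply (is_cderiv_ext_loc (fun y => 1 - / (y - RtoC (-1)))%C _ z _ (Im z)); [exact Hz| |exact K].
  intros y Hy.
  assert (Uy : upper_half y).
  { unfold upper_half. assert (Q := Rle_trans _ _ _ (Rmax_r _ _) (Rmax_Cmod (y - z)%C)).
    assert (Q' := Rle_lt_trans _ _ _ Q Hy). apply Rabs_lt_between in Q'.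
    unfold Im in *. simpl in Q'. lra. }
  simpl. rewrite RtoC_m1. field. apply upper_half_neq_0, (upper_half_shift y 1 Uy).
Qed.

Definition circ (t : R) : C := (cos t, sin t).

Lemma Cexp_circ (t : R) : Cexp (Ci * RtoC t)%C = circ t.
Proof.
  unfold Cexp, circ; simpl.
  replace (0 * t - 1 * 0) with 0 by ring. replace (0 * 0 + 1 * t) with t by ring.
  rewrite exp_0, !Rmult_1_l. reflexivity.
Qed.

Lemma is_rderiv_circ (t : R) : is_rderiv circ t (Ci * circ t)%C.
Proof.
  apply is_derive_components_rderiv; unfold Re, Im; simpl; auto_derive; trivial; ring.
Qed.

Lemma upper_half_circ (t : R) : 0 < t < PI -> upper_half (circ t).
Proof. intros H. unfold upper_half; simpl. apply sin_gt_0; lra. Qed.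

Definition rho : C := circ (2 * PI / 3).

Lemma cos_2PI3' : cos (2 * PI / 3) = - (1 / 2).
Proof. replace (2 * PI / 3) with (PI - PI / 3) by field. rewrite cos_minus, cos_PI, sin_PI, cos_PI3. lra. Qed.
Lemma sin_2PI3' : sin (2 * PI / 3) = sin (PI / 3).
Proof. replace (2 * PI / 3) with (PI - PI / 3) by field. apply sin_PI_x. Qed.

Lemma lactC_rho (b : bool) : lactC b rho = circ (PI / 3).
Proof.
  assert (S : sin (PI / 3) * sin (PI / 3) = 3 / 4).
  { assert (Q := sin2_cos2 (PI / 3)). unfold Rsqr in Q. rewrite cos_PI3 in Q. lra. }
  unfold rho, circ. rewrite cos_2PI3', sin_2PI3', cos_PI3.
  destruct b; simpl.
  - apply injective_projections; simpl; lra.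
  - apply injective_projections; simpl;
    (match goal with |- context [?x * (?x * 1) + ?y * (?y * 1)] =>
      replace (x * (x * 1) + y * (y * 1)) with (1 / 4 + sin (PI / 3) * sin (PI / 3)) by (simpl; field) end);
    rewrite S; field_simplify; nra.
Qed.

Lemma upper_half_rho : upper_half rho.
Proof. apply upper_half_circ. assert (P := PI_RGT_0). lra. Qed.

Section Kernel.
Variable f : C -> C.
Hypothesis Hholo : forall z, upper_half z -> exists l, is_cderiv f z l.
Hypothesis Hmod : forall A z, SL2Z A -> upper_half z -> f (mobC A z) = f z.

(** The integrand of [I_f] in partial fractions, which makes sense for any two real poles. The
    recursion along a word needs poles that are not fixed by the letters applied. *)
Definition ker (w v : R) (z : C) : C := (f z * (/ (z - RtoC w) - / (z - RtoC v)))%C.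

Lemma ker_holo (w v : R) (z : C) : upper_half z -> exists l, is_cderiv (ker w v) z l.
Proof.
  intros Hz. destruct (Hholo z Hz) as [l Hl].
  eexists. apply (is_cderiv_mult f); [exact Hl|].
  apply is_cderiv_minus; apply is_cderiv_inv_sub; exact Hz.
Qed.

Lemma f_lactC (b : bool) (z : C) : upper_half z -> f (lactC b z) = f z.
Proof.
  intros Hz. rewrite <- (Hmod (wmat [b]) z); [|apply wmat_nonneg|exact Hz].
  rewrite mobC_wmat by exact Hz. reflexivity.
Qed.

(* The cocycle term [1 / (z + 1)] coming from V cancels in the difference of the two poles. *)
Lemma ker_lactC (b : bool) (u v : R) (z : C) : 0 < u -> 0 < v -> upper_half z ->
  (ker (- u) (lact b v) (lactC b z) * (if b then 1 else / ((z + 1) * (z + 1))) =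
   ker (- lact b u) v z)%C.
Proof.
  intros Hu Hv Hz. unfold ker. rewrite f_lactC by exact Hz.
  rewrite <- Cmult_assoc. f_equal.
  assert (N1 := upper_half_neq_0 _ (upper_half_shift z 1 Hz)).
  destruct b; cbn [lact lactC].
  - rewrite !RtoC_opp, !RtoC_plus, Cmult_1_r. f_equal; f_equal; ring.
  - rewrite !RtoC_opp.
    rewrite !RtoC_div, !RtoC_plus by lra.
    assert (Hu1 : (RtoC u + 1)%C <> 0%C) by (intros E; apply (f_equal fst) in E; simpl in E; lra).
    assert (Hv1 : (RtoC v + 1)%C <> 0%C) by (intros E; apply (f_equal fst) in E; simpl in E; lra).
    assert (N2 : (z * (RtoC u + 1) + RtoC u)%C <> 0%C).
    { replace (z * (RtoC u + 1) + RtoC u)%C with (RtoC (u + 1) * z + RtoC u)%C by (rewrite RtoC_plus; ring).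
      apply Clin_neq_0; [exact Hz|left; lra]. }
    assert (N3 : (z - RtoC v)%C <> 0%C) by apply (upper_half_sub_real z v Hz).
    field.
    repeat split; auto.
    all: intros E; first [apply N2; rewrite <- E; ring | apply N3; rewrite <- E; ring].
Qed.

Definition J (w v : R) (z0 z1 : C) : C := segment_integral (ker w v) z0 z1.

Lemma J_primitive (w v : R) (F : C -> C) (z0 z1 : C) :
  (forall z, upper_half z -> is_cderiv F z (ker w v z)) ->
  upper_half z0 -> upper_half z1 -> J w v z0 z1 = (F z1 - F z0)%C.
Proof.
  intros HF H0 H1. apply segment_integral_primitive.
  - apply holo_segment_ccont; auto. apply ker_holo.
  - intros s Hs. apply HF, upper_half_seg; auto.
Qed.

Lemma J_chasles (w v : R) (z0 z1 z2 : C) : upper_half z0 -> upper_half z1 -> upper_half z2 ->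
  (J w v z0 z1 + J w v z1 z2 = J w v z0 z2)%C.
Proof.
  intros H0 H1 H2. destruct (holo_primitive _ (ker_holo w v)) as [F HF].
  rewrite !(J_primitive w v F) by auto. ring.
Qed.

(** If [F] is a primitive of the kernel on the left, then [F] composed with [lactC b] is one of the
    pulled-back kernel. The pull-back moves the letter from the pole [v] to the pole [- u]. *)
Lemma J_lact (b : bool) (u v : R) (z0 z1 : C) : 0 < u -> 0 < v -> upper_half z0 -> upper_half z1 ->
  J (- u) (lact b v) (lactC b z0) (lactC b z1) = J (- lact b u) v z0 z1.
Proof.
  intros Hu Hv H0 H1.
  destruct (holo_primitive _ (ker_holo (- u) (lact b v))) as [F HF].
  rewrite (J_primitive _ _ F) by auto using upper_half_lactC.
  rewrite (J_primitive _ _ (fun z => F (lactC b z))); auto.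
  intros z Hz. rewrite <- ker_lactC by auto.
  apply is_cderiv_comp; [apply HF, upper_half_lactC, Hz|apply is_cderiv_lactC, Hz].
Qed.

(** The first letter of [l] is the outermost at [v] but is the first to reach [u], hence the
    reversal. *)
Lemma J_act (l : list bool) (u v : R) (z0 z1 : C) : 0 < u -> 0 < v -> upper_half z0 -> upper_half z1 ->
  J (- u) (act l v) (actC l z0) (actC l z1) = J (- act (rev l) u) v z0 z1.
Proof.
  intros Hu Hv H0 H1. revert u Hu. induction l as [|b l IH]; intros u Hu; [reflexivity|].
  cbn [rev]. rewrite act_app.
  change (actC (b :: l)) with (fun z => lactC b (actC l z)).
  change (act (b :: l) v) with (lact b (act l v)). change (act [b] u) with (lact b u).
  etransitivity; [apply J_lact; auto using act_pos, upper_half_actC|].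
  apply IH, lact_pos, Hu.
Qed.

Definition Farc (t : R) : R := Re (f (circ t)).
Hypothesis Hreal : forall t, PI / 3 <= t <= 2 * PI / 3 -> Im (f (circ t)) = 0 /\ 0 <= Farc t.

(** The modular substitution z -> -1/z sends e^(it) to e^(i(pi-t)). *)
Lemma Farc_sym (t : R) : 0 < t < PI -> Farc (PI - t) = Farc t.
Proof.
  intros Ht. unfold Farc. f_equal.
  rewrite <- (Hmod (Mat2 0 (-1) 1 0) (circ t)); [|reflexivity|apply upper_half_circ, Ht].
  f_equal. unfold mobC; cbn [ma mb mc md].
  assert (N := upper_half_neq_0 _ (upper_half_circ t Ht)).
  replace ((RtoC 0 * circ t + RtoC (-1)) / (RtoC 1 * circ t + RtoC 0))%C with (- / circ t)%C
    by (rewrite RtoC_m1; field; exact N).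
  assert (Q := sin2_cos2 t). unfold Rsqr in Q.
  unfold circ. rewrite sin_PI_x. replace (PI - t) with (- t + PI) by ring. rewrite neg_cos, cos_neg.
  apply injective_projections; simpl;
  replace (cos t * (cos t * 1) + sin t * (sin t * 1)) with 1 by lra; field.
Qed.

Lemma Farc_continuous (t : R) : 0 < t < PI -> continuous Farc t.
Proof.
  intros Ht. destruct (Hholo _ (upper_half_circ t Ht)) as [l Hl].
  apply (ex_derive_continuous (V := R_NormedModule)).
  eexists. apply is_rderiv_Re. apply (is_rderiv_comp f); [exact Hl|apply is_rderiv_circ].
Qed.

(* Minus the imaginary part of [1 / (1 - e^(-it) v)]. *)
Definition poisson (t v : R) : R := sin t * v / (v * v - 2 * v * cos t + 1).

Lemma poisson_den (t v : R) : 0 < sin t -> 0 < v -> 0 < v * v - 2 * v * cos t + 1.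
Proof.
  intros Ht Hv. assert (Q := sin2_cos2 t). unfold Rsqr in Q.
  replace (v * v - 2 * v * cos t + 1) with ((v - cos t) * (v - cos t) + sin t * sin t) by nra.
  assert (0 < sin t * sin t) by (apply Rmult_lt_0_compat; lra).
  assert (0 <= (v - cos t) * (v - cos t)) by apply Rle_0_sqr. lra.
Qed.

Lemma arc_sin_pos (t : R) : PI / 3 <= t <= 2 * PI / 3 -> 0 < sin t.
Proof. intros H. assert (P := PI_RGT_0). apply sin_gt_0; lra. Qed.

Lemma arc_reflect (t : R) : PI / 3 <= t <= 2 * PI / 3 -> PI / 3 <= PI - t <= 2 * PI / 3.
Proof. lra. Qed.

Lemma Farc_poisson_continuous (t v : R) : PI / 3 <= t <= 2 * PI / 3 -> 0 < v ->
  continuous (fun t => Farc t * poisson t v) t /\ continuous (fun t => Farc t * poisson (PI - t) v) t.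
Proof.
  intros Ht Hv. assert (P := PI_RGT_0).
  assert (D := poisson_den t v (arc_sin_pos t Ht) Hv).
  assert (D' := poisson_den (PI - t) v (arc_sin_pos (PI - t) (arc_reflect t Ht)) Hv).
  split; (apply (continuous_mult (K := R_AbsRing)); [apply Farc_continuous; lra|]);
  apply (ex_derive_continuous (V := R_NormedModule)); unfold poisson; auto_derive;
  apply Rgt_not_eq; [exact D|exact D'].
Qed.

Lemma ex_RInt_arc (h : R -> R) :
  (forall t, PI / 3 <= t <= 2 * PI / 3 -> continuous h t) -> ex_RInt h (PI / 3) (2 * PI / 3).
Proof.
  intros H. apply (ex_RInt_continuous (V := R_CompleteNormedModule)). intros t Ht. apply H.
  assert (P := PI_RGT_0). rewrite Rmin_left, Rmax_right in Ht by lra. exact Ht.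
Qed.

Definition G (v : R) : R := RInt (fun t => Farc t * poisson t v) (PI / 3) (2 * PI / 3).

Lemma G_reflect (v : R) : 0 < v ->
  RInt (fun t => Farc t * poisson (PI - t) v) (PI / 3) (2 * PI / 3) = G v.
Proof.
  intros Hv. assert (P := PI_RGT_0).
  assert (Ex : ex_RInt (fun t => Farc t * poisson t v) (PI / 3) (2 * PI / 3)).
  { apply ex_RInt_arc. intros t Ht. apply Farc_poisson_continuous; auto. }
  assert (K := is_RInt_swap _ _ _ _ (RInt_correct (V := R_CompleteNormedModule) _ _ _ Ex)).
  replace (PI / 3) with (-1 * (2 * PI / 3) + PI) in K at 1 by field.
  replace (2 * PI / 3) with (-1 * (PI / 3) + PI) in K at 1 by field.
  apply (is_RInt_comp_lin (V := R_NormedModule)) in K. apply (is_RInt_opp (V := R_NormedModule)) in K.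
  rewrite opp_opp in K. apply (is_RInt_unique (V := R_CompleteNormedModule)).
  refine (is_RInt_ext _ _ _ _ _ _ K).
  intros t Ht. rewrite Rmin_left, Rmax_right in Ht by lra.
  unfold opp, scal; simpl. unfold mult; simpl.
  replace (-1 * t + PI) with (PI - t) by ring. rewrite Farc_sym by lra. ring.
Qed.

(** As [f] is real on the arc and the velocity is [Ci * circ t], only the imaginary parts of the two
    fractions survive. The pole [- u] is [u] turned by a half circle, which replaces [t] by
    [PI - t]. *)
Lemma ker_circ (u v t : R) : PI / 3 <= t <= 2 * PI / 3 -> 0 < u -> 0 < v ->
  Re (ker (- u) v (circ t) * (Ci * circ t))%C = - (Farc t * poisson (PI - t) u + Farc t * poisson t v).
Proof.
  intros Ht Hu Hv. destruct (Hreal t Ht) as [H0 _]. unfold ker, Farc in *.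
  assert (D := poisson_den t v (arc_sin_pos t Ht) Hv).
  assert (D' := poisson_den (PI - t) u (arc_sin_pos (PI - t) (arc_reflect t Ht)) Hu).
  unfold poisson. rewrite sin_PI_x. replace (PI - t) with (- t + PI) in * by ring. rewrite neg_cos, cos_neg in *.
  destruct (f (circ t)) as [x y]. simpl in *. subst y.
  assert (Q := sin2_cos2 t). unfold Rsqr in Q.
  replace ((cos t + - - u) * ((cos t + - - u) * 1) + (sin t + - 0) * ((sin t + - 0) * 1)) with (u * u - 2 * u * - cos t + 1) by lra.
  replace ((cos t + - v) * ((cos t + - v) * 1) + (sin t + - 0) * ((sin t + - 0) * 1)) with (v * v - 2 * v * cos t + 1) by lra.
  set (E1 := u * u - 2 * u * - cos t + 1) in *. set (E2 := v * v - 2 * v * cos t + 1) in *.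
  unfold Rdiv. field; lra.
Qed.

(** [J] runs along the chord; a primitive exchanges the chord for the unit arc. That arc is
    traversed from [2 * PI / 3] down to [PI / 3], which absorbs the minus sign of [ker_circ]. *)
Lemma J_arc (u v : R) (b : bool) : 0 < u -> 0 < v -> Re (J (- u) v rho (lactC b rho)) = G u + G v.
Proof.
  intros Hu Hv. assert (P := PI_RGT_0).
  destruct (holo_primitive _ (ker_holo (- u) v)) as [F HF].
  rewrite (J_primitive _ _ F) by auto using upper_half_rho, upper_half_lactC.
  rewrite lactC_rho. unfold rho.
  rewrite <- (G_reflect u Hu).
  assert (K1 : ex_RInt (fun t => Farc t * poisson (PI - t) u) (PI / 3) (2 * PI / 3)).
  { apply ex_RInt_arc. intros t Ht. apply Farc_poisson_continuous; auto. }
  assert (K2 : ex_RInt (fun t => Farc t * poisson t v) (PI / 3) (2 * PI / 3)).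
  { apply ex_RInt_arc. intros t Ht. apply Farc_poisson_continuous; auto. }
  unfold G. change Rplus with (@plus R_AbelianGroup).
  rewrite <- (RInt_plus (V := R_CompleteNormedModule)) by assumption.
  symmetry. apply (is_RInt_unique (V := R_CompleteNormedModule)).
  replace (Re (F (circ (PI / 3)) - F (circ (2 * PI / 3)))%C) with
    (opp (minus (Re (F (circ (2 * PI / 3)))) (Re (F (circ (PI / 3))))))
    by (unfold opp, minus, plus, opp; simpl; unfold Re; ring).
  apply (is_RInt_ext (V := R_NormedModule) (fun t => opp (- (Farc t * poisson (PI - t) u + Farc t * poisson t v)))).
  { intros t _. unfold opp, plus; simpl. ring. }
  apply (is_RInt_opp (V := R_NormedModule)).
  apply (is_RInt_derive (V := R_CompleteNormedModule) (fun t => Re (F (circ t)))).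
  - intros t Ht. rewrite Rmin_left, Rmax_right in Ht by lra.
    rewrite <- ker_circ by auto. apply is_rderiv_Re. apply (is_rderiv_comp F).
    + apply HF, upper_half_circ; lra.
    + apply is_rderiv_circ.
  - intros t Ht. rewrite Rmin_left, Rmax_right in Ht by lra.
    apply (continuous_opp (V := R_NormedModule)).
    apply (continuous_plus (V := R_NormedModule)); apply Farc_poisson_continuous; auto.
Qed.

(** If [z] is fixed by [l = p ++ m], then [act m z] is fixed by [m ++ p]; so at a fixed point the
    sum runs over the fixed points of all cyclic rotations. *)
Fixpoint suffix_sum (l : list bool) (z : R) : R :=
  match l with
  | [] => 0
  | b :: l' => G (act l z) + suffix_sum l' z
  end.

Lemma suffix_sum_app (l m : list bool) (z : R) :
  suffix_sum (l ++ m) z = suffix_sum l (act m z) + suffix_sum m z.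
Proof.
  induction l as [|b l IH]; cbn [app suffix_sum]; [ring|].
  rewrite IH, app_comm_cons, act_app. ring.
Qed.

(** Each letter contributes one [J_arc]. On the side of [u] the path meets [u] but not the final
    point [act (rev l) u], whereas [suffix_sum] counts the final point and not [u]; the two extra
    terms repair this shift and cancel at a fixed point. *)
Lemma J_suffix_sum (l : list bool) (u v : R) : 0 < u -> 0 < v ->
  Re (J (- u) (act l v) rho (actC l rho)) + G (act (rev l) u) =
  G u + suffix_sum (rev l) u + suffix_sum l v.
Proof.
  intros Hu Hv. revert u Hu. induction l as [|b l IH]; intros u Hu.
  - cbn [rev act actC fold_right suffix_sum].
    destruct (holo_primitive _ (ker_holo (- u) v)) as [F HF].
    rewrite (J_primitive _ _ F) by auto using upper_half_rho. unfold Re. simpl. ring.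
  - cbn [rev]. rewrite suffix_sum_app, act_app.
    change (act (b :: l) v) with (lact b (act l v)). change (actC (b :: l) rho) with (lactC b (actC l rho)).
    change (act [b] u) with (lact b u).
    assert (H1 := lact_pos b u Hu).
    specialize (IH (lact b u) H1).
    rewrite <- (J_chasles _ _ rho (lactC b rho)) by auto using upper_half_rho, upper_half_lactC, upper_half_actC.
    rewrite J_lact by auto using upper_half_rho, upper_half_actC, act_pos.
    replace (Re (J (- u) (lact b (act l v)) rho (lactC b rho) + J (- lact b u) (act l v) rho (actC l rho))%C) with
      (Re (J (- u) (lact b (act l v)) rho (lactC b rho)) + Re (J (- lact b u) (act l v) rho (actC l rho))) by reflexivity.
    rewrite J_arc by auto using lact_pos, act_pos.
    cbn [suffix_sum]. change (act (b :: l) v) with (lact b (act l v)). change (act [b] u) with (lact b u). lra.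
Qed.

(** With both poles fixed the differential is invariant under the word, so the integral over a
    period does not depend on the base point, and [z] may be replaced by [rho]. *)
Lemma J_period (l : list bool) (u v : R) (z : C) : 0 < u -> 0 < v -> upper_half z ->
  act l v = v -> act (rev l) u = u ->
  Re (J (- u) v z (actC l z)) = suffix_sum l v + suffix_sum (rev l) u.
Proof.
  intros Hu Hv Hz Ev Eu.
  assert (K := J_suffix_sum l u v Hu Hv). rewrite Ev, Eu in K.
  assert (K2 := J_act l u v rho z Hu Hv upper_half_rho Hz). rewrite Ev, Eu in K2.
  assert (C1 := J_chasles (- u) v rho z (actC l z) upper_half_rho Hz (upper_half_actC l z Hz)).
  assert (C2 := J_chasles (- u) v rho (actC l rho) (actC l z) upper_half_rho (upper_half_actC l _ upper_half_rho) (upper_half_actC l z Hz)).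
  rewrite K2 in C2. rewrite <- C2 in C1.
  apply (f_equal Re) in C1.
  change (Re (J (- u) v rho z) + Re (J (- u) v z (actC l z)) =
    Re (J (- u) v rho (actC l rho)) + Re (J (- u) v rho z)) in C1.
  lra.
Qed.
End Kernel.

(** * Quadratic forms of hyperbolic words *)

(** By ad = 1 + bc the trace is 2 exactly when bc = 0. This turns hyperbolicity into the occurrence
    of both letters. *)
Lemma hyperbolic_word_offdiag (l : list bool) :
  hyperbolic (wmat l) <-> (1 <= mb (wmat l))%Z /\ (1 <= mc (wmat l))%Z.
Proof.
  destruct (wmat_nonneg l) as [H (H1 & H2 & H3 & H4)].
  unfold hyperbolic, SL2Z, mdet, mtrace in *. split.
  - intros Hh.
    assert (mb (wmat l) * mc (wmat l) <> 0)%Z.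
    { intros E. assert (E1 : (ma (wmat l) * md (wmat l) = 1)%Z) by lia.
      destruct (Z.eq_mul_1_nonneg (ma (wmat l)) (md (wmat l)) ltac:(lia) E1) as [E2 E3]. lia. }
    nia.
  - intros [Hb Hc]. nia.
Qed.

Lemma fixed_point_eq (A : mat2) (w : R) :
  fixed_point A w -> IZR (mc A) * w * w + (IZR (md A) - IZR (ma A)) * w - IZR (mb A) = 0.
Proof.
  intros [Hn H]. unfold mobR in H.
  assert (E : IZR (ma A) * w + IZR (mb A) = w * (IZR (mc A) * w + IZR (md A))).
  { rewrite <- H at 2. field. exact Hn. }
  lra.
Qed.

Lemma Derive_mobR (A : mat2) (w : R) :
  SL2Z A -> IZR (mc A) * w + IZR (md A) <> 0 ->
  Derive (mobR A) w = / ((IZR (mc A) * w + IZR (md A)) * (IZR (mc A) * w + IZR (md A))).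
Proof.
  intros HA Hn. apply is_derive_unique. unfold mobR. auto_derive; [exact Hn|].
  assert (E : IZR (ma A) * IZR (md A) - IZR (mb A) * IZR (mc A) = 1).
  { rewrite <- !mult_IZR, <- minus_IZR. f_equal. exact HA. }
  transitivity ((IZR (ma A) * IZR (md A) - IZR (mb A) * IZR (mc A)) / ((IZR (mc A) * w + IZR (md A)) * (IZR (mc A) * w + IZR (md A)))).
  - field. exact Hn.
  - rewrite E. field. exact Hn.
Qed.

Section Word.
Variable l : list bool.
Let A := wmat l.
Hypothesis Hhyp : hyperbolic A.

Lemma hyp_word_real :
  1 <= IZR (ma A) /\ 1 <= IZR (mb A) /\ 1 <= IZR (mc A) /\ 1 <= IZR (md A) /\
  IZR (ma A) * IZR (md A) - IZR (mb A) * IZR (mc A) = 1.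
Proof.
  destruct (wmat_real l) as (_ & _ & Ha & Hd & Hdet).
  destruct (proj1 (hyperbolic_word_offdiag l) Hhyp) as [Hb Hc].
  repeat split; auto; apply IZR_le; assumption.
Qed.

(** The derivative is 1/(cw+d)^2, which is below 1 for positive [w]; and 0 is not fixed because b is
    at least 1. *)
Lemma repelling_neg (w : R) : repelling A w -> w < 0.
Proof.
  intros [Hf Hd]. destruct hyp_word_real as (Ha & Hb & Hc & Hdd & Hdet).
  assert (E := fixed_point_eq _ _ Hf).
  rewrite Derive_mobR in Hd; [|apply wmat_nonneg|apply Hf].
  destruct (Rlt_le_dec w 0) as [|Hw]; [assumption|exfalso].
  set (q := IZR (mc A) * w + IZR (md A)) in *.
  assert (Hw' : 0 < w) by (destruct (Req_dec w 0); [subst w; lra|lra]).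
  assert (1 < q) by (unfold q; nra).
  rewrite Rabs_pos_eq in Hd by (left; apply Rinv_0_lt_compat; nra).
  assert (/ (q * q) < / 1) by (apply Rinv_lt_contravar; nra).
  lra.
Qed.

Lemma is_form_of_roots (Q : qform) : is_form_of A Q ->
  exists u v, 0 < u /\ 0 < v /\
    IZR (mc A) * u * u + (IZR (ma A) - IZR (md A)) * u - IZR (mb A) = 0 /\
    IZR (mc A) * v * v + (IZR (md A) - IZR (ma A)) * v - IZR (mb A) = 0 /\
    forall z, upper_half z ->
      (RtoC (sqrt (IZR (qdisc Q))) / qeval Q z (RtoC 1) = / (z - RtoC (- u)) - / (z - RtoC v))%C.
Proof.
  intros [_ (w & v & Hw & Hv & Qw & Qv & Hs)].
  assert (Nw := repelling_neg w Hw).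
  destruct hyp_word_real as (Ha & Hb & Hc & Hdd & Hdet).
  assert (Ew := fixed_point_eq _ _ (proj1 Hw)). assert (Ev := fixed_point_eq _ _ (proj1 Hv)).
  assert (Nwv : w <> v).
  { intros ->. destruct Hw as [_ H1]. destruct Hv as [_ H2]. lra. }
  assert (Hsum : IZR (mc A) * (w + v) + (IZR (md A) - IZR (ma A)) = 0).
  { apply (Rmult_eq_reg_r (w - v)); [|lra]. lra. }
  assert (Hprod : IZR (mc A) * (w * v) = - IZR (mb A)).
  { assert (IZR (mc A) * (w * v) = w * (IZR (mc A) * (w + v) + (IZR (md A) - IZR (ma A))) - (IZR (mc A) * w * w + (IZR (md A) - IZR (ma A)) * w - IZR (mb A)) - IZR (mb A)) by ring.
    rewrite Hsum, Ew in H. lra. }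
  assert (Pv : 0 < v).
  { destruct (Rlt_le_dec 0 v); [assumption|exfalso].
    assert (0 <= w * v) by nra. nra. }
  exists (- w), v. split; [lra|]. split; [exact Pv|]. split; [lra|]. split; [exact Ev|].
  intros z Hz. rewrite Ropp_involutive.
  destruct Q as [qa qb qc]. unfold qdisc, qeval in *. simpl Defs.qa in *. simpl Defs.qb in *. simpl Defs.qc in *.
  apply (f_equal fst) in Qw. apply (f_equal fst) in Qv. simpl in Qw, Qv.
  rewrite !minus_IZR, !mult_IZR.
  set (a := IZR qa) in *. set (b := IZR qb) in *. set (c := IZR qc) in *.
  assert (Eb : b = - a * (w + v)).
  { apply (Rmult_eq_reg_r (w - v)); [|lra]. lra. }
  assert (Ec : c = a * (w * v)).
  { rewrite Eb in Qw. lra. }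
  rewrite (sign_eq_m1 (w - v)) in Hs by lra.
  assert (Na : a < 0).
  { destruct (Rlt_le_dec a 0) as [|H]; [assumption|exfalso].
    destruct H as [H|H]; [rewrite sign_eq_1 in Hs; lra|rewrite <- H, sign_0 in Hs; lra]. }
  (* [a] and [w - v] are both negative, so [a * (w - v)] is the positive root of the discriminant.
     Here the sign convention of the form fixes the sign of the differential. *)
  replace (b * b - 4 * a * c) with ((a * (w - v)) * (a * (w - v))) by (rewrite Eb, Ec; ring).
  rewrite sqrt_square by nra.
  assert (N1 := upper_half_sub_real z w Hz). assert (N2 := upper_half_sub_real z v Hz).
  assert (N3 : RtoC a <> 0%C) by (intros E; apply (f_equal fst) in E; simpl in E; lra).
  replace (RtoC a * z * z + RtoC b * z * 1 + RtoC c * 1 * 1)%C with (RtoC a * ((z - RtoC w) * (z - RtoC v)))%C.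
  2:{ rewrite Eb, Ec, !RtoC_mult, RtoC_opp, RtoC_plus. ring. }
  rewrite RtoC_mult, RtoC_minus. field. auto.
Qed.

(** Needed to unfold the epsilon in [form_of]. The form is (-c, a - d, b) divided by its content,
    with negative leading coefficient because the repelling root is the smaller one. *)
Lemma is_form_of_exists : exists Q, is_form_of A Q.
Proof.
  destruct hyp_word_real as (Ha & Hb & Hc & Hdd & Hdet).
  destruct (proj1 (hyperbolic_word_offdiag l) Hhyp) as [Zb Zc]. fold A in Zb, Zc.
  set (e := Z.gcd (ma A - md A) (mb A)).
  set (d := Z.gcd (- mc A) e).
  assert (Hd : (0 < d)%Z).
  { assert (0 <= d)%Z by apply Z.gcd_nonneg.
    assert (d <> 0)%Z by (intros E; apply Z.gcd_eq_0_l in E; lia). lia. }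
  assert (D1 : (d | - mc A)%Z) by apply Z.gcd_divide_l.
  assert (De : (d | e)%Z) by apply Z.gcd_divide_r.
  assert (D2 : (d | ma A - md A)%Z) by (eapply Z.divide_trans; [exact De|apply Z.gcd_divide_l]).
  assert (D3 : (d | mb A)%Z) by (eapply Z.divide_trans; [exact De|apply Z.gcd_divide_r]).
  exists (QForm (- mc A / d) ((ma A - md A) / d) (mb A / d)).
  assert (Pd : 0 < IZR d) by (apply (IZR_lt 0); exact Hd).
  assert (Q1 : IZR (- mc A / d) * IZR d = - IZR (mc A)).
  { rewrite <- mult_IZR, <- opp_IZR. f_equal. rewrite Z.mul_comm. symmetry. apply Z_div_exact_full_2; [lia|]. apply Z.mod_divide; [lia|exact D1]. }
  assert (Q2 : IZR ((ma A - md A) / d) * IZR d = IZR (ma A) - IZR (md A)).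
  { rewrite <- mult_IZR, <- minus_IZR. f_equal. rewrite Z.mul_comm. symmetry. apply Z_div_exact_full_2; [lia|]. apply Z.mod_divide; [lia|exact D2]. }
  assert (Q3 : IZR (mb A / d) * IZR d = IZR (mb A)).
  { rewrite <- mult_IZR. f_equal. rewrite Z.mul_comm. symmetry. apply Z_div_exact_full_2; [lia|]. apply Z.mod_divide; [lia|exact D3]. }
  split.
  { unfold qprimitive; cbn [Defs.qa Defs.qb Defs.qc]. rewrite (Z.gcd_div_factor (ma A - md A)) by auto. fold e.
    rewrite Z.gcd_div_factor by auto. fold d. apply Z_div_same_full. lia. }
  set (t := IZR (ma A) + IZR (md A)).
  assert (Ht : 3 <= t).
  { unfold t. rewrite <- plus_IZR. apply IZR_le.
    destruct (wmat_nonneg l) as [H (H1 & H2 & H3 & H4)]. fold A in H, H1, H2, H3, H4.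
    unfold SL2Z, mdet in H. nia. }
  set (r := sqrt (t * t - 4)).
  assert (Hr : r * r = t * t - 4) by (apply sqrt_def; nra).
  assert (Hr0 : 0 < r) by (apply sqrt_lt_R0; nra).
  assert (Hrt : r < t) by nra.
  assert (Hrt2 : t - 2 < r) by nra.
  set (a := IZR (ma A)) in *. set (b := IZR (mb A)) in *. set (c := IZR (mc A)) in *. set (dd := IZR (md A)) in *.
  assert (Hbc : b * c = a * dd - 1) by lra.
  assert (Hr' : r * r = (a - dd) * (a - dd) + 4 * (b * c)) by (rewrite Hr, Hbc; unfold t; ring).
  assert (Hroot : forall x, 2 * c * x = (a - dd) + r \/ 2 * c * x = (a - dd) - r -> c * x * x + (dd - a) * x - b = 0).
  { intros x Hx. apply (Rmult_eq_reg_l (4 * c)); [|lra].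
    replace (4 * c * (c * x * x + (dd - a) * x - b)) with ((2 * c * x) * (2 * c * x) + 2 * (dd - a) * (2 * c * x) - 4 * (b * c)) by ring.
    destruct Hx as [-> | ->]; lra. }
  set (w := ((a - dd) - r) / (2 * c)). set (v := ((a - dd) + r) / (2 * c)).
  assert (Hw : 2 * c * w = (a - dd) - r) by (unfold w; field; lra).
  assert (Hv : 2 * c * v = (a - dd) + r) by (unfold v; field; lra).
  (* At a fixed point cx + d is an eigenvalue of the matrix; the smaller one, below 1, gives a
     derivative above 1. *)
  assert (Dw : c * w + dd = (t - r) / 2) by (unfold t; lra).
  assert (Dv : c * v + dd = (t + r) / 2) by (unfold t; lra).
  assert (Fix : forall x, c * x * x + (dd - a) * x - b = 0 -> c * x + dd <> 0 -> fixed_point A x).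
  { intros x Hx Hn. split; [exact Hn|]. unfold mobR. fold a b c dd.
    apply (Rmult_eq_reg_r (c * x + dd)); [|exact Hn]. field_simplify; [|exact Hn]. lra. }
  assert (Ew := Hroot w (or_intror Hw)). assert (Ev := Hroot v (or_introl Hv)).
  exists w, v. repeat split.
  - fold c dd. lra.
  - apply Fix; [exact Ew|lra].
  - rewrite Derive_mobR; [|apply wmat_nonneg|fold c dd; lra]. fold c dd. rewrite Dw.
    assert (0 < (t - r) / 2 < 1) by lra. set (q := (t - r) / 2) in *.
    rewrite Rabs_pos_eq by (left; apply Rinv_0_lt_compat; nra).
    rewrite <- Rinv_1. apply Rinv_lt_contravar; nra.
  - fold c dd. lra.
  - apply Fix; [exact Ev|lra].
  - rewrite Derive_mobR; [|apply wmat_nonneg|fold c dd; lra]. fold c dd. rewrite Dv.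
    assert (1 < (t + r) / 2) by lra. set (q := (t + r) / 2) in *.
    rewrite Rabs_pos_eq by (left; apply Rinv_0_lt_compat; nra).
    rewrite <- Rinv_1. apply Rinv_lt_contravar; nra.
  - apply injective_projections; simpl; [|ring].
    apply (Rmult_eq_reg_r (IZR d)); [|lra].
    match goal with |- ?L * _ = _ => replace (L * IZR d) with ((IZR (- mc A / d) * IZR d) * w * w + (IZR ((ma A - md A) / d) * IZR d) * w + IZR (mb A / d) * IZR d) by ring end.
    rewrite Q1, Q2, Q3. lra.
  - apply injective_projections; simpl; [|ring].
    apply (Rmult_eq_reg_r (IZR d)); [|lra].
    match goal with |- ?L * _ = _ => replace (L * IZR d) with ((IZR (- mc A / d) * IZR d) * v * v + (IZR ((ma A - md A) / d) * IZR d) * v + IZR (mb A / d) * IZR d) by ring end.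
    rewrite Q1, Q2, Q3. lra.
  - simpl Defs.qa. rewrite (sign_eq_m1 (w - v)), sign_eq_m1; [reflexivity| |].
    + destruct (Rlt_le_dec (IZR (- mc A / d)) 0); [assumption|nra].
    + nra.
Qed.
End Word.

(* The right-hand side is [- A^(-1) (- u)] for the matrix A of l: this is how repelling fixed points lead to reversed words. *)
Lemma act_rev_mat (l : list bool) (u : R) : 0 < u ->
  act (rev l) u = (IZR (md (wmat l)) * u + IZR (mb (wmat l))) / (IZR (mc (wmat l)) * u + IZR (ma (wmat l))).
Proof.
  revert u. induction l as [|b l IH]; intros u Hu; [simpl; field|].
  cbn [rev]. rewrite act_app. change (act [b] u) with (lact b u).
  rewrite IH by (apply lact_pos, Hu). rewrite wmat_cons.
  destruct (wmat_real l) as (Hb & Hc & Ha & Hd & _). set (A := wmat l) in *.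
  assert (0 <= IZR (mc A) * u) by nra.
  assert (0 < IZR (ma A) * u) by nra.
  destruct b; cbn [lmat mmul matT matV ma mb mc md lact]; rewrite !plus_IZR, !mult_IZR; field; try lra.
Qed.

Section IfWord.
Variables (f : C -> C) (tau0 : C).
Hypothesis Hholo : forall z, upper_half z -> exists l, is_cderiv f z l.
Hypothesis Hmod : forall A z, SL2Z A -> upper_half z -> f (mobC A z) = f z.
Hypothesis Hreal : forall t, PI / 3 <= t <= 2 * PI / 3 -> Im (f (circ t)) = 0 /\ 0 <= Farc f t.
Hypothesis Htau0 : upper_half tau0.

Lemma I_f_word (l : list bool) : hyperbolic (wmat l) ->
  exists u v, 0 < u /\ 0 < v /\ act l v = v /\ act (rev l) u = u /\
    Re (I_f f tau0 (wmat l)) = suffix_sum f l v + suffix_sum f (rev l) u.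
Proof.
  intros Hh.
  assert (HQ := epsilon_spec (inhabits (QForm 0 0 0)) _ (is_form_of_exists l Hh)). fold (form_of (wmat l)) in HQ.
  destruct (is_form_of_roots l Hh _ HQ) as (u & v & Hu & Hv & Eu & Ev & HK).
  destruct (hyp_word_real l Hh) as (Ha & Hb & Hc & Hd & Hdet).
  assert (Pu : 0 < IZR (mc (wmat l)) * u) by nra. assert (Pv : 0 < IZR (mc (wmat l)) * v) by nra.
  assert (Fv : act l v = v).
  { rewrite <- mobR_wmat by lra. unfold mobR.
    apply (Rmult_eq_reg_r (IZR (mc (wmat l)) * v + IZR (md (wmat l)))); [|lra]. field_simplify; lra. }
  assert (Fu : act (rev l) u = u).
  { rewrite act_rev_mat by lra.
    apply (Rmult_eq_reg_r (IZR (mc (wmat l)) * u + IZR (ma (wmat l)))); [|lra]. field_simplify; lra. }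
  exists u, v. repeat split; auto.
  rewrite <- (J_period f Hholo Hmod Hreal l u v tau0) by auto.
  f_equal. unfold I_f. destruct (excluded_middle_informative _) as [_|N]; [|contradiction].
  rewrite mobC_wmat by exact Htau0. cbv zeta. unfold J, segment_integral.
  apply (RInt_ext (V := C_R_CompleteNormedModule)). intros s Hs.
  rewrite Rmin_left, Rmax_right in Hs by lra.
  match goal with |- @eq _ ?x ?y => change (@eq C x y) end.
  f_equal. unfold ker. rewrite <- HK.
  - unfold Cdiv. ring.
  - apply upper_half_seg; [exact Htau0|apply upper_half_actC, Htau0|lra].
Qed.
End IfWord.

(** * The coboundary inequality and the contraction estimate *)

(* This is [F / (F^2 - s)] for [F = v + 1/v]; with [s = (2 cos t)^2] and a factor [sin t] it is
   the average of [poisson] at [t] and [PI - t]. *)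
Definition ratio (s v : R) : R := v * (v * v + 1) / ((v * v + 1) * (v * v + 1) - s * (v * v)).
Definition skew (v : R) : R := Rabs (v - / v).

(* The constant that makes [ratio_step] tangent at the golden ratio. *)
Definition kap (s : R) : R := (5 + s) / (5 * phi * ((5 - s) * (5 - s))).

Lemma phi_sqr : phi * phi = phi + 1.
Proof. unfold phi. assert (H : sqrt 5 * sqrt 5 = 5) by (apply sqrt_def; lra). lra. Qed.

Lemma phi_bounds : 1618 / 1000 < phi < 16181 / 10000.
Proof.
  unfold phi. assert (H : sqrt 5 * sqrt 5 = 5) by (apply sqrt_def; lra). assert (P := sqrt_pos 5).
  split; nra.
Qed.

Lemma ratio_den (s v : R) : 0 <= s <= 1 ->
  3 / 4 * ((v * v + 1) * (v * v + 1)) <= (v * v + 1) * (v * v + 1) - s * (v * v).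
Proof.
  intros Hs. assert (0 <= (v * v - 1) * (v * v - 1)) by apply Rle_0_sqr.
  assert (0 <= v * v) by apply Rle_0_sqr. nra.
Qed.

Lemma ratio_den_pos (s v : R) : 0 <= s <= 1 -> 0 < (v * v + 1) * (v * v + 1) - s * (v * v).
Proof. intros Hs. assert (H := ratio_den s v Hs). assert (0 <= v * v) by apply Rle_0_sqr. nra. Qed.

Lemma ratio_nonneg (s v : R) : 0 <= s <= 1 -> 0 < v -> 0 <= ratio s v.
Proof.
  intros Hs Hv. apply Rmult_le_pos; [nra|]. left. apply Rinv_0_lt_compat, ratio_den_pos, Hs.
Qed.

Lemma ratio_le_lin (s v : R) : 0 <= s <= 1 -> 0 < v -> ratio s v <= 2 * v.
Proof.
  intros Hs Hv. assert (D := ratio_den s v Hs). assert (D' := ratio_den_pos s v Hs).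
  unfold ratio. apply (Rmult_le_reg_r ((v * v + 1) * (v * v + 1) - s * (v * v))); [exact D'|].
  unfold Rdiv. rewrite Rmult_assoc, Rinv_l by lra.
  assert (v * v + 1 <= 2 * ((v * v + 1) * (v * v + 1) - s * (v * v))) by nra. nra.
Qed.

Lemma ratio_inv (s v : R) : 0 <= s <= 1 -> 0 < v -> ratio s (/ v) = ratio s v.
Proof.
  intros Hs Hv. assert (D := ratio_den_pos s v Hs). unfold ratio. field.
  repeat split; try lra.
Qed.

Lemma skew_inv (v : R) : 0 < v -> skew (/ v) = skew v.
Proof. intros Hv. unfold skew. rewrite Rinv_inv, <- Rabs_Ropp. f_equal. ring. Qed.

(** [phi + / phi = 2 * phi - 1] is the square root of 5. *)
Lemma ratio_phi (s : R) : 0 <= s <= 1 -> ratio s phi = (2 * phi - 1) / (5 - s).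
Proof.
  intros Hs. assert (Hp := phi_sqr). assert (B := phi_bounds).
  unfold ratio. rewrite Hp.
  replace ((phi + 1 + 1) * (phi + 1 + 1) - s * (phi + 1)) with ((phi + 1) * (5 - s)).
  2:{ replace ((phi + 1 + 1) * (phi + 1 + 1)) with (phi * phi + 4 * phi + 4) by ring. rewrite Hp. ring. }
  replace (phi * (phi + 1 + 1)) with ((phi + 1) * (2 * phi - 1)).
  2:{ replace ((phi + 1) * (2 * phi - 1)) with (2 * (phi * phi) + phi - 1) by ring.
      replace (phi * (phi + 1 + 1)) with (phi * phi + 2 * phi) by ring. lra. }
  field. lra.
Qed.

Lemma kap_nonneg (s : R) : 0 <= s <= 1 -> 0 <= kap s.
Proof.
  intros Hs. assert (B := phi_bounds). apply Rmult_le_pos; [lra|]. left. apply Rinv_0_lt_compat.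
  apply Rmult_lt_0_compat; nra.
Qed.

(** Equality holds at [x = / phi], where [x + 1 = phi] and both values of [skew] are 1. As [x] tends
    to 0 the left side exceeds [ratio s phi], but [skew x] grows without bound. The cases follow the
    absolute value in [skew x]. *)
Lemma ratio_step (s x : R) : 0 <= s <= 1 -> 0 < x ->
  ratio s (x + 1) <= ratio s phi - kap s * (skew (x + 1) - skew x).
Proof.
  intros Hs Hx. rewrite ratio_phi by exact Hs.
  assert (Hp := phi_sqr). assert (B := phi_bounds). assert (K := kap_nonneg s Hs).
  assert (D := ratio_den_pos s (x + 1) Hs).
  assert (I1 : / (x + 1) < 1) by (rewrite <- Rinv_1; apply Rinv_lt_contravar; lra).
  unfold skew at 1. rewrite (Rabs_pos_eq (x + 1 - / (x + 1))) by lra.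
  destruct (Rle_lt_dec 1 x) as [H1|H1].
  - assert (I2 : / x <= 1) by (rewrite <- Rinv_1; apply Rinv_le_contravar; lra).
    unfold skew. rewrite Rabs_pos_eq by lra.
    (* For [x >= 1] both terms are largest at [x = 1]: [3 / 2] is [skew 2 - skew 1] and
       [10 / (25 - 4 * s)] is [ratio s 2]. *)
    assert (Hd : x + 1 - / (x + 1) - (x - / x) <= 3 / 2).
    { replace (x + 1 - / (x + 1) - (x - / x)) with (1 + / (x * (x + 1))) by (field; lra).
      assert (/ (x * (x + 1)) <= / 2) by (apply Rinv_le_contravar; nra). lra. }
    assert (Hr : ratio s (x + 1) <= 10 / (25 - 4 * s)).
    { unfold ratio. apply Rle_div_l; [exact D|].
      replace (10 / (25 - 4 * s) * _) with (10 * (((x + 1) * (x + 1) + 1) * ((x + 1) * (x + 1) + 1) - s * ((x + 1) * (x + 1))) / (25 - 4 * s)) by (field; lra).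
      apply -> Rle_div_r; [|lra].
      set (y := x + 1) in *.
      assert (0 <= (2 * y - 1) * (y - 2) * (5 * (y * y + 1) + 2 * s * y)).
      { apply Rmult_le_pos; [apply Rmult_le_pos; unfold y; lra|]. unfold y; nra. }
      lra. }
    assert (Hk : kap s * (x + 1 - / (x + 1) - (x - / x)) <= kap s * (3 / 2)) by (apply Rmult_le_compat_l; lra).
    assert (Hm : 10 / (25 - 4 * s) + kap s * (3 / 2) <= (2 * phi - 1) / (5 - s)).
    { assert (E : (2 * phi - 1) / (5 - s) - (10 / (25 - 4 * s) + kap s * (3 / 2)) =
        ((2 * phi - 1) * phi * (5 - s) * (25 - 4 * s) * 10 - 100 * phi * ((5 - s) * (5 - s)) - 3 * ((5 + s) * (25 - 4 * s))) / (10 * phi * ((5 - s) * (5 - s)) * (25 - 4 * s))).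
      { unfold kap. field. lra. }
      assert (0 <= (2 * phi - 1) / (5 - s) - (10 / (25 - 4 * s) + kap s * (3 / 2))); [|lra].
      rewrite E. apply Rmult_le_pos.
      (* After this reduction the numerator is linear in [phi] and quadratic in [s], so the rational
         bounds on [phi], multiplied by [s] and [s * s], settle it. *)
      - replace ((2 * phi - 1) * phi) with (phi + 2) by lra.
        assert (S2 : 0 <= s * s <= s) by nra.
        assert (Q1 := Rmult_le_pos (phi - 1618 / 1000) s ltac:(lra) (proj1 Hs)).
        assert (Q2 := Rmult_le_pos (16181 / 10000 - phi) s ltac:(lra) (proj1 Hs)).
        assert (Q3 := Rmult_le_pos (phi - 1618 / 1000) (s * s) ltac:(lra) (proj1 S2)).
        assert (Q4 := Rmult_le_pos (16181 / 10000 - phi) (s * s) ltac:(lra) (proj1 S2)).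
        lra.
      - assert (0 < (5 - s) * (5 - s)) by (apply Rmult_lt_0_compat; lra).
        assert (0 < 10 * phi * ((5 - s) * (5 - s))) by (apply Rmult_lt_0_compat; lra).
        left. apply Rinv_0_lt_compat, Rmult_lt_0_compat; lra. }
    lra.
  - assert (I2 : 1 < / x) by (rewrite <- Rinv_1; apply Rinv_lt_contravar; lra).
    unfold skew. rewrite (Rabs_left1 (x - / x)) by lra.
    (* For [y = x + 1] the difference has numerator [(y - phi)^2] times a polynomial that is
       positive on [0 < x < 1]; its coefficients are reduced by [phi^2 = phi + 1]. *)
    set (N := (x + 1 - phi) * (x + 1 - phi) *
      (((20 + 20 * phi) + (-1 - phi) * s + (-1 - phi) * (s * s))
      + ((150 + 40 * phi) + (-40 + 13 * phi) * s - 7 * phi * (s * s)) * x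
      + ((210 + 40 * phi) + (-73 + 13 * phi) * s + (3 - 11 * phi) * (s * s)) * (x * x)
      + ((115 + 20 * phi) + (-47 - 11 * phi) * s + (2 - 5 * phi) * (s * s)) * (x * x * x)
      + ((15 + 5 * phi) + (-17 - 9 * phi) * s) * (x * x * x * x)
      + (-10 - 2 * s) * (x * x * x * x * x))).
    assert (E : (2 * phi - 1) / (5 - s) - kap s * (x + 1 - / (x + 1) - - (x - / x)) - ratio s (x + 1) =
       N / (5 * phi * ((5 - s) * (5 - s)) * ((x + 1) * x) * (((x + 1) * (x + 1) + 1) * ((x + 1) * (x + 1) + 1) - s * ((x + 1) * (x + 1))))).
    { transitivity ((5 * phi * (5 - s) * ((x + 1) * x) * ((2 * phi - 1) * (((x + 1) * (x + 1) + 1) * ((x + 1) * (x + 1) + 1) - s * ((x + 1) * (x + 1))) - (5 - s) * ((x + 1) * ((x + 1) * (x + 1) + 1))) - (5 + s) * ((2 * x + 1) * (x * x + x - 1)) * (((x + 1) * (x + 1) + 1) * ((x + 1) * (x + 1) + 1) - s * ((x + 1) * (x + 1)))) / (5 * phi * ((5 - s) * (5 - s)) * ((x + 1) * x) * (((x + 1) * (x + 1) + 1) * ((x + 1) * (x + 1) + 1) - s * ((x + 1) * (x + 1))))).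
      - unfold kap, ratio. field. lra.
      - f_equal. unfold N. ring [Hp]. }
    assert (HN : 0 <= N).
    { apply Rmult_le_pos; [apply Rle_0_sqr|].
      assert (S2 : 0 <= s * s <= s) by nra.
      assert (X1 : 0 <= x <= 1) by lra.
      assert (X2 : 0 <= x * x <= 1) by nra.
      assert (X3 : 0 <= x * x * x <= 1) by nra.
      assert (X4 : 0 <= x * x * x * x <= 1) by nra.
      assert (X5 : 0 <= x * x * x * x * x <= 1) by nra.
      assert (S1p : 0 <= phi * s <= 17 / 10) by nra.
      assert (S2p : 0 <= phi * (s * s) <= 17 / 10) by nra.
      (* Only the coefficients of the fourth and fifth powers of [x] can be negative, at worst -10
         and -12; the constant term absorbs them. *)
      assert (C0 : 46 <= (20 + 20 * phi) + (-1 - phi) * s + (-1 - phi) * (s * s)) by lra.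
      assert (C1 : 0 <= (150 + 40 * phi) + (-40 + 13 * phi) * s - 7 * phi * (s * s)) by lra.
      assert (C2 : 0 <= (210 + 40 * phi) + (-73 + 13 * phi) * s + (3 - 11 * phi) * (s * s)) by lra.
      assert (C3 : 0 <= (115 + 20 * phi) + (-47 - 11 * phi) * s + (2 - 5 * phi) * (s * s)) by lra.
      assert (C4 : -10 <= (15 + 5 * phi) + (-17 - 9 * phi) * s) by lra.
      assert (C5 : -12 <= -10 - 2 * s) by lra.
      assert (Y1 := Rmult_le_pos _ _ C1 (proj1 X1)).
      assert (Y2 := Rmult_le_pos _ _ C2 (proj1 X2)).
      assert (Y3 := Rmult_le_pos _ _ C3 (proj1 X3)).
      assert (Y4 := Rmult_le_compat_r _ _ _ (proj1 X4) C4).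
      assert (Y5 := Rmult_le_compat_r _ _ _ (proj1 X5) C5).
      lra. }
    assert (0 <= N / (5 * phi * ((5 - s) * (5 - s)) * ((x + 1) * x) * (((x + 1) * (x + 1) + 1) * ((x + 1) * (x + 1) + 1) - s * ((x + 1) * (x + 1))))).
    { assert (0 < (5 - s) * (5 - s)) by (apply Rmult_lt_0_compat; lra).
      assert (0 < 5 * phi * ((5 - s) * (5 - s))) by (apply Rmult_lt_0_compat; lra).
      assert (0 < (x + 1) * x) by (apply Rmult_lt_0_compat; lra).
      apply Rmult_le_pos; [exact HN|]. left.
      apply Rinv_0_lt_compat, Rmult_lt_0_compat; [apply Rmult_lt_0_compat; assumption|exact D]. }
    lra.
Qed.

Lemma lact_false_inv (v : R) : 0 < v -> lact false v = / (/ v + 1).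
Proof. intros Hv. simpl. field. lra. Qed.

(** Inversion exchanges T and V and preserves [ratio] and [skew], so V at [v] is T at [/ v]. *)
Lemma ratio_lact (s v : R) (b : bool) : 0 <= s <= 1 -> 0 < v ->
  ratio s (lact b v) <= ratio s phi - kap s * (skew (lact b v) - skew v).
Proof.
  intros Hs Hv. destruct b; [apply ratio_step; auto|].
  assert (Hi := Rinv_0_lt_compat v Hv).
  rewrite lact_false_inv, ratio_inv, skew_inv by lra. rewrite <- (skew_inv v) by lra.
  apply ratio_step; auto.
Qed.

(** The hypothesis bounds the chordal distance on the projective line by [/ r]; the Euclidean
    distance would be useless here, since T preserves it. The proof gives the Lipschitz constant
    (5/4)/(9/16) = 20/9, rounded up to 3. *)
Lemma ratio_osc (s v v' r : R) : 0 <= s <= 1 -> 0 < v -> 0 < v' -> 0 < r ->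
  r * r * ((v - v') * (v - v')) <= (1 + v * v) * (1 + v' * v') ->
  ratio s v <= ratio s v' + 3 / r.
Proof.
  intros Hs Hv Hv' Hr H.
  assert (D := ratio_den s v Hs). assert (D' := ratio_den s v' Hs).
  assert (P := ratio_den_pos s v Hs). assert (P' := ratio_den_pos s v' Hs).
  set (q := v * v + 1) in *. set (q' := v' * v' + 1) in *.
  assert (Q1 : 1 <= q) by (unfold q; nra). assert (Q1' : 1 <= q') by (unfold q'; nra).
  assert (E : ratio s v - ratio s v' = ((v - v') * (1 - v * v')) * (q * q' + s * (v * v')) / ((q * q - s * (v * v)) * (q' * q' - s * (v' * v')))).
  { unfold ratio. fold q q'. unfold Rdiv.
    replace ((v - v') * (1 - v * v')) with (v * q' - v' * q) by (unfold q, q'; ring). field. lra. }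
  set (X := (v - v') * (1 - v * v')) in *.
  assert (HX : r * X <= q * q').
  { assert (H1 : (1 - v * v') * (1 - v * v') <= q * q').
    { unfold q, q'. assert (0 <= (v + v') * (v + v')) by apply Rle_0_sqr. lra. }
    assert (H2 : (r * X) * (r * X) <= (q * q') * (q * q')).
    { replace ((r * X) * (r * X)) with ((r * r * ((v - v') * (v - v'))) * ((1 - v * v') * (1 - v * v'))) by (unfold X; ring).
      apply Rmult_le_compat; try lra.
      - apply Rmult_le_pos; [nra|apply Rle_0_sqr].
      - apply Rle_0_sqr.
      - unfold q, q'. lra. }
    destruct (Rle_lt_dec (r * X) (q * q')); [assumption|exfalso].
    assert (0 < q * q') by nra. nra. }
  assert (HV : q * q' + s * (v * v') <= 5 / 4 * (q * q')).
  { assert (S1 := Rle_0_sqr (v - 1)). assert (S2 := Rle_0_sqr (v' - 1)). unfold Rsqr in S1, S2.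
    assert (S3 : (2 * v) * (2 * v') <= q * q') by (apply Rmult_le_compat; unfold q, q'; lra).
    assert (S4 : 0 <= v * v') by (apply Rmult_le_pos; lra).
    assert (S5 := Rmult_le_compat_r _ _ _ S4 (proj2 Hs)). lra. }
  assert (HV0 : 0 <= q * q' + s * (v * v')) by (assert (0 <= v * v') by nra; nra).
  cut (ratio s v - ratio s v' <= 3 / r); [lra|]. rewrite E.
  assert (Pd : 0 < (q * q - s * (v * v)) * (q' * q' - s * (v' * v'))) by (apply Rmult_lt_0_compat; assumption).
  apply Rle_div_l; [exact Pd|].
  apply (Rmult_le_reg_l r); [exact Hr|].
  replace (r * (3 / r * ((q * q - s * (v * v)) * (q' * q' - s * (v' * v'))))) with (3 * ((q * q - s * (v * v)) * (q' * q' - s * (v' * v')))) by (field; lra).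
  assert (Hd : 9 / 16 * ((q * q') * (q * q')) <= (q * q - s * (v * v)) * (q' * q' - s * (v' * v'))).
  { replace (9 / 16 * ((q * q') * (q * q'))) with ((3 / 4 * (q * q)) * (3 / 4 * (q' * q'))) by field.
    apply Rmult_le_compat; nra. }
  assert (Hn : (r * X) * (q * q' + s * (v * v')) <= (q * q') * (5 / 4 * (q * q'))).
  { apply Rle_trans with ((q * q') * (q * q' + s * (v * v'))).
    - apply Rmult_le_compat_r; assumption.
    - apply Rmult_le_compat_l; [nra|assumption]. }
  assert (0 <= (q * q') * (q * q')) by apply Rle_0_sqr.
  lra.
Qed.

(* For the matrix (a b; c d) of a word, (a^2 + c^2)(b^2 + d^2) = 1 + (ab + cd)^2, and ab + cd grows at each letter. *)
Lemma wmat_length (l : list bool) :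
  INR (length l) <= IZR (ma (wmat l)) * IZR (mb (wmat l)) + IZR (mc (wmat l)) * IZR (md (wmat l)).
Proof.
  induction l as [|b l IH]; [simpl; lra|].
  destruct (wmat_real l) as (Hb & Hc & Ha & Hd & _). rewrite wmat_cons. set (A := wmat l) in *.
  change (length (b :: l)) with (S (length l)). rewrite S_INR.
  assert (0 <= IZR (mb A) * IZR (mc A)) by nra.
  assert (1 <= IZR (ma A) * IZR (md A)) by nra.
  assert (0 <= IZR (md A) * IZR (mc A)) by nra.
  assert (0 <= IZR (ma A) * IZR (mb A)) by nra.
  destruct b; cbn [lmat mmul matT matV ma mb mc md]; rewrite !plus_IZR, !mult_IZR; lra.
Qed.

(** Clearing denominators leaves r^2 (z - z')^2 against the product of the squared lengths of the
    matrix applied to (z, 1) and (z', 1). Each squared length dominates [al * (y * y)] and [be], the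
    squared column lengths, and [al * be] is at least r^2 by [wmat_length]. *)
Lemma act_contract (l : list bool) (z z' : R) : 0 < z -> 0 < z' ->
  let r := INR (length l) in let v := act l z in let v' := act l z' in
  r * r * ((v - v') * (v - v')) <= (1 + v * v) * (1 + v' * v').
Proof.
  intros Hz Hz' r v v'. unfold v, v'. rewrite <- !mobR_wmat by lra.
  destruct (wmat_real l) as (Hb & Hc & Ha & Hd & Hdet). assert (Hl := wmat_length l). fold r in Hl.
  assert (Hr : 0 <= r) by apply pos_INR.
  unfold mobR. set (A := wmat l) in *.
  set (a := IZR (ma A)) in *. set (b := IZR (mb A)) in *. set (c := IZR (mc A)) in *. set (d := IZR (md A)) in *.
  assert (Hcz : 0 <= c * z) by nra. assert (Hcz' : 0 <= c * z') by nra.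
  assert (Haz : 0 <= a * z) by nra. assert (Haz' : 0 <= a * z') by nra.
  set (p := a * z + b). set (q := c * z + d). set (p' := a * z' + b). set (q' := c * z' + d).
  assert (Hq : 0 < q) by (unfold q; lra). assert (Hq' : 0 < q') by (unfold q'; lra).
  assert (E : p / q - p' / q' = (z - z') / (q * q')).
  { replace (z - z') with ((a * d - b * c) * (z - z')) by (rewrite Hdet; ring).
    unfold p, p'. unfold Rdiv. field_simplify; [|lra|lra]. unfold q, q'. f_equal. ring. }
  rewrite E.
  replace (r * r * ((z - z') / (q * q') * ((z - z') / (q * q')))) with ((r * r * ((z - z') * (z - z'))) * / ((q * q) * (q' * q'))) by (field; lra).
  replace ((1 + p / q * (p / q)) * (1 + p' / q' * (p' / q'))) with (((p * p + q * q) * (p' * p' + q' * q')) * / ((q * q) * (q' * q'))) by (field; lra).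
  apply Rmult_le_compat_r; [left; apply Rinv_0_lt_compat; repeat apply Rmult_lt_0_compat; assumption|].
  set (al := a * a + c * c). set (be := b * b + d * d).
  assert (Hab : r * r <= al * be).
  { replace (al * be) with ((a * d - b * c) * (a * d - b * c) + (a * b + c * d) * (a * b + c * d)) by (unfold al, be; ring).
    rewrite Hdet. nra. }
  assert (Q : forall y, 0 < y -> al * (y * y) <= (a * y + b) * (a * y + b) + (c * y + d) * (c * y + d) /\
      be <= (a * y + b) * (a * y + b) + (c * y + d) * (c * y + d)).
  { intros y Hy. assert (0 <= a * b * y) by (apply Rmult_le_pos; nra). assert (0 <= c * d * y) by (apply Rmult_le_pos; nra).
    assert (0 <= (a * y) * (a * y)) by apply Rle_0_sqr. assert (0 <= (c * y) * (c * y)) by apply Rle_0_sqr.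
    unfold al, be. split; nra. }
  destruct (Q z Hz) as [Q1 Q2]. destruct (Q z' Hz') as [Q1' Q2'].
  fold p q in Q1, Q2. fold p' q' in Q1', Q2'.
  assert (Pal : 0 <= al) by (unfold al; nra). assert (Pbe : 0 <= be) by (unfold be; nra).
  assert (Pr : 0 <= r * r) by nra.
  (* [(z - z')^2] is at most the square of the larger point; that point supplies [al] and the other
     one [be]. *)
  destruct (Rle_lt_dec z' z) as [L|L].
  - apply Rle_trans with ((al * (z * z)) * be).
    + replace (al * (z * z) * be) with ((al * be) * (z * z)) by ring. apply Rmult_le_compat; nra.
    + apply Rmult_le_compat; try assumption. apply Rmult_le_pos; nra.
  - apply Rle_trans with (be * (al * (z' * z'))).
    + replace (be * (al * (z' * z'))) with ((al * be) * (z' * z')) by ring. apply Rmult_le_compat; nra.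
    + apply Rmult_le_compat; try assumption. apply Rmult_le_pos; nra.
Qed.

Lemma arc_cos (t : R) : PI / 3 <= t <= 2 * PI / 3 -> 0 <= 4 * (cos t * cos t) <= 1.
Proof.
  intros Ht. assert (P := PI_RGT_0).
  assert (cos (2 * PI / 3) <= cos t) by (apply cos_decr_1; lra).
  assert (cos t <= cos (PI / 3)) by (apply cos_decr_1; lra).
  rewrite cos_2PI3', cos_PI3 in *. nra.
Qed.

(** * Estimates for the arc integral [G] and its sums along words *)

Section GBounds.
Variable f : C -> C.
Hypothesis Hholo : forall z, upper_half z -> exists l, is_cderiv f z l.
Hypothesis Hmod : forall A z, SL2Z A -> upper_half z -> f (mobC A z) = f z.
Hypothesis Hreal : forall t, PI / 3 <= t <= 2 * PI / 3 -> Im (f (circ t)) = 0 /\ 0 <= Farc f t.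

Lemma poisson_avg (t v : R) : PI / 3 <= t <= 2 * PI / 3 -> 0 < v ->
  (poisson t v + poisson (PI - t) v) / 2 = sin t * ratio (4 * (cos t * cos t)) v.
Proof.
  intros Ht Hv.
  assert (D := poisson_den t v (arc_sin_pos t Ht) Hv).
  assert (D' := poisson_den (PI - t) v (arc_sin_pos (PI - t) (arc_reflect t Ht)) Hv).
  unfold poisson, ratio. rewrite sin_PI_x. replace (PI - t) with (- t + PI) in * by ring. rewrite neg_cos, cos_neg in *.
  assert (Q := ratio_den_pos _ v (arc_cos t Ht)). field. repeat split; lra.
Qed.

Lemma Farc_mult_continuous (w : R -> R) (t : R) : PI / 3 <= t <= 2 * PI / 3 ->
  continuous w t -> continuous (fun t => Farc f t * (sin t * w t)) t.
Proof.
  intros Ht Hw. assert (P := PI_RGT_0).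
  apply (continuous_mult (K := R_AbsRing)); [apply Farc_continuous; auto; lra|].
  apply (continuous_mult (K := R_AbsRing)); [|exact Hw].
  apply (ex_derive_continuous (V := R_NormedModule)). auto_derive; trivial.
Qed.

Lemma ratio_continuous (v t : R) : PI / 3 <= t <= 2 * PI / 3 -> continuous (fun t => ratio (4 * (cos t * cos t)) v) t.
Proof.
  intros Ht. apply (ex_derive_continuous (V := R_NormedModule)). unfold ratio. auto_derive.
  apply Rgt_not_eq. exact (ratio_den_pos _ v (arc_cos t Ht)).
Qed.

Lemma kap_continuous (t : R) : PI / 3 <= t <= 2 * PI / 3 -> continuous (fun t => kap (4 * (cos t * cos t))) t.
Proof.
  intros Ht. apply (ex_derive_continuous (V := R_NormedModule)). unfold kap.
  assert (A := arc_cos t Ht). assert (B := phi_bounds). auto_derive.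
  apply Rgt_not_eq. apply Rmult_lt_0_compat; [lra|]. apply Rmult_lt_0_compat; lra.
Qed.

Definition arc_weight (w : R -> R) : R := RInt (fun t => Farc f t * (sin t * w t)) (PI / 3) (2 * PI / 3).

(** Averaging the integral with its reflection [G_reflect] turns the Poisson kernel into one
    invariant under inversion of [v]. *)
Lemma G_ratio (v : R) : 0 < v -> G f v = arc_weight (fun t => ratio (4 * (cos t * cos t)) v).
Proof.
  intros Hv. assert (P := PI_RGT_0). unfold arc_weight.
  assert (K1 : ex_RInt (fun t => Farc f t * poisson (PI - t) v) (PI / 3) (2 * PI / 3)).
  { apply ex_RInt_arc. intros t Ht. apply Farc_poisson_continuous; auto. }
  assert (K2 : ex_RInt (fun t => Farc f t * poisson t v) (PI / 3) (2 * PI / 3)).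
  { apply ex_RInt_arc. intros t Ht. apply Farc_poisson_continuous; auto. }
  assert (C1 := RInt_correct (V := R_CompleteNormedModule) _ _ _ K1).
  assert (C2 := RInt_correct (V := R_CompleteNormedModule) _ _ _ K2).
  rewrite (G_reflect f Hholo Hmod v Hv) in C1. fold (G f v) in C2.
  assert (C3 := is_RInt_scal (V := R_NormedModule) _ _ _ (1 / 2) _ (is_RInt_plus (V := R_NormedModule) _ _ _ _ _ _ C2 C1)).
  assert (C4 : is_RInt (fun t => 1 / 2 * (Farc f t * poisson t v + Farc f t * poisson (PI - t) v))
    (PI / 3) (2 * PI / 3) (1 / 2 * (G f v + G f v))) by exact C3.
  replace (1 / 2 * (G f v + G f v)) with (G f v) in C4 by field.
  symmetry. apply (is_RInt_unique (V := R_CompleteNormedModule)).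
  refine (is_RInt_ext _ _ _ _ _ _ C4). intros t Ht. rewrite Rmin_left, Rmax_right in Ht by lra.
  match goal with |- @eq _ ?x ?y => change (@eq R x y) end.
  rewrite <- poisson_avg by lra. field.
Qed.

(** Carries kernel inequalities over to [G], since the weight [Farc f t * sin t] is non-negative.
    The bounds [ratio_le_lin], [ratio_osc] and [ratio_lact] all pass through it; [e] may have either
    sign. *)
Lemma G_le (w : R -> R) (A e v v' : R) : 0 < v -> 0 < v' ->
  (forall t, PI / 3 <= t <= 2 * PI / 3 -> continuous w t) ->
  (forall t, PI / 3 <= t <= 2 * PI / 3 ->
     let s := 4 * (cos t * cos t) in ratio s v <= A * ratio s v' + e * w t) ->
  G f v <= A * G f v' + e * arc_weight w.
Proof.
  intros Hv Hv' Hw H. assert (P := PI_RGT_0).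
  assert (Ex : forall y, (forall t, PI / 3 <= t <= 2 * PI / 3 -> continuous y t) ->
     is_RInt (fun t => Farc f t * (sin t * y t)) (PI / 3) (2 * PI / 3) (arc_weight y)).
  { intros y Hy. apply (RInt_correct (V := R_CompleteNormedModule)). apply ex_RInt_arc.
    intros t Ht. apply Farc_mult_continuous; auto. }
  rewrite !G_ratio by assumption.
  assert (I1 := Ex _ (ratio_continuous v)). assert (I2 := Ex _ (ratio_continuous v')). assert (I3 := Ex _ Hw).
  assert (I4 := is_RInt_plus (V := R_NormedModule) _ _ _ _ _ _ (is_RInt_scal (V := R_NormedModule) _ _ _ A _ I2) (is_RInt_scal (V := R_NormedModule) _ _ _ e _ I3)).
  refine (is_RInt_le _ _ _ _ _ _ _ I1 I4 _); [lra|].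
  intros t Ht. assert (Ht' : PI / 3 <= t <= 2 * PI / 3) by lra.
  destruct (Hreal t Ht') as [_ HF]. assert (S := arc_sin_pos t Ht'). specialize (H t Ht'). cbv zeta in H.
  unfold scal, plus; simpl; unfold mult; simpl.
  replace (A * (Farc f t * (sin t * ratio (4 * (cos t * cos t)) v')) + e * (Farc f t * (sin t * w t))) with
    (Farc f t * (sin t * (A * ratio (4 * (cos t * cos t)) v' + e * w t))) by ring.
  apply Rmult_le_compat_l; [exact HF|]. apply Rmult_le_compat_l; lra.
Qed.

Lemma arc_weight_nonneg (w : R -> R) :
  (forall t, PI / 3 <= t <= 2 * PI / 3 -> continuous w t) ->
  (forall t, PI / 3 <= t <= 2 * PI / 3 -> 0 <= w t) -> 0 <= arc_weight w.
Proof.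
  intros Hc Hw. assert (P := PI_RGT_0). apply RInt_ge_0; [lra| |].
  - apply ex_RInt_arc. intros t Ht. apply Farc_mult_continuous; auto.
  - intros t Ht. assert (Ht' : PI / 3 <= t <= 2 * PI / 3) by lra.
    destruct (Hreal t Ht') as [_ HF]. assert (S := arc_sin_pos t Ht'). specialize (Hw t Ht').
    apply Rmult_le_pos; [exact HF|]. apply Rmult_le_pos; lra.
Qed.

(** The 3 comes from [ratio_osc] and also covers the 2 of [ratio_le_lin]. *)
Definition Cf : R := 3 * arc_weight (fun _ => 1).

Lemma Cf_nonneg : 0 <= Cf.
Proof.
  apply Rmult_le_pos; [lra|]. apply arc_weight_nonneg; intros t Ht; [apply continuous_const|lra].
Qed.

Lemma G_nonneg (v : R) : 0 < v -> 0 <= G f v.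
Proof.
  intros Hv. rewrite G_ratio by exact Hv. apply arc_weight_nonneg; [apply ratio_continuous|].
  intros t Ht. apply ratio_nonneg; [apply arc_cos, Ht|exact Hv].
Qed.

Lemma G_le_lin (v : R) : 0 < v -> G f v <= Cf * v.
Proof.
  intros Hv.
  replace (Cf * v) with (0 * G f v + (3 * v) * arc_weight (fun _ => 1)) by (unfold Cf; ring).
  apply G_le; auto; [intros; apply continuous_const|].
  intros t Ht s. assert (Q := ratio_le_lin s v (arc_cos t Ht) Hv). lra.
Qed.

Lemma G_act_osc (l : list bool) (z z' : R) : 0 < z -> 0 < z' -> (1 <= length l)%nat ->
  G f (act l z) <= G f (act l z') + Cf / INR (length l).
Proof.
  intros Hz Hz' Hl. assert (Hr : 0 < INR (length l)) by (apply lt_0_INR; lia).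
  replace (G f (act l z') + Cf / INR (length l)) with (1 * G f (act l z') + (3 / INR (length l)) * arc_weight (fun _ => 1))
    by (unfold Cf; field; lra).
  apply G_le; auto using act_pos; [intros; apply continuous_const|].
  intros t Ht s.
  assert (Q := ratio_osc s (act l z) (act l z') _ (arc_cos t Ht) (act_pos l z Hz) (act_pos l z' Hz') Hr (act_contract l z z' Hz Hz')).
  lra.
Qed.

Lemma phi_pos : 0 < phi.
Proof. assert (B := phi_bounds). lra. Qed.

Lemma G_lact (b : bool) (v : R) : 0 < v ->
  G f (lact b v) <= G f phi - arc_weight (fun t => kap (4 * (cos t * cos t))) * (skew (lact b v) - skew v).
Proof.
  intros Hv.
  replace (G f phi - _) with (1 * G f phi + (- (skew (lact b v) - skew v)) * arc_weight (fun t => kap (4 * (cos t * cos t)))) by ring.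
  apply G_le; auto using lact_pos, phi_pos, kap_continuous.
  intros t Ht s. assert (Q := ratio_lact s v b (arc_cos t Ht) Hv). fold s. lra.
Qed.

Lemma G_inv (v : R) : 0 < v -> G f (/ v) = G f v.
Proof.
  intros Hv. rewrite !G_ratio by (auto using Rinv_0_lt_compat). unfold arc_weight. assert (P := PI_RGT_0).
  apply RInt_ext. intros t Ht. rewrite Rmin_left, Rmax_right in Ht by lra.
  rewrite ratio_inv; [reflexivity|apply arc_cos; lra|exact Hv].
Qed.

Lemma suffix_sum_nonneg (l : list bool) (z : R) : 0 < z -> 0 <= suffix_sum f l z.
Proof.
  intros Hz. induction l as [|b l IH]; cbn [suffix_sum]; [lra|].
  assert (Q := G_nonneg _ (act_pos (b :: l) z Hz)). lra.
Qed.

(** The [skew] differences of [G_lact] telescope along the suffixes. *)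
Lemma suffix_sum_le (l : list bool) (z : R) : 0 < z ->
  suffix_sum f l z <= INR (length l) * G f phi - arc_weight (fun t => kap (4 * (cos t * cos t))) * (skew (act l z) - skew z).
Proof.
  intros Hz. induction l as [|b l IH]; [simpl; lra|].
  cbn [suffix_sum]. change (act (b :: l) z) with (lact b (act l z)).
  change (length (b :: l)) with (S (length l)). rewrite S_INR.
  assert (Q := G_lact b (act l z) (act_pos l z Hz)). lra.
Qed.

(** Summed, it bounds the harmonic sum by a square root; any sublinear bound would serve. *)
Lemma sqrt_step (n : nat) : / INR (S n) <= 2 * (sqrt (INR (S n)) - sqrt (INR n)).
Proof.
  assert (H0 := pos_INR n). rewrite S_INR. set (x := INR n) in *.
  assert (A1 := sqrt_def x H0). assert (A2 := sqrt_def (x + 1) ltac:(lra)).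
  assert (B1 := sqrt_pos x). assert (B2 : 1 <= sqrt (x + 1)) by (rewrite <- sqrt_1 at 1; apply sqrt_le_1; lra).
  assert (B3 : sqrt x <= sqrt (x + 1)) by (apply sqrt_le_1; lra).
  set (a := sqrt x) in *. set (b := sqrt (x + 1)) in *.
  apply (Rmult_le_reg_l (x + 1)); [lra|]. rewrite Rinv_r by lra.
  rewrite <- A2.
  assert ((b - a) * (b + a) = 1) by lra.
  assert (1 <= (b - a) * (2 * b)) by nra.
  nra.
Qed.

(** A suffix of length r forgets its argument up to [Cf / r], and the suffixes have lengths from 1
    to [length l]. *)
Lemma suffix_sum_osc (l : list bool) (z z' : R) : 0 < z -> 0 < z' ->
  suffix_sum f l z <= suffix_sum f l z' + 2 * Cf * sqrt (INR (length l)).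
Proof.
  intros Hz Hz'. induction l as [|b l IH]; [simpl; rewrite sqrt_0; lra|].
  cbn [suffix_sum].
  assert (Q := G_act_osc (b :: l) z z' Hz Hz' ltac:(simpl; lia)).
  change (length (b :: l)) with (S (length l)) in *.
  assert (S1 := sqrt_step (length l)). assert (S2 := Rmult_le_compat_l _ _ _ Cf_nonneg S1).
  unfold Rdiv in Q. lra.
Qed.

Lemma act_V (j : nat) : act (repeat false j) 1 = / INR (S j).
Proof.
  induction j as [|j IH]; [simpl; field|].
  cbn [repeat]. change (act (false :: repeat false j) 1) with (lact false (act (repeat false j) 1)).
  rewrite IH. rewrite (S_INR (S j)). assert (H := lt_0_INR (S j) ltac:(lia)).
  rewrite lact_false_inv by (apply Rinv_0_lt_compat, H). rewrite Rinv_inv. reflexivity.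
Qed.

(** [G v] is at most linear in [v], and a run of V sends 1 to reciprocals of integers, so the sum is
    harmonic. *)
Lemma suffix_sum_V (j : nat) : suffix_sum f (repeat false j) 1 <= 2 * Cf * sqrt (INR j).
Proof.
  induction j as [|j IH]; [simpl; rewrite sqrt_0; lra|].
  cbn [repeat suffix_sum].
  assert (Q := G_le_lin _ (act_pos (false :: repeat false j) 1 Rlt_0_1)).
  change (false :: repeat false j) with (repeat false (S j)) in *. rewrite act_V in Q.
  rewrite act_V.
  assert (H := lt_0_INR (S j) ltac:(lia)).
  assert (S0 : / INR (S (S j)) <= / INR (S j)).
  { apply Rinv_le_contravar; [exact H|]. rewrite (S_INR (S j)). lra. }
  assert (S1 := sqrt_step j). assert (S2 := Rmult_le_compat_l _ _ _ Cf_nonneg S1).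
  assert (S3 := Rmult_le_compat_l _ _ _ Cf_nonneg S0). lra.
Qed.
End GBounds.

(** * Farey paths *)

Definition prefix (w : nat -> bool) (n : nat) : list bool := map w (seq 0 n).

Lemma pre_S (w : nat -> bool) (n : nat) : prefix w (S n) = prefix w n ++ [w n].
Proof. unfold prefix. rewrite seq_S, map_app. reflexivity. Qed.

Lemma pre_length (w : nat -> bool) (n : nat) : length (prefix w n) = n.
Proof. unfold prefix. rewrite length_map, length_seq. reflexivity. Qed.

Lemma pre_add (w : nat -> bool) (n k : nat) : prefix w (n + k) = prefix w n ++ map w (seq n k).
Proof. unfold prefix. rewrite seq_app, map_app. reflexivity. Qed.

Lemma wmat_pre_S (w : nat -> bool) (n : nat) :
  wmat (prefix w (S n)) = mmul (wmat (prefix w n)) (lmat (w n)).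
Proof. rewrite pre_S, wmat_app. f_equal. apply mmul_one_r. Qed.

Lemma minv_mul_l (A B : mat2) : SL2Z A -> mmul (minv A) (mmul A B) = B.
Proof.
  intros H. unfold SL2Z, mdet in H. rewrite <- mmul_assoc.
  replace (mmul (minv A) A) with mone; [apply mmul_one_l|].
  apply mat2_eq; cbn [mmul minv mone ma mb mc md]; lia.
Qed.

Lemma minv_mul_r (A B : mat2) : SL2Z A -> mmul A (mmul (minv A) B) = B.
Proof.
  intros H. unfold SL2Z, mdet in H. rewrite <- mmul_assoc.
  replace (mmul A (minv A)) with mone; [apply mmul_one_l|].
  apply mat2_eq; cbn [mmul minv mone ma mb mc md]; lia.
Qed.

Lemma letter_pre (w : nat -> bool) (n : nat) : letter (fun n => wmat (prefix w n)) n = lmat (w n).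
Proof. unfold letter. rewrite wmat_pre_S. apply minv_mul_l, wmat_nonneg. Qed.

Lemma is_farey_path_word (x : R) (A : nat -> mat2) :
  is_farey_path x A -> exists w, forall n, A n = wmat (prefix w n).
Proof.
  intros (HS & H0 & HL & _).
  exists (fun n => if excluded_middle_informative (letter A n = matT) then true else false).
  induction n as [|n IH]; [exact H0|].
  rewrite wmat_pre_S, <- IH, <- (minv_mul_r (A n) (A (S n))) by apply HS.
  f_equal. fold (letter A n). destruct (excluded_middle_informative _) as [E|E]; [exact E|].
  destruct (HL n); [contradiction|assumption].
Qed.

Lemma lact_le (b : bool) (z z' : R) : 0 <= z -> z <= z' -> lact b z <= lact b z'.
Proof.
  intros Hz H. destruct b; simpl; [lra|].
  apply Rle_div_l; [lra|]. replace (z' / (z' + 1) * (z + 1)) with (z' * (z + 1) / (z' + 1)) by (field; lra).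
  apply -> Rle_div_r; [|lra]. nra.
Qed.

Lemma act_le (l : list bool) (z z' : R) : 0 <= z -> z <= z' -> act l z <= act l z'.
Proof.
  intros Hz H. induction l as [|b l IH]; [exact H|].
  apply (lact_le b (act l z) (act l z')); [apply act_nonneg, Hz|exact IH].
Qed.

Lemma act_frac (l : list bool) (z : R) : 0 <= z ->
  act l z = (IZR (ma (wmat l)) * z + IZR (mb (wmat l))) / (IZR (mc (wmat l)) * z + IZR (md (wmat l))).
Proof. intros Hz. rewrite <- mobR_wmat by exact Hz. reflexivity. Qed.

(** The difference is (1 - z)/((cz + d)(c + d)). Since c and d are at least 1, cz + d >= z + 1 >= |1
    - z|, which makes the bound uniform in [z]. *)
Lemma act_dist (l : list bool) (z : R) : 0 <= z -> (1 <= mc (wmat l))%Z ->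
  Rabs (act l 1 - act l z) <= / IZR (mc (wmat l) + md (wmat l)).
Proof.
  intros Hz Hc. rewrite !act_frac by lra. apply IZR_le in Hc.
  destruct (wmat_real l) as (Hb & _ & Ha & Hd & Hdet). rewrite plus_IZR.
  set (a := IZR (ma (wmat l))) in *. set (b := IZR (mb (wmat l))) in *.
  set (c := IZR (mc (wmat l))) in *. set (d := IZR (md (wmat l))) in *.
  assert (Hz' : z + 1 <= c * z + d) by nra.
  replace ((a * 1 + b) / (c * 1 + d) - (a * z + b) / (c * z + d)) with ((1 - z) / (c * z + d) * / (c + d)).
  2:{ replace (1 - z) with ((a * d - b * c) * (1 - z)) by (rewrite Hdet; ring). field. lra. }
  rewrite Rabs_mult, (Rabs_pos_eq (/ (c + d))) by (left; apply Rinv_0_lt_compat; lra).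
  rewrite <- (Rmult_1_l (/ (c + d))) at 2.
  apply Rmult_le_compat_r; [left; apply Rinv_0_lt_compat; lra|].
  unfold Rdiv. rewrite Rabs_mult, (Rabs_pos_eq (/ (c * z + d))) by (left; apply Rinv_0_lt_compat; lra).
  apply (Rmult_le_reg_r (c * z + d)); [lra|]. rewrite Rmult_assoc, Rinv_l by lra.
  unfold Rabs; destruct (Rcase_abs (1 - z)); lra.
Qed.

(** From the first V on, c and d are positive; T raises c + d by c, and V raises it by d. *)
Lemma pre_denominators (w : nat -> bool) (n0 n : nat) : w n0 = false -> (n0 < n)%nat ->
  (1 <= mc (wmat (prefix w n)))%Z /\ (Z.of_nat (n - n0) <= mc (wmat (prefix w n)) + md (wmat (prefix w n)))%Z.
Proof.
  intros H0 Hn. induction Hn as [|n Hn IH]; rewrite wmat_pre_S.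
  - destruct (wmat_diag_pos (prefix w n0)). destruct (wmat_nonneg (prefix w n0)) as (_ & _ & _ & ? & _).
    rewrite H0. cbn [lmat mmul matV ma mb mc md]. lia.
  - destruct (wmat_diag_pos (prefix w n)). destruct (w n); cbn [lmat mmul matT matV ma mb mc md]; lia.
Qed.

Lemma pre_dist (w : nat -> bool) (n0 n : nat) (z : R) : w n0 = false -> (n0 < n)%nat -> 0 <= z ->
  Rabs (act (prefix w n) 1 - act (prefix w n) z) <= / INR (n - n0).
Proof.
  intros H0 Hn Hz. destruct (pre_denominators w n0 n H0 Hn) as [Hc Hs].
  eapply Rle_trans; [apply act_dist; assumption|].
  apply Rinv_le_contravar; [apply lt_0_INR; lia|]. rewrite INR_IZR_INZ. apply IZR_le, Hs.
Qed.

Lemma inv_INR_small (e : R) : 0 < e -> exists N, (0 < N)%nat /\ / INR N < e.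
Proof.
  intros He. destruct (archimed_cor1 e He) as [N [H1 H2]]. exists N. split; assumption.
Qed.

Lemma mobR_pre (w : nat -> bool) (n : nat) : mobR (wmat (prefix w n)) 1 = act (prefix w n) 1.
Proof. apply mobR_wmat; lra. Qed.

Lemma path_lim_of_tails (w : nat -> bool) (z : nat -> R) (x : R) :
  (forall n, 0 <= z n /\ act (prefix w n) (z n) = x) -> (exists n, w n = false) ->
  is_lim_seq (fun n => mobR (wmat (prefix w n)) 1) x.
Proof.
  intros Hz [n0 H0]. apply is_lim_seq_spec. intros eps.
  destruct (inv_INR_small eps (cond_pos eps)) as [N [HN1 HN2]].
  exists (n0 + N)%nat. intros n Hn. rewrite mobR_pre.
  destruct (Hz n) as [Hz1 <-].
  eapply Rle_lt_trans; [apply (pre_dist w n0); auto; lia|].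
  eapply Rle_lt_trans; [|exact HN2].
  apply Rinv_le_contravar; [apply lt_0_INR; lia|]. apply le_INR; lia.
Qed.

Definition infinitely_both (w : nat -> bool) : Prop :=
  (forall N, exists n, (N <= n)%nat /\ w n = true) /\ (forall N, exists n, (N <= n)%nat /\ w n = false).

Lemma path_lim_exists (w : nat -> bool) : infinitely_both w ->
  exists x, is_lim_seq (fun n => mobR (wmat (prefix w n)) 1) (Finite x).
Proof.
  intros [_ HV]. destruct (HV 0%nat) as [n0 [_ H0]].
  apply ex_lim_seq_cauchy_corr. intros eps.
  destruct (inv_INR_small (eps / 2)) as [N [HN1 HN2]]; [destruct eps; simpl; lra|].
  exists (n0 + N)%nat.
  assert (K : forall n, (n0 + N <= n)%nat -> Rabs (act (prefix w (n0 + N)) 1 - act (prefix w n) 1) < eps / 2).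
  { intros n Hn. replace n with ((n0 + N) + (n - (n0 + N)))%nat by lia. rewrite (pre_add w (n0 + N)), act_app.
    eapply Rle_lt_trans; [apply (pre_dist w n0); [exact H0|lia|left; apply act_pos; lra]|].
    replace (n0 + N - n0)%nat with N by lia. exact HN2. }
  intros n m Hn Hm. rewrite !mobR_pre.
  assert (K1 := K n Hn). assert (K2 := K m Hm).
  apply Rabs_lt_between in K1, K2. apply Rabs_lt_between. lra.
Qed.

(** The limit lies between b/d and a/c, the images of 0 and infinity; the products allow c = 0. *)
Lemma path_lim_bounds (w : nat -> bool) (x : R) (n : nat) :
  is_lim_seq (fun n => mobR (wmat (prefix w n)) 1) x ->
  IZR (mb (wmat (prefix w n))) <= x * IZR (md (wmat (prefix w n))) /\
  x * IZR (mc (wmat (prefix w n))) <= IZR (ma (wmat (prefix w n))).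
Proof.
  intros Hl. destruct (wmat_real (prefix w n)) as (Hb & Hc & Ha & Hd & Hdet).
  set (A := wmat (prefix w n)) in *.
  assert (Hm : forall m, (n <= m)%nat -> IZR (mb A) <= mobR (wmat (prefix w m)) 1 * IZR (md A) /\
     mobR (wmat (prefix w m)) 1 * IZR (mc A) <= IZR (ma A)).
  { intros m Hm. rewrite mobR_pre. replace m with (n + (m - n))%nat by lia. rewrite pre_add, act_app.
    set (z := act (map w (seq n (m - n))) 1). assert (Hz : 0 < z) by (apply act_pos; lra).
    rewrite act_frac by lra. fold A.
    assert (0 <= IZR (mc A) * z) by nra.
    split.
    - replace ((IZR (ma A) * z + IZR (mb A)) / (IZR (mc A) * z + IZR (md A)) * IZR (md A)) with
       (IZR (mb A) + (IZR (ma A) * IZR (md A) - IZR (mb A) * IZR (mc A)) * z / (IZR (mc A) * z + IZR (md A))) by (field; lra).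
      rewrite Hdet. assert (0 < 1 * z / (IZR (mc A) * z + IZR (md A))) by (apply Rdiv_lt_0_compat; lra). lra.
    - replace ((IZR (ma A) * z + IZR (mb A)) / (IZR (mc A) * z + IZR (md A)) * IZR (mc A)) with
       (IZR (ma A) - (IZR (ma A) * IZR (md A) - IZR (mb A) * IZR (mc A)) / (IZR (mc A) * z + IZR (md A))) by (field; lra).
      rewrite Hdet. assert (0 < 1 / (IZR (mc A) * z + IZR (md A))) by (apply Rdiv_lt_0_compat; lra). lra. }
  split.
  - apply (is_lim_seq_le_loc (fun _ => IZR (mb A)) (fun m => mobR (wmat (prefix w m)) 1 * IZR (md A)) (IZR (mb A)) (x * IZR (md A))).
    + exists n. intros m H. apply Hm, H.
    + apply is_lim_seq_const.
    + apply (is_lim_seq_scal_r _ (IZR (md A)) x Hl).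
  - apply (is_lim_seq_le_loc (fun m => mobR (wmat (prefix w m)) 1 * IZR (mc A)) (fun _ => IZR (ma A)) (x * IZR (mc A)) (IZR (ma A))).
    + exists n. intros m H. apply Hm, H.
    + apply (is_lim_seq_scal_r _ (IZR (mc A)) x Hl).
    + apply is_lim_seq_const.
Qed.

Lemma pre_denominators_mono (w : nat -> bool) (n k : nat) :
  (mc (wmat (prefix w n)) <= mc (wmat (prefix w (n + k))))%Z /\ (md (wmat (prefix w n)) <= md (wmat (prefix w (n + k))))%Z.
Proof.
  induction k as [|k IH]; [rewrite Nat.add_0_r; lia|]. rewrite Nat.add_succ_r, wmat_pre_S.
  destruct (wmat_nonneg (prefix w (n + k))) as (_ & _ & _ & ? & ?).
  destruct (w (n + k)%nat); cbn [lmat mmul matT matV ma mb mc md]; lia.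
Qed.

Lemma pre_denominators_unbounded (w : nat -> bool) (K : nat) : infinitely_both w ->
  exists n, (Z.of_nat K <= mc (wmat (prefix w n)))%Z /\ (Z.of_nat K <= md (wmat (prefix w n)))%Z.
Proof.
  intros [HT HV]. induction K as [|K [n [IH1 IH2]]].
  - exists 0%nat. simpl. lia.
  - destruct (HV n) as [m [Hm Em]]. destruct (HT (S m)) as [p [Hp Ep]]. exists (S p).
    destruct (pre_denominators_mono w n (m - n)) as [M1 M2]. replace (n + (m - n))%nat with m in * by lia.
    destruct (pre_denominators_mono w (S m) (p - S m)) as [M3 M4]. replace (S m + (p - S m))%nat with p in * by lia.
    destruct (wmat_diag_pos (prefix w m)) as [_ Hd].
    rewrite wmat_pre_S, Em in M3, M4. rewrite wmat_pre_S, Ep.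
    cbn [lmat mmul matT matV ma mb mc md] in *. lia.
Qed.

Lemma rational_frac (p q : Z) : (0 < q)%Z -> rational (IZR p / IZR q).
Proof.
  intros Hq. exists (QArith_base.Qmake p (Z.to_pos q)). unfold Q2R; simpl. rewrite Z2Pos.id by exact Hq. reflexivity.
Qed.

Lemma rational_act (l : list bool) : rational (act l 0) /\ rational (act l 1).
Proof.
  destruct (wmat_nonneg l) as (_ & _ & _ & Hc & _). destruct (wmat_diag_pos l) as [_ Hd].
  rewrite !act_frac by lra. rewrite !Rmult_0_r, !Rmult_1_r, !Rplus_0_l, <- !plus_IZR.
  split; apply rational_frac; lia.
Qed.

(** For a limit p/q, the integers u = pd - bq and v = aq - pc are non-negative and satisfy uc + vd =
    q. Once c and d exceed q, both must vanish, so q = 0. *)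
Lemma path_lim_irrational (w : nat -> bool) (x : R) : infinitely_both w ->
  is_lim_seq (fun n => mobR (wmat (prefix w n)) 1) x -> ~ rational x.
Proof.
  intros Hw Hl [[p qq] ->]. unfold Q2R in Hl; simpl in Hl.
  set (q := Zpos qq) in *.
  destruct (pre_denominators_unbounded w (S (Z.to_nat q)) Hw) as [n [Hc Hd]].
  destruct (path_lim_bounds w _ n Hl) as [B1 B2].
  destruct (wmat_nonneg (prefix w n)) as (HS & _). unfold SL2Z, mdet in HS.
  set (A := wmat (prefix w n)) in *.
  assert (Hq : 0 < IZR q) by (apply (IZR_lt 0); reflexivity).
  assert (Z1 : (mb A * q <= p * md A)%Z).
  { apply le_IZR. rewrite !mult_IZR. apply (Rmult_le_compat_r (IZR q)) in B1; [|lra].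
    replace (IZR p * / IZR q * IZR (md A) * IZR q) with (IZR p * IZR (md A)) in B1 by (field; lra). exact B1. }
  assert (Z2 : (p * mc A <= ma A * q)%Z).
  { apply le_IZR. rewrite !mult_IZR. apply (Rmult_le_compat_r (IZR q)) in B2; [|lra].
    replace (IZR p * / IZR q * IZR (mc A) * IZR q) with (IZR p * IZR (mc A)) in B2 by (field; lra). exact B2. }
  assert (Q0 : (0 < q)%Z) by reflexivity.
  set (u := (p * md A - mb A * q)%Z). set (v := (ma A * q - p * mc A)%Z).
  assert (E : (u * mc A + v * md A = q)%Z).
  { unfold u, v. transitivity (q * (ma A * md A - mb A * mc A))%Z; [ring|rewrite HS; ring]. }
  assert (U0 : (0 <= u)%Z) by (unfold u; lia). assert (V0 : (0 <= v)%Z) by (unfold v; lia).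
  assert (Hc' : (q < mc A)%Z) by lia. assert (Hd' : (q < md A)%Z) by lia.
  clear - E U0 V0 Hc' Hd' Q0.
  destruct (Z.eq_dec u 0) as [->|]; [|nia]. destruct (Z.eq_dec v 0) as [->|]; nia.
Qed.

(** T maps the positive axis above 1 and V maps it below 1, so the next letter tells on which side
    of [act (prefix w n) 1] the limit lies. A first disagreement of two paths thus forces equality
    with that rational point. *)
Lemma path_lim_vs_prefix (w : nat -> bool) (x : R) (n : nat) :
  is_lim_seq (fun n => mobR (wmat (prefix w n)) 1) x ->
  if w n then act (prefix w n) 1 <= x else x <= act (prefix w n) 1.
Proof.
  intros Hl.
  assert (K : forall m, (S n <= m)%nat -> exists z, 0 < z /\ mobR (wmat (prefix w m)) 1 = act (prefix w n) (lact (w n) z)).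
  { intros m Hm. exists (act (map w (seq (S n) (m - S n))) 1). split; [apply act_pos; lra|].
    rewrite mobR_pre. replace m with (S n + (m - S n))%nat at 1 by lia.
    rewrite pre_add, pre_S, !act_app. reflexivity. }
  destruct (w n).
  - apply (is_lim_seq_le_loc (fun _ => act (prefix w n) 1) (fun n => mobR (wmat (prefix w n)) 1) (act (prefix w n) 1) x);
      [|apply is_lim_seq_const|exact Hl].
    exists (S n). intros m Hm. destruct (K m Hm) as [z [Hz ->]]. apply act_le; simpl; lra.
  - apply (is_lim_seq_le_loc (fun n => mobR (wmat (prefix w n)) 1) (fun _ => act (prefix w n) 1) x (act (prefix w n) 1));
      [|exact Hl|apply is_lim_seq_const].
    exists (S n). intros m Hm. destruct (K m Hm) as [z [Hz ->]]. apply act_le; [apply lact_nonneg; lra|].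
    simpl. apply Rle_div_l; lra.
Qed.

Lemma path_unique (w w' : nat -> bool) (x : R) : ~ rational x ->
  is_lim_seq (fun n => mobR (wmat (prefix w n)) 1) x -> is_lim_seq (fun n => mobR (wmat (prefix w' n)) 1) x ->
  forall n, prefix w n = prefix w' n.
Proof.
  intros Hx H H' n. induction n as [|n IH]; [reflexivity|].
  rewrite !pre_S, IH. do 2 f_equal.
  assert (K := path_lim_vs_prefix w x n H). assert (K' := path_lim_vs_prefix w' x n H').
  rewrite IH in K.
  destruct (w n), (w' n); try reflexivity; exfalso; apply Hx;
  replace x with (act (prefix w' n) 1) by lra; apply rational_act.
Qed.

(** * Existence of the Farey path of a positive real *)

Section Expansion.
Variable x : R.
Hypothesis Hx : 0 < x.

(** Subtractive Euclidean algorithm. The tie at 1 goes to T: a rational [x] then reaches the tail 0,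
    from which V repeats forever, as the convention for rationals demands. *)
Fixpoint farey_tail (n : nat) : R :=
  match n with
  | O => x
  | S n => if Rle_dec 1 (farey_tail n) then farey_tail n - 1 else farey_tail n / (1 - farey_tail n)
  end.

Definition farey_letter (n : nat) : bool := if Rle_dec 1 (farey_tail n) then true else false.

Lemma farey_tail_nonneg (n : nat) : 0 <= farey_tail n.
Proof.
  induction n as [|n IH]; simpl; [lra|]. destruct (Rle_dec 1 (farey_tail n)); [lra|].
  apply Rmult_le_pos; [exact IH|]. left; apply Rinv_0_lt_compat; lra.
Qed.

Lemma act_farey_tail (n : nat) : act (prefix farey_letter n) (farey_tail n) = x.
Proof.
  induction n as [|n IH]; [reflexivity|]. rewrite pre_S, act_app.
  replace (act [farey_letter n] (farey_tail (S n))) with (farey_tail n); [exact IH|].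
  assert (P := farey_tail_nonneg n).
  cbn [act fold_right farey_tail]. unfold farey_letter. destruct (Rle_dec 1 (farey_tail n)); simpl; field. lra.
Qed.

Lemma farey_letters_zero (n : nat) : farey_tail n = 0 -> forall m, (n <= m)%nat -> farey_tail m = 0 /\ farey_letter m = false.
Proof.
  intros H m Hm. assert (E : farey_tail m = 0).
  { induction Hm as [|m Hm IH]; [exact H|]. cbn [farey_tail]. rewrite IH.
    destruct (Rle_dec 1 0); [lra|field]. }
  split; [exact E|]. unfold farey_letter. rewrite E. destruct (Rle_dec 1 0); [lra|reflexivity].
Qed.

(** [k] is fuel: each step subtracts the smaller of [p] and [q] from the other until [p] is 0. *)
Lemma farey_letters_rational_aux (k p q n : nat) : (p + q <= k)%nat -> (0 < q)%nat ->
  farey_tail n = INR p / INR q -> exists N, forall m, (N <= m)%nat -> farey_letter m = false.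
Proof.
  revert p q n. induction k as [|k IH]; intros p q n Hk Hq E; [lia|].
  assert (Pq : 0 < INR q) by (apply lt_0_INR; exact Hq).
  destruct (Nat.eq_dec p 0) as [->|Hp].
  - exists n. intros m Hm. apply (farey_letters_zero n); [rewrite E; simpl; field; lra|exact Hm].
  - destruct (Nat.le_gt_cases q p) as [L|L].
    + apply (IH (p - q)%nat q (S n)); [lia|lia|]. cbn [farey_tail]. rewrite E.
      destruct (Rle_dec 1 (INR p / INR q)) as [_|N].
      * rewrite minus_INR by exact L. field. lra.
      * exfalso. apply N. apply -> Rle_div_r; [|lra]. rewrite Rmult_1_l. apply le_INR, L.
    + assert (L' := lt_INR _ _ L). apply (IH p (q - p)%nat (S n)); [lia|lia|]. cbn [farey_tail]. rewrite E.
      destruct (Rle_dec 1 (INR p / INR q)) as [C|_].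
      * exfalso. apply (Rmult_le_compat_r (INR q)) in C; [|lra].
        replace (INR p / INR q * INR q) with (INR p) in C by (field; lra). lra.
      * rewrite minus_INR by lia. field. lra.
Qed.

Lemma farey_letters_rational : rational x -> exists N, forall n, (N <= n)%nat -> farey_letter n = false.
Proof.
  intros [[p q] E]. unfold Q2R in E; simpl in E.
  assert (Pq : 0 < IZR (Zpos q)) by (apply (IZR_lt 0); reflexivity).
  assert (Pp : (0 < p)%Z).
  { apply lt_IZR. apply (Rmult_lt_reg_r (/ IZR (Zpos q))); [apply Rinv_0_lt_compat, Pq|]. lra. }
  apply (farey_letters_rational_aux _ (Z.to_nat p) (Pos.to_nat q) 0 (Nat.le_refl _)); [lia|].
  simpl. rewrite !INR_IZR_INZ, Z2Nat.id, positive_nat_Z by lia. exact E.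
Qed.

(** If T stopped, the reciprocal of the tail would lose 1 at each step; if V stopped, the tail
    itself would. Either eventually contradicts the sign of the tail. *)
Lemma farey_letters_irrational : ~ rational x -> infinitely_both farey_letter.
Proof.
  intros Hr. split; intros N; apply NNPP; intros H.
  - assert (K : forall n, (N <= n)%nat -> farey_tail n < 1).
    { intros n Hn. destruct (Rle_lt_dec 1 (farey_tail n)) as [L|L]; [|exact L].
      exfalso. apply H. exists n. split; [exact Hn|]. unfold farey_letter. destruct (Rle_dec 1 (farey_tail n)); [reflexivity|lra]. }
    assert (P : 0 < farey_tail N).
    { destruct (Req_dec (farey_tail N) 0) as [E|E]; [|assert (Q := farey_tail_nonneg N); lra].
      exfalso. apply Hr. rewrite <- (act_farey_tail N), E. apply rational_act. }
    assert (Q : forall k, 0 < farey_tail (N + k) /\ / farey_tail (N + k) = / farey_tail N - INR k).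
    { induction k as [|k [IH1 IH2]]; [rewrite Nat.add_0_r; simpl; lra|].
      rewrite Nat.add_succ_r. cbn [farey_tail]. assert (L := K (N + k)%nat ltac:(lia)).
      destruct (Rle_dec 1 (farey_tail (N + k))) as [C|_]; [lra|].
      split; [apply Rdiv_lt_0_compat; lra|]. rewrite S_INR.
      replace (/ (farey_tail (N + k) / (1 - farey_tail (N + k)))) with (/ farey_tail (N + k) - 1) by (field; lra). lra. }
    destruct (INR_unbounded (/ farey_tail N)) as [k Hk]. destruct (Q k) as [Q1 Q2].
    apply Rinv_0_lt_compat in Q1. lra.
  - assert (K : forall n, (N <= n)%nat -> 1 <= farey_tail n).
    { intros n Hn. destruct (Rle_lt_dec 1 (farey_tail n)) as [L|L]; [exact L|].
      exfalso. apply H. exists n. split; [exact Hn|]. unfold farey_letter. destruct (Rle_dec 1 (farey_tail n)); [lra|reflexivity]. }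
    assert (Q : forall k, farey_tail (N + k) = farey_tail N - INR k).
    { induction k as [|k IH]; [rewrite Nat.add_0_r; simpl; lra|].
      rewrite Nat.add_succ_r. cbn [farey_tail]. assert (L := K (N + k)%nat ltac:(lia)).
      destruct (Rle_dec 1 (farey_tail (N + k))) as [_|C]; [|lra]. rewrite S_INR. lra. }
    destruct (INR_unbounded (farey_tail N)) as [k Hk]. assert (Q' := farey_tail_nonneg (N + k)). rewrite Q in Q'. lra.
Qed.

Lemma is_farey_path_exists : is_farey_path x (fun n => wmat (prefix farey_letter n)).
Proof.
  split; [intros; apply wmat_nonneg|]. split; [reflexivity|].
  split; [intros n; rewrite letter_pre; destruct (farey_letter n); auto|].
  split; [|split].
  - apply (path_lim_of_tails _ farey_tail).
    + intros n. split; [apply farey_tail_nonneg|apply act_farey_tail].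
    + destruct (classic (rational x)) as [Hr|Hr].
      * destruct (farey_letters_rational Hr) as [N HN]. exists N. apply HN; lia.
      * destruct (proj2 (farey_letters_irrational Hr) 0%nat) as [n [_ Hn]]. exists n. exact Hn.
  - intros Hr. destruct (farey_letters_irrational Hr) as [HT HV].
    split; intros N; [destruct (HT N) as [n [Hn E]]|destruct (HV N) as [n [Hn E]]]; exists n; (split; [exact Hn|]);
    rewrite letter_pre, E; reflexivity.
  - intros Hr. destruct (farey_letters_rational Hr) as [N HN]. exists N. intros n Hn.
    rewrite letter_pre, (HN n Hn). reflexivity.
Qed.

Lemma farey_path_spec : is_farey_path x (farey_path x).
Proof. exact (epsilon_spec _ _ (ex_intro _ _ is_farey_path_exists)). Qed.
End Expansion.

(** Frees the later arguments from epsilon: a word with both letters infinitely often may be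
    prescribed, and it is the Farey path of its limit. *)
Lemma farey_path_of_word (w : nat -> bool) (x : R) : 0 < x -> infinitely_both w ->
  is_lim_seq (fun n => mobR (wmat (prefix w n)) 1) x ->
  forall n, farey_path x n = wmat (prefix w n).
Proof.
  intros Hx Hw Hl n. assert (Hs := farey_path_spec x Hx).
  destruct (is_farey_path_word _ _ Hs) as [w' Hw'].
  destruct Hs as (_ & _ & _ & Hl' & _).
  rewrite Hw'. f_equal. apply (path_unique w' w x (path_lim_irrational w x Hw Hl)).
  - apply (is_lim_seq_ext _ _ _ (fun n => f_equal (fun A => mobR A 1) (Hw' n)) Hl').
  - exact Hl.
Qed.

Lemma path_lim_pos (w : nat -> bool) (x : R) : infinitely_both w ->
  is_lim_seq (fun n => mobR (wmat (prefix w n)) 1) x -> 0 < x.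
Proof.
  intros [HT _] Hl. destruct (HT 0%nat) as [n [_ Hn]].
  destruct (path_lim_bounds w x (S n) Hl) as [B _]. rewrite wmat_pre_S, Hn in B.
  destruct (wmat_diag_pos (prefix w n)) as [Ha _].
  destruct (wmat_nonneg (prefix w n)) as (_ & _ & Hb & Hc & Hd).
  cbn [lmat mmul matT ma mb mc md] in B.
  assert (B1 : 1 <= IZR (ma (wmat (prefix w n)) * 1 + mb (wmat (prefix w n)) * 1)) by (apply IZR_le; lia).
  assert (B2 : 0 <= IZR (mc (wmat (prefix w n)) * 1 + md (wmat (prefix w n)) * 1)) by (apply IZR_le; lia).
  destruct (Rlt_le_dec 0 x) as [|H]; [assumption|nra].
Qed.

(** * Averages along words *)

Definition alternating (b : bool) (k : nat) : list bool := concat (repeat [b; negb b] k).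

Lemma alternating_S_r (b : bool) (k : nat) : alternating b (S k) = alternating b k ++ [b; negb b].
Proof.
  unfold alternating. induction k as [|k IH]; [reflexivity|].
  change (repeat [b; negb b] (S (S k))) with ([b; negb b] :: repeat [b; negb b] (S k)).
  rewrite concat_cons, IH at 1. rewrite app_assoc. reflexivity.
Qed.

Lemma alternating_rev (b : bool) (k : nat) : rev (alternating b k) = alternating (negb b) k.
Proof.
  induction k as [|k IH]; [reflexivity|]. rewrite alternating_S_r, rev_app_distr, IH.
  unfold alternating. simpl. rewrite Bool.negb_involutive. reflexivity.
Qed.

Lemma alternating_length (b : bool) (k : nat) : length (alternating b k) = (2 * k)%nat.
Proof.
  induction k as [|k IH]; [reflexivity|]. rewrite alternating_S_r, length_app, IH. simpl. lia.
Qed.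

Definition phi_orbit (b : bool) : R := if b then phi else / phi.

Lemma phi_orbit_pos (b : bool) : 0 < phi_orbit b.
Proof. destruct b; simpl; [exact phi_pos|apply Rinv_0_lt_compat, phi_pos]. Qed.

Lemma lact_phi (b : bool) : lact b (phi_orbit (negb b)) = phi_orbit b.
Proof.
  assert (H := phi_sqr). assert (P := phi_pos).
  destruct b; simpl; apply (Rmult_eq_reg_r phi); try lra.
  - field_simplify; lra.
  - rewrite <- H. field. lra.
Qed.

Lemma sqrt_sublinear (K e : R) : 0 <= K -> 0 < e ->
  exists N, forall n, (N <= n)%nat -> K * sqrt (INR n) + K < e * INR n.
Proof.
  intros HK He. set (d := (2 * K + 1) / e).
  assert (Hd : 0 < d) by (apply Rdiv_lt_0_compat; lra).
  destruct (INR_unbounded (d * d + 1)) as [N HN]. exists N. intros n Hn. apply le_INR in Hn.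
  assert (H0 := pos_INR n).
  assert (Q := sqrt_def (INR n) H0). set (r := sqrt (INR n)) in *.
  assert (R0 : 0 <= r) by apply sqrt_pos.
  assert (R1 : 1 <= r) by nra.
  assert (Rd : d < r) by nra.
  assert (Ed : e * d = 2 * K + 1) by (unfold d; field; lra).
  rewrite <- Q. assert (e * d < e * r) by (apply Rmult_lt_compat_l; lra).
  assert (2 * K + 1 < e * r) by lra.
  assert ((2 * K + 1) * r < e * r * r) by (apply Rmult_lt_compat_r; lra). nra.
Qed.

Lemma pre_offdiag (w : nat -> bool) (n0 n : nat) : w n0 = true -> (n0 < n)%nat -> (1 <= mb (wmat (prefix w n)))%Z.
Proof.
  intros H0 Hn. induction Hn as [|n Hn IH]; rewrite wmat_pre_S.
  - destruct (wmat_diag_pos (prefix w n0)). destruct (wmat_nonneg (prefix w n0)) as (_ & _ & ? & _).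
    rewrite H0. cbn [lmat mmul matT ma mb mc md]. lia.
  - destruct (wmat_diag_pos (prefix w n)). destruct (w n); cbn [lmat mmul matT matV ma mb mc md]; lia.
Qed.

Lemma pre_hyperbolic (w : nat -> bool) : infinitely_both w ->
  exists N, forall n, (N <= n)%nat -> hyperbolic (wmat (prefix w n)).
Proof.
  intros [HT HV]. destruct (HT 0%nat) as [n1 [_ E1]]. destruct (HV 0%nat) as [n2 [_ E2]].
  exists (S (n1 + n2)). intros n Hn. apply hyperbolic_word_offdiag. split.
  - apply (pre_offdiag w n1); [exact E1|lia].
  - apply (pre_denominators w n2); [exact E2|lia].
Qed.

(** * Bounds for [Lambda] and the values it attains *)

Section Main.
Variables (f : C -> C) (tau0 : C).
Hypothesis Hholo : forall z, upper_half z -> exists l, is_cderiv f z l.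
Hypothesis Hmod : forall A z, SL2Z A -> upper_half z -> f (mobC A z) = f z.
Hypothesis Hreal : forall t, PI / 3 <= t <= 2 * PI / 3 -> Im (f (circ t)) = 0 /\ 0 <= Farc f t.
Hypothesis Htau0 : upper_half tau0.

Let g := G f phi.
Let c := Cf f.
Let ReI (l : list bool) : R := Re (I_f f tau0 (wmat l)).

(* A stand-in for [ReI] defined on all words: the cyclic tails are cut off and replaced by 1. *)
Definition cut_sum (l : list bool) : R := suffix_sum f l 1 + suffix_sum f (rev l) 1.

Let g_nonneg : 0 <= g := G_nonneg f Hholo Hmod Hreal phi phi_pos.
Let c_nonneg : 0 <= c := Cf_nonneg f Hholo Hreal.

Lemma cut_sum_nonneg (l : list bool) : 0 <= cut_sum l.
Proof. apply Rplus_le_le_0_compat; apply suffix_sum_nonneg; auto; lra. Qed.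

Lemma ReI_nonhyperbolic (l : list bool) : ~ hyperbolic (wmat l) -> ReI l = 0.
Proof.
  intros H. unfold ReI, I_f. destruct (excluded_middle_informative _); [contradiction|reflexivity].
Qed.

Lemma ReI_bounds (l : list bool) : 0 <= ReI l <= 2 * g * INR (length l).
Proof.
  destruct (classic (hyperbolic (wmat l))) as [H|H].
  - destruct (I_f_word f tau0 Hholo Hmod Hreal Htau0 l H) as (u & v & Hu & Hv & Fv & Fu & E).
    unfold ReI. rewrite E.
    assert (N1 := suffix_sum_nonneg f Hholo Hmod Hreal l v Hv).
    assert (N2 := suffix_sum_nonneg f Hholo Hmod Hreal (rev l) u Hu).
    assert (B1 := suffix_sum_le f Hholo Hmod Hreal l v Hv).
    assert (B2 := suffix_sum_le f Hholo Hmod Hreal (rev l) u Hu).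
    rewrite Fv in B1. rewrite Fu, length_rev in B2. fold g in B1, B2. lra.
  - rewrite (ReI_nonhyperbolic l H). assert (P := pos_INR (length l)).
    assert (Q := Rmult_le_pos _ _ g_nonneg P). lra.
Qed.

Lemma ReI_le_cut_sum (l : list bool) : ReI l <= cut_sum l + 4 * c * sqrt (INR (length l)).
Proof.
  destruct (classic (hyperbolic (wmat l))) as [H|H].
  - destruct (I_f_word f tau0 Hholo Hmod Hreal Htau0 l H) as (u & v & Hu & Hv & Fv & Fu & E).
    unfold ReI. rewrite E. unfold cut_sum.
    assert (B1 := suffix_sum_osc f Hholo Hmod Hreal l v 1 Hv Rlt_0_1).
    assert (B2 := suffix_sum_osc f Hholo Hmod Hreal (rev l) u 1 Hu Rlt_0_1).
    rewrite length_rev in B2. fold c in B1, B2. lra.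
  - rewrite (ReI_nonhyperbolic l H). assert (P := cut_sum_nonneg l).
    assert (Q := Rmult_le_pos _ _ c_nonneg (sqrt_pos (INR (length l)))). lra.
Qed.

Lemma cut_sum_le_ReI (l : list bool) : hyperbolic (wmat l) -> cut_sum l <= ReI l + 4 * c * sqrt (INR (length l)).
Proof.
  intros H. destruct (I_f_word f tau0 Hholo Hmod Hreal Htau0 l H) as (u & v & Hu & Hv & Fv & Fu & E).
  unfold ReI. rewrite E. unfold cut_sum.
  assert (B1 := suffix_sum_osc f Hholo Hmod Hreal l 1 v Rlt_0_1 Hv).
  assert (B2 := suffix_sum_osc f Hholo Hmod Hreal (rev l) 1 u Rlt_0_1 Hu).
  rewrite length_rev in B2. fold c in B1, B2. lra.
Qed.

(** Concatenation only moves base points: [l] is evaluated at [act m 1] and [rev m] at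
    [act (rev l) 1], in place of 1. *)
Lemma cut_sum_app (l m : list bool) :
  Rabs (cut_sum (l ++ m) - cut_sum l - cut_sum m) <= 2 * c * sqrt (INR (length l)) + 2 * c * sqrt (INR (length m)).
Proof.
  unfold cut_sum. rewrite rev_app_distr, !suffix_sum_app.
  assert (P1 := act_pos m 1 Rlt_0_1). assert (P2 := act_pos (rev l) 1 Rlt_0_1).
  assert (B1 := suffix_sum_osc f Hholo Hmod Hreal l _ 1 P1 Rlt_0_1).
  assert (B2 := suffix_sum_osc f Hholo Hmod Hreal l 1 _ Rlt_0_1 P1).
  assert (B3 := suffix_sum_osc f Hholo Hmod Hreal (rev m) _ 1 P2 Rlt_0_1).
  assert (B4 := suffix_sum_osc f Hholo Hmod Hreal (rev m) 1 _ Rlt_0_1 P2).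
  rewrite length_rev in B3, B4. fold c in B1, B2, B3, B4. apply Rabs_le. lra.
Qed.

Lemma cut_sum_V (j : nat) : cut_sum (repeat false j) <= 4 * c * sqrt (INR j).
Proof.
  unfold cut_sum. rewrite rev_repeat. assert (B := suffix_sum_V f Hholo Hmod Hreal j). fold c in B. lra.
Qed.

Lemma suffix_sum_alternating (b : bool) (k : nat) :
  suffix_sum f (alternating b k) (phi_orbit b) = INR (2 * k) * g /\
  act (alternating b k) (phi_orbit b) = phi_orbit b.
Proof.
  assert (HG : forall b', G f (phi_orbit b') = g).
  { intros [|]; [reflexivity|]. apply (G_inv f Hholo Hmod). exact phi_pos. }
  induction k as [|k [IH1 IH2]]; [split; [simpl; ring|reflexivity]|].
  change (alternating b (S k)) with (b :: negb b :: alternating b k).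
  cbn [suffix_sum].
  change (act (b :: negb b :: alternating b k) (phi_orbit b)) with (lact b (lact (negb b) (act (alternating b k) (phi_orbit b)))).
  change (act (negb b :: alternating b k) (phi_orbit b)) with (lact (negb b) (act (alternating b k) (phi_orbit b))).
  assert (E : lact (negb b) (phi_orbit b) = phi_orbit (negb b)).
  { rewrite <- (Bool.negb_involutive b) at 2. apply lact_phi. }
  rewrite IH1, IH2, E, lact_phi.
  split; [|reflexivity]. rewrite !HG. replace (2 * S k)%nat with (S (S (2 * k))) by lia. rewrite !S_INR. ring.
Qed.

Lemma cut_sum_alternating (k : nat) :
  INR (2 * k) * (2 * g) <= cut_sum (alternating true k) + 4 * c * sqrt (INR (2 * k)).
Proof.
  unfold cut_sum. rewrite alternating_rev. simpl (negb true).
  destruct (suffix_sum_alternating true k) as [E1 _]. destruct (suffix_sum_alternating false k) as [E2 _].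
  assert (B1 := suffix_sum_osc f Hholo Hmod Hreal (alternating true k) _ 1 (phi_orbit_pos true) Rlt_0_1).
  assert (B2 := suffix_sum_osc f Hholo Hmod Hreal (alternating false k) _ 1 (phi_orbit_pos false) Rlt_0_1).
  rewrite E1 in B1. rewrite E2 in B2. rewrite alternating_length in B1, B2. fold c in B1, B2. lra.
Qed.

(** An upper limit asks for the lower estimate at infinitely many [n] only, so the greedy word need
    be checked from below only when it stands above its target. *)
Lemma Lambda_of_word (w : nat -> bool) (x v K : R) : infinitely_both w ->
  is_lim_seq (fun n => mobR (wmat (prefix w n)) 1) x -> 0 <= K ->
  (forall n, ReI (prefix w n) <= v * INR n + K * sqrt (INR n) + K) ->
  (forall N, exists n, (N <= n)%nat /\ v * INR n <= ReI (prefix w n) + K * sqrt (INR n) + K) ->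
  Lambda f tau0 (P1_fin x) = Finite v.
Proof.
  intros Hw Hl HK HU HL. assert (Hx := path_lim_pos w x Hw Hl).
  unfold Lambda. destruct (Rlt_dec 0 x) as [_|N]; [|contradiction].
  unfold Lambda_pos. apply is_LimSup_seq_unique.
  apply (is_LimSup_seq_ext (fun n => ReI (prefix w n) / INR n)).
  { intros n. unfold ReI. rewrite (farey_path_of_word w x Hx Hw Hl). reflexivity. }
  intros eps. destruct (sqrt_sublinear K eps HK (cond_pos eps)) as [N0 HN0]. split.
  - intros N. destruct (HL (S (N + N0))) as [n [Hn E]]. exists n. split; [lia|].
    specialize (HN0 n ltac:(lia)). assert (P : 0 < INR n) by (apply lt_0_INR; lia).
    apply (Rmult_lt_reg_r (INR n)); [exact P|].
    replace (ReI (prefix w n) / INR n * INR n) with (ReI (prefix w n)) by (field; lra). lra.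
  - exists (S N0). intros n Hn.
    specialize (HN0 n ltac:(lia)). assert (P : 0 < INR n) by (apply lt_0_INR; lia). specialize (HU n).
    apply (Rmult_lt_reg_r (INR n)); [exact P|].
    replace (ReI (prefix w n) / INR n * INR n) with (ReI (prefix w n)) by (field; lra). lra.
Qed.

Lemma pre_even_alternating (k : nat) : prefix Nat.even (2 * k) = alternating true k.
Proof.
  induction k as [|k IH]; [reflexivity|]. rewrite alternating_S_r, <- IH.
  replace (2 * S k)%nat with (S (S (2 * k))) by lia. rewrite !pre_S, <- app_assoc.
  rewrite Nat.even_succ, <- Nat.negb_even, Nat.even_mul. reflexivity.
Qed.

Lemma even_infinitely_both : infinitely_both Nat.even.
Proof.
  split; intros N.
  - exists (2 * N)%nat. split; [lia|]. rewrite Nat.even_mul. reflexivity.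
  - exists (S (2 * N)). split; [lia|]. rewrite Nat.even_succ, <- Nat.negb_even, Nat.even_mul. reflexivity.
Qed.

Lemma phi_path_lim : is_lim_seq (fun n => mobR (wmat (prefix Nat.even n)) 1) phi.
Proof.
  apply (path_lim_of_tails _ (fun n => phi_orbit (Nat.even n))).
  - intros n. split; [left; apply phi_orbit_pos|]. induction n as [|n IH]; [reflexivity|].
    rewrite pre_S, act_app. change (act [Nat.even n] (phi_orbit (Nat.even (S n)))) with (lact (Nat.even n) (phi_orbit (Nat.even (S n)))).
    rewrite Nat.even_succ, <- Nat.negb_even, lact_phi. exact IH.
  - exists 1%nat. reflexivity.
Qed.

Lemma Lambda_phi : Lambda f tau0 (P1_fin phi) = Finite (2 * g).
Proof.
  apply (Lambda_of_word Nat.even phi (2 * g) (8 * c) even_infinitely_both phi_path_lim); [lra| |].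
  - intros n. assert (B := ReI_bounds (prefix Nat.even n)). rewrite pre_length in B.
    assert (Q := Rmult_le_pos _ _ c_nonneg (sqrt_pos (INR n))). lra.
  - intros N. destruct (pre_hyperbolic _ even_infinitely_both) as [N0 H0].
    exists (2 * (N + N0))%nat. split; [lia|].
    assert (B1 := cut_sum_le_ReI _ (H0 (2 * (N + N0))%nat ltac:(lia))). rewrite pre_length in B1.
    assert (B2 := cut_sum_alternating (N + N0)). rewrite pre_even_alternating in *. lra.
Qed.

Lemma Lambda_pos_bounds (x : R) : 0 < x ->
  Rbar_le (Finite 0) (Lambda_pos f tau0 x) /\ Rbar_le (Lambda_pos f tau0 x) (Finite (2 * g)).
Proof.
  intros Hx. destruct (is_farey_path_word x _ (farey_path_spec x Hx)) as [w Hw].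
  assert (B : forall n, 0 <= Re (I_f f tau0 (farey_path x n)) <= 2 * g * INR n).
  { intros n. rewrite Hw. assert (Q := ReI_bounds (prefix w n)). rewrite pre_length in Q. exact Q. }
  unfold Lambda_pos.
  assert (K : forall n, (1 <= n)%nat -> 0 <= Re (I_f f tau0 (farey_path x n)) / INR n <= 2 * g).
  { intros n Hn. assert (P : 0 < INR n) by (apply lt_0_INR; lia). specialize (B n). split.
    - apply Rmult_le_pos; [lra|]. left; apply Rinv_0_lt_compat, P.
    - apply Rle_div_l; lra. }
  rewrite <- (LimSup_seq_const 0), <- (LimSup_seq_const (2 * g)).
  split; apply LimSup_le; exists 1%nat; intros n Hn; apply K, Hn.
Qed.

Lemma Lambda_bounds (x : P1R) :
  Rbar_le (Finite 0) (Lambda f tau0 x) /\ Rbar_le (Lambda f tau0 x) (Finite (2 * g)).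
Proof.
  destruct x as [x|]; simpl; [|split; simpl; lra].
  destruct (Rlt_dec 0 x) as [H|H]; [apply Lambda_pos_bounds, H|].
  destruct (Rlt_dec x 0) as [H'|H']; [apply Lambda_pos_bounds; lra|].
  split; simpl; lra.
Qed.

(* Every even position gets the letter T exactly when the running average is below v, so
   that the word is driven up by blocks TV and down by blocks VV. *)
Section Greedy.
Variable v : R.
Hypothesis Hv : 0 < v < 2 * g.

Definition greedy_choice (n : nat) (l : list bool) : bool :=
  if Nat.even n then (if Rlt_dec (cut_sum l) (v * INR n) then true else false) else false.

Fixpoint greedy_prefix (n : nat) : list bool :=
  match n with
  | O => []
  | S n => greedy_prefix n ++ [greedy_choice n (greedy_prefix n)]
  end.

Definition greedy (n : nat) : bool := greedy_choice n (greedy_prefix n).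

Lemma pre_greedy (n : nat) : prefix greedy n = greedy_prefix n.
Proof. induction n as [|n IH]; [reflexivity|]. rewrite pre_S, IH. reflexivity. Qed.

Lemma greedy_true (n : nat) : greedy n = true -> cut_sum (prefix greedy n) < v * INR n.
Proof.
  unfold greedy, greedy_choice. rewrite pre_greedy. destruct (Nat.even n); [|discriminate].
  destruct (Rlt_dec _ _); [auto|discriminate].
Qed.

Lemma greedy_even_false (m : nat) : greedy (2 * m) = false -> v * INR (2 * m) <= cut_sum (prefix greedy (2 * m)).
Proof.
  unfold greedy, greedy_choice. rewrite pre_greedy, Nat.even_mul. cbn [Nat.even orb].
  destruct (Rlt_dec _ _); [discriminate|lra].
Qed.

Lemma greedy_odd (m : nat) : greedy (S (2 * m)) = false.
Proof.
  unfold greedy, greedy_choice. rewrite Nat.even_succ, <- Nat.negb_even, Nat.even_mul. reflexivity.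
Qed.

Lemma pre_greedy_SS (m : nat) : prefix greedy (2 * S m) = prefix greedy (2 * m) ++ [greedy (2 * m); false].
Proof.
  replace (2 * S m)%nat with (S (S (2 * m))) by lia. rewrite !pre_S, <- app_assoc, greedy_odd. reflexivity.
Qed.

(** Otherwise the word ends in blocks TV, whose average tends to [2 * g > v], although the sum stays
    below [v * INR n] at every later even position. *)
Lemma greedy_often_above (m : nat) : exists k, (m <= k)%nat /\ greedy (2 * k) = false.
Proof.
  apply NNPP. intros H.
  assert (T : forall k, (m <= k)%nat -> greedy (2 * k) = true).
  { intros k Hk. destruct (greedy (2 * k)) eqn:E; [reflexivity|]. exfalso. apply H. exists k. auto. }
  assert (E : forall k, prefix greedy (2 * (m + k)) = prefix greedy (2 * m) ++ alternating true k).
  { induction k as [|k IH]; [rewrite Nat.add_0_r, app_nil_r; reflexivity|].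
    rewrite Nat.add_succ_r, pre_greedy_SS, IH, T, alternating_S_r, app_assoc by lia. reflexivity. }
  set (M := v * INR (2 * m) + 2 * c * sqrt (INR (2 * m))).
  assert (HM : 0 <= M).
  { assert (Q := Rmult_le_pos _ _ c_nonneg (sqrt_pos (INR (2 * m)))). assert (Q' := pos_INR (2 * m)).
    assert (Q'' := Rmult_le_pos v _ ltac:(lra) Q'). unfold M. lra. }
  destruct (sqrt_sublinear (6 * c + M) (2 * g - v)) as [k Hk]; [lra|lra|].
  specialize (Hk (2 * k)%nat ltac:(lia)).
  assert (A := greedy_true _ (T (m + k)%nat ltac:(lia))). rewrite E in A.
  assert (B := cut_sum_app (prefix greedy (2 * m)) (alternating true k)). rewrite pre_length, alternating_length in B.
  apply Rabs_le_between in B.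
  assert (D := cut_sum_alternating k). assert (P := cut_sum_nonneg (prefix greedy (2 * m))).
  rewrite Nat.mul_add_distr_l, plus_INR in A.
  assert (S0 := Rmult_le_pos _ _ HM (sqrt_pos (INR (2 * k)))).
  unfold M in *. lra.
Qed.

(** Otherwise the word ends in V only and its average tends to 0, below [v]. *)
Lemma greedy_often_below (m : nat) : exists k, (m <= k)%nat /\ greedy (2 * k) = true.
Proof.
  apply NNPP. intros H.
  assert (T : forall k, (m <= k)%nat -> greedy (2 * k) = false).
  { intros k Hk. destruct (greedy (2 * k)) eqn:E; [|reflexivity]. exfalso. apply H. exists k. auto. }
  assert (E : forall k, prefix greedy (2 * (m + k)) = prefix greedy (2 * m) ++ repeat false (2 * k)).
  { induction k as [|k IH]; [rewrite Nat.add_0_r, app_nil_r; reflexivity|].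
    rewrite Nat.add_succ_r, pre_greedy_SS, IH, T by lia.
    replace (2 * S k)%nat with (2 * k + 2)%nat by lia. rewrite repeat_app, app_assoc. reflexivity. }
  set (M := cut_sum (prefix greedy (2 * m)) + 2 * c * sqrt (INR (2 * m))).
  assert (HM : 0 <= M).
  { assert (Q := Rmult_le_pos _ _ c_nonneg (sqrt_pos (INR (2 * m)))).
    assert (P := cut_sum_nonneg (prefix greedy (2 * m))). unfold M. lra. }
  destruct (sqrt_sublinear (6 * c + M) v) as [k Hk]; [lra|lra|].
  specialize (Hk (2 * k)%nat ltac:(lia)).
  assert (A := greedy_even_false _ (T (m + k)%nat ltac:(lia))). rewrite E in A.
  assert (B := cut_sum_app (prefix greedy (2 * m)) (repeat false (2 * k))). rewrite pre_length, repeat_length in B.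
  apply Rabs_le_between in B.
  assert (D := cut_sum_V (2 * k)).
  rewrite Nat.mul_add_distr_l, plus_INR in A.
  assert (S0 := Rmult_le_pos _ _ HM (sqrt_pos (INR (2 * k)))).
  assert (S1 := Rmult_le_pos v _ ltac:(lra) (pos_INR (2 * m))).
  unfold M in *. lra.
Qed.

Lemma greedy_infinitely_both : infinitely_both greedy.
Proof.
  split; intros N.
  - destruct (greedy_often_below N) as [k [Hk E]]. exists (2 * k)%nat. split; [lia|exact E].
  - exists (S (2 * N)). split; [lia|apply greedy_odd].
Qed.

(* Everything after the last T is a run of V, whose contribution is sublinear. *)
Lemma greedy_last_T (n : nat) : exists p s j,
  prefix greedy n = p ++ s ++ repeat false j /\ (s = [] \/ s = [true]) /\ cut_sum p <= v * INR (length p).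
Proof.
  induction n as [|n (p & s & j & E & Hs & Hp)].
  - exists [], [], 0%nat. split; [reflexivity|]. split; [auto|]. unfold cut_sum; simpl; lra.
  - rewrite pre_S. destruct (greedy n) eqn:D.
    + exists (prefix greedy n), [true], 0%nat. split; [reflexivity|]. split; [auto|].
      rewrite pre_length. left. apply greedy_true, D.
    + exists p, s, (j + 1)%nat. split; [|auto]. rewrite E, repeat_app, <- !app_assoc. reflexivity.
Qed.

(** Before its last T the sum was at most [v] times the length; that letter and the run of V after
    it add little. The 12 is 4 for each of two uses of [cut_sum_app] and 4 for the run of V. *)
Lemma greedy_upper (n : nat) :
  cut_sum (prefix greedy n) <= v * INR n + 12 * c * sqrt (INR n) + cut_sum [true].
Proof.
  destruct (greedy_last_T n) as (p & s & j & E & Hs & Hp).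
  assert (L : (length p + (length s + j))%nat = n).
  { rewrite <- (pre_length greedy n), E, !length_app, repeat_length. reflexivity. }
  assert (B1 := cut_sum_app p (s ++ repeat false j)). assert (B2 := cut_sum_app s (repeat false j)).
  apply Rabs_le_between in B1, B2. rewrite length_app, repeat_length in B1. rewrite repeat_length in B2.
  assert (D := cut_sum_V j).
  assert (Hcs : cut_sum s <= cut_sum [true]).
  { destruct Hs as [-> | ->]; [|lra]. replace (cut_sum []) with 0 by (unfold cut_sum; simpl; ring). apply cut_sum_nonneg. }
  assert (Mono : forall k, (k <= n)%nat -> c * sqrt (INR k) <= c * sqrt (INR n)).
  { intros k Hk. apply Rmult_le_compat_l; [exact c_nonneg|]. apply sqrt_le_1; try apply pos_INR. apply le_INR, Hk. }
  assert (M1 := Mono (length p) ltac:(lia)). assert (M2 := Mono (length s + j)%nat ltac:(lia)).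
  assert (M3 := Mono (length s) ltac:(lia)). assert (M4 := Mono j ltac:(lia)).
  assert (Lp : v * INR (length p) <= v * INR n) by (apply Rmult_le_compat_l; [lra|apply le_INR; lia]).
  rewrite E. lra.
Qed.

Lemma Lambda_greedy : exists x, Lambda f tau0 (P1_fin x) = Finite v.
Proof.
  destruct (path_lim_exists greedy greedy_infinitely_both) as [x Hx]. exists x.
  assert (P := cut_sum_nonneg [true]).
  (* The 12 of [greedy_upper] plus 4 for passing from [cut_sum] to [ReI]. *)
  apply (Lambda_of_word greedy x v (16 * c + cut_sum [true]) greedy_infinitely_both Hx); [lra| |].
  - intros n. assert (B := ReI_le_cut_sum (prefix greedy n)). rewrite pre_length in B.
    assert (U := greedy_upper n). assert (Q := Rmult_le_pos _ _ P (sqrt_pos (INR n))). lra.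
  - intros N. destruct (pre_hyperbolic _ greedy_infinitely_both) as [N0 H0].
    destruct (greedy_often_above (N + N0)) as [k [Hk E]]. exists (2 * k)%nat. split; [lia|].
    assert (A := greedy_even_false k E).
    assert (B := cut_sum_le_ReI _ (H0 (2 * k)%nat ltac:(lia))). rewrite pre_length in B.
    assert (Q := Rmult_le_pos _ _ P (sqrt_pos (INR (2 * k)))).
    assert (Q' := Rmult_le_pos _ _ c_nonneg (sqrt_pos (INR (2 * k)))). lra.
Qed.
End Greedy.
End Main.

Theorem theorem1p7 (f : C -> C) (tau0 : C)
  (Hf : weakly_holomorphic_modular_function f)
  (Hf0 : exists tau : C, upper_half tau /\ f tau <> RtoC 0)
  (Hpos : forall t : R, PI / 3 <= t <= 2 * PI / 3 ->
     Im (f (Cexp (Ci * RtoC t)%C)) = 0 /\ 0 <= Re (f (Cexp (Ci * RtoC t)%C)))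
  (Htau0 : upper_half tau0) :
  is_finite (Lambda f tau0 (P1_fin phi)) /\
  (forall x : P1R,
     Rbar_le (Finite 0) (Lambda f tau0 x) /\
     Rbar_le (Lambda f tau0 x) (Lambda f tau0 (P1_fin phi))) /\
  (forall v : Rbar,
     (exists x : P1R, Lambda f tau0 x = v) <->
     (Rbar_le (Finite 0) v /\ Rbar_le v (Lambda f tau0 (P1_fin phi)))).
Proof.
  destruct Hf as (Hd & Hmod & _).
  assert (Hholo : forall z, upper_half z -> exists l, is_cderiv f z l).
  { intros z Hz. destruct (Hd z Hz) as [l Hl]. exists l. apply is_derive_is_cderiv, Hl. }
  assert (Hreal : forall t, PI / 3 <= t <= 2 * PI / 3 -> Im (f (circ t)) = 0 /\ 0 <= Farc f t).
  { intros t Ht. unfold Farc. rewrite <- Cexp_circ. apply Hpos, Ht. }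
  assert (B := Lambda_bounds f tau0 Hholo Hmod Hreal Htau0).
  rewrite (Lambda_phi f tau0 Hholo Hmod Hreal Htau0).
  split; [reflexivity|]. split; [exact B|].
  intros v. split; [intros [x <-]; apply B|]. intros [H0 H1].
  destruct v as [v| |]; [|contradiction|contradiction]. simpl in H0, H1.
  (* The greedy word needs [v] strictly inside the interval; the end points are attained at infinity
     and at [phi]. *)
  destruct H0 as [H0|<-]; [|exists P1_inf; reflexivity].
  destruct H1 as [H1| ->]; [|exists (P1_fin phi); apply (Lambda_phi f tau0 Hholo Hmod Hreal Htau0)].
  destruct (Lambda_greedy f tau0 Hholo Hmod Hreal Htau0 v (conj H0 H1)) as [x Hx].
  exists (P1_fin x). exact Hx.
Qed.
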